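(* Let $c>0$ and $T>0$. Assume that the exact real-valued solution $z$ of the ''good'' Boussinesq equation $$z_{tt}+z_{xxxx}-z_{xx}-(z^2)_{xx}=0,\quad x\in(-\pi,\pi),\ t>0,$$ with periodic boundary conditions satisfies $z(t)\in H^3$ and $z_t(t)\in H^1$ for $0\le t\le T$, with $\|z\|_{L^\infty(0,T;H^3)}+\|z_t\|_{L^\infty(0,T;H^1)}<\infty$. Let $u^0=z(0)-i\langle\partial_x^2\rangle_c^{-1}z_t(0)$, $u^{n+1}=\Psi^\tau(u^n)$ for $n\ge0$, with $\Psi^\tau$ the second-order exponential-type integrator defined in the context, and $$z^n=\frac12(u^n+\overline{u^n}),\qquad z_t^n=\frac i2\langle\partial_x^2\rangle_c(u^n-\overline{u^n}).$$ Then there exists a constant $\tau_0>0$ such that for all step sizes $0<\tau\le\tau_0$ and all $n\ge 0$ with $t_n=n\tau\le T$, $$\|z(t_n)-z^n\|+\|z_t(t_n)-z_t^n\|_{-2}\le C\tau^2,$$ where $C$ depends on $T$, $c$ and $\|z\|_{L^\infty(0,T;H^3)}+\|z_t\|_{L^\infty(0,T;H^1)}$.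
   Context: All functions are $2\pi$-periodic in $x$, $\Omega=(-\pi,\pi)$, with Fourier coefficients $\widehat f_k=\frac1{2\pi}\int_\Omega f(x)e^{-ikx}dx$. For $m\in\mathbb R$, $\|f\|_m^2=\sum_{k\in\mathbb Z}(1+k^2)^m|\widehat f_k|^2$, and $H^m$ is the space of periodic functions (distributions if $m<0$) with finite $\|\cdot\|_m$; $\|\cdot\|=\|\cdot\|_0$ is the $L^2$ norm; $(f,g)=\frac1{2\pi}\int_\Omega f\overline g\,dx$. Operators act as Fourier multipliers: $\partial_x^2$ by $-k^2$; $\langle\partial_x^2\rangle_c=\sqrt{\partial_x^4-\partial_x^2+c}$ by $\sqrt{k^4+k^2+c}$; $A=\partial_x^2+\langle\partial_x^2\rangle_c$; $e^{is\partial_x^2}$ by $e^{-isk^2}$; $\partial_x^{-2}$ by $-1/k^2$ for $k\ne0$ and by $0$ for $k=0$. Let $\psi_1(z)=\int_0^1e^{zs}ds$, $\psi_2(z)=\int_0^1se^{zs}ds$ for $z\in\mathbb{C}$; $\psi_j(2i\tau\partial_x^2)$ acts by $\psi_j(-2i\tau k^2)$. With $u=z-i\langle\partial_x^2\rangle_c^{-1}z_t$, the equation for real $z$ is equivalent to $\partial_tu=i\langle\partial_x^2\rangle_cu-\frac i4\langle\partial_x^2\rangle_c^{-1}[2c(u+\overline u)+\partial_x^2(u+\overline u)^2]$; solutions are understood in the sense of Duhamel's formula $u(t)=e^{it\langle\partial_x^2\rangle_c}u(0)-\frac i4\int_0^te^{i(t-s)\langle\partial_x^2\rangle_c}\langle\partial_x^2\rangle_c^{-1}\left[2c(u+\overline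 u)+\partial_x^2(u+\overline u)^2\right](s)\,ds$. The second-order integrator is $$\Psi^\tau(f)=e^{i\tau\langle\partial_x^2\rangle_c}f+\mathcal L(f)+\frac{\partial_x^2}{4}\langle\partial_x^2\rangle_c^{-1}e^{i\tau\langle\partial_x^2\rangle_c}\Big(-i\big[I_1^\tau(f)+\overline{I_1^\tau(f)}+2I_2^\tau(f)+I_3^\tau(f)-\tau\overline f^2\big]-A\big[J_1^\tau(f,f)+2J_2^\tau(f,f)+J_3^\tau(f,f)\big]$$ $$\qquad+2\big[J_1^\tau(f,\mathcal P(f))+J_2^\tau(\mathcal P(f),f)\big]-2\big[J_3^\tau(f,\mathcal P(f))+J_2^\tau(f,\mathcal P(f))\big]\Big),$$ where $$\mathcal P(f)=Af-\frac14\langle\partial_x^2\rangle_c^{-1}\left[2c(f+\overline f)+\partial_x^2(f+\overline f)^2\right],$$ $$\mathcal L(f)=-\frac{ic\tau}{2}\langle\partial_x^2\rangle_c^{-1}e^{i\tau\langle\partial_x^2\rangle_c}\Big[f-\frac{i\tau}{2}(Af-\mathcal P(f))+\psi_1(2i\tau\partial_x^2)\overline f-i\tau\psi_2(2i\tau\partial_x^2)\big(A\overline f+\overline{\mathcal P(f)}\big)\Big],$$ $$I_1^\tau(f)=\int_0^\tau e^{is\partial_x^2}(e^{-is\partial_x^2}f)^2ds,\quad I_2^\tau(f)=\int_0^\tau e^{is\partial_x^2}|e^{-is\partial_x^2}f|^2ds,\quad I_3^\tau(f)=\tau\psi_1(2i\tau\partial_x^2)(\overline f)^2,$$ $$J_1^\tau(f,g)=\int_0^\tau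 se^{is\partial_x^2}(e^{-is\partial_x^2}f)(e^{-is\partial_x^2}g)ds,\quad J_2^\tau(f,g)=\int_0^\tau se^{is\partial_x^2}(e^{-is\partial_x^2}f)(e^{is\partial_x^2}\overline g)ds,$$ $$J_3^\tau(f,g)=-\frac{i\tau}2e^{2i\tau\partial_x^2}\partial_x^{-2}(\overline{fg})+\frac{i\tau}2\psi_1(2i\tau\partial_x^2)\partial_x^{-2}(\overline{fg})+\frac{\tau^2}2(\overline f,g).$$ In each integral $e^{is\partial_x^2}$ on the far left acts on the whole product following it. *)

(* Defs.v *)
From HB Require Import structures.
From mathcomp Require Import all_boot all_order all_algebra.
From mathcomp Require Import all_classical all_reals all_analysis.
From mathcomp Require Import ess_sup_inf complex.

Set Implicit Arguments.
Unset Strict Implicit.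
Unset Printing Implicit Defensive.

Import Order.TTheory GRing.Theory Num.Theory.
Import numFieldNormedType.Exports.
Local Open Scope classical_set_scope.
Local Open Scope ring_scope.
Local Open Scope complex_scope.

(* Functions of x are maps R -> R[i]; functions that agree almost everywhere
   have the same Fourier coefficients, hence the same image under every
   operator below. *)

Section Complex.
Context {R : realType}.
Implicit Types (D : set R) (f : R -> R[i]) (u : nat -> R[i]).

Definition cis (t : R) : R[i] := cos t +i* sin t.

Definition cexp (z : R[i]) : R[i] := (expR (complex.Re z))%:C * cis (complex.Im z).

Definition clim u : R[i] :=
  limn (fun n => complex.Re (u n)) +i* limn (fun n => complex.Im (u n)).

Definition cint D f : R[i] :=
  (\int[lebesgue_measure]_(x in D) complex.Re (f x))
  +i* (\int[lebesgue_measure]_(x in D) complex.Im (f x)).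

Definition conjf f : R -> R[i] := fun x => conjc (f x).

Definition toC (g : R -> R) : R -> R[i] := fun x => (g x)%:C.

Definition psi1 (z : R[i]) : R[i] := cint `[0, 1] (fun s => cexp (z * s%:C)).

Definition psi2 (z : R[i]) : R[i] :=
  cint `[0, 1] (fun s => s%:C * cexp (z * s%:C)).

End Complex.

Section Fourier.
Context {R : realType}.
Implicit Types (f g : R -> R[i]) (k : int) (m : R).

Definition Omega : set R := `]- pi, pi[.

Definition fourier f k : R[i] :=
  ((2 * pi)^-1)%:C * cint Omega (fun x => f x * cis (- (k%:~R * x))).

Definition inner f g : R[i] :=
  ((2 * pi)^-1)%:C * cint Omega (fun x => f x * conjc (g x)).

Definition sobolev_norm m f : \bar R :=
  sqrte (\esum_(k in [set: int])
    (((1 + k%:~R ^+ 2) `^ m) * Normc.normc (fourier f k) ^+ 2)%:E).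

(* For m < 0 this only contains the elements of H^m that are functions. *)
Definition in_H m f : Prop :=
  [/\ periodic f (pi *+ 2),
      lebesgue_measure.-integrable Omega (EFin \o (fun x => complex.Re (f x))),
      lebesgue_measure.-integrable Omega (EFin \o (fun x => complex.Im (f x))) &
      (sobolev_norm m f < +oo)%E].

(* The Fourier multiplier f |-> \sum_k s(k) f^_k e^{ikx}, the series being the
   limit of its symmetric partial sums over -N <= k <= N. *)
Definition fmult (s : int -> R[i]) f : R -> R[i] := fun x =>
  clim (fun N => \sum_(j < N.*2.+1)
    (let k : int := j%:Z - N%:Z in s k * fourier f k * cis (k%:~R * x))).

Definition dxx : (R -> R[i]) -> R -> R[i] :=
  fmult (fun k => (- (k%:~R ^+ 2))%:C).

Definition dxx_inv : (R -> R[i]) -> R -> R[i] :=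
  fmult (fun k => if k == 0 then 0 else (- (k%:~R ^+ 2)^-1)%:C).

Definition exp_dxx (s : R) : (R -> R[i]) -> R -> R[i] :=
  fmult (fun k => cis (- (s * k%:~R ^+ 2))).

Definition psi1_dxx (tau : R) : (R -> R[i]) -> R -> R[i] :=
  fmult (fun k => psi1 (0 +i* (- (2 * tau * k%:~R ^+ 2)))).

Definition psi2_dxx (tau : R) : (R -> R[i]) -> R -> R[i] :=
  fmult (fun k => psi2 (0 +i* (- (2 * tau * k%:~R ^+ 2)))).

Definition omega (c : R) k : R :=
  Num.sqrt (k%:~R ^+ 4 + k%:~R ^+ 2 + c).

(* <dxx>_c *)
Definition bra (c : R) : (R -> R[i]) -> R -> R[i] :=
  fmult (fun k => (omega c k)%:C).

Definition bra_inv (c : R) : (R -> R[i]) -> R -> R[i] :=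
  fmult (fun k => ((omega c k)^-1)%:C).

Definition exp_bra (c s : R) : (R -> R[i]) -> R -> R[i] :=
  fmult (fun k => cis (s * omega c k)).

Definition Aop (c : R) : (R -> R[i]) -> R -> R[i] :=
  fmult (fun k => (- (k%:~R ^+ 2) + omega c k)%:C).

End Fourier.

Section Equation.
Context {R : realType}.
Implicit Types (c t T m : R) (z zt : R -> R -> R) (f : R -> R[i]).

Definition nonlin c f : R -> R[i] :=
  let h := f \+ conjf f in ((2 * c)%:C \*o h) \+ dxx (h \* h).

Definition u_of c z zt t : R -> R[i] :=
  toC (z t) \- ('i \*o bra_inv c (toC (zt t))).

(* As H^m is separable, Bochner measurability of t |-> w(t) in H^m amounts to
   measurability of each Fourier coefficient. *)
Definition time_measurable T (w : R -> R -> R[i]) : Prop :=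
  forall k : int,
    measurable_fun `[0, T] (fun t => complex.Re (fourier (w t) k)) /\
    measurable_fun `[0, T] (fun t => complex.Im (fourier (w t) k)).

Definition Linf_norm T m (w : R -> R -> R[i]) : \bar R :=
  ess_sup
    (mrestr (@lebesgue_measure R) (measurable_itv `]0, T[))
    (fun t => sobolev_norm m (w t)).

(* The second clause says that zt is the (weak) time derivative of z; the third
   is Duhamel's formula, with functions of x identified when equal a.e. The
   Bochner integrals of the formula are computed pointwise in x, their integrands
   being H^s-valued with s > 1/2. The second clause is in fact implied by the
   third and is only there to tie zt to z explicitly. *)
Definition boussinesq_solution c T z zt : Prop :=
  let u := u_of c z zt in
  [/\ time_measurable T (fun t => toC (z t)) /\
      time_measurable T (fun t => toC (zt t)),
      forall (t : R) (k : int), 0 <= t <= T ->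
        fourier (toC (z t)) k = fourier (toC (z 0)) k
          + cint `[0, t] (fun s => fourier (toC (zt s)) k) &
      forall t : R, 0 <= t <= T ->
        {ae lebesgue_measure, forall x : R,
          u t x = exp_bra c t (u 0) x
            - 'i * 4^-1 * cint `[0, t]
                (fun s => exp_bra c (t - s) (bra_inv c (nonlin c (u s))) x)}].

End Equation.

Section Integrator.
Context {R : realType}.
Implicit Types (c tau : R) (f g : R -> R[i]).

Definition I1 tau f : R -> R[i] := fun x => cint `[0, tau] (fun s =>
  exp_dxx s (exp_dxx (- s) f \* exp_dxx (- s) f) x).

Definition I2 tau f : R -> R[i] := fun x => cint `[0, tau] (fun s =>
  exp_dxx s (exp_dxx (- s) f \* conjf (exp_dxx (- s) f)) x).

Definition I3 tau f : R -> R[i] :=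
  tau%:C \*o psi1_dxx tau (conjf f \* conjf f).

Definition J1 tau f g : R -> R[i] := fun x => cint `[0, tau] (fun s =>
  s%:C * exp_dxx s (exp_dxx (- s) f \* exp_dxx (- s) g) x).

Definition J2 tau f g : R -> R[i] := fun x => cint `[0, tau] (fun s =>
  s%:C * exp_dxx s (exp_dxx (- s) f \* exp_dxx s (conjf g)) x).

Definition J3 tau f g : R -> R[i] := fun x =>
  let q := dxx_inv (conjf (f \* g)) in
  - ('i * tau%:C / 2) * exp_dxx (2 * tau) q x
  + 'i * tau%:C / 2 * psi1_dxx tau q x
  + tau%:C ^+ 2 / 2 * inner (conjf f) g.

Definition Pop c f : R -> R[i] :=
  Aop c f \- (4^-1 \*o bra_inv c (nonlin c f)).

Definition Lop c tau f : R -> R[i] :=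
  (- ('i * c%:C * tau%:C / 2)) \*o bra_inv c (exp_bra c tau
    (f \- (('i * tau%:C / 2) \*o (Aop c f \- Pop c f))
       \+ psi1_dxx tau (conjf f)
       \- (('i * tau%:C) \*o
             psi2_dxx tau (Aop c (conjf f) \+ conjf (Pop c f))))).

Definition Psi c tau f : R -> R[i] :=
  let p := Pop c f in
  exp_bra c tau f \+ Lop c tau f \+
  (4^-1 \*o dxx (bra_inv c (exp_bra c tau
    (((- 'i) \*o (I1 tau f \+ conjf (I1 tau f) \+ (2 \*o I2 tau f)
                  \+ I3 tau f \- (tau%:C \*o (conjf f \* conjf f))))
     \- Aop c (J1 tau f f \+ (2 \*o J2 tau f f) \+ J3 tau f f)
     \+ (2 \*o (J1 tau f p \+ J2 tau p f))
     \- (2 \*o (J3 tau f p \+ J2 tau f p)))))).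

Definition u_num c tau (u0 : R -> R[i]) (n : nat) : R -> R[i] :=
  iter n (Psi c tau) u0.

Definition z_num c tau u0 n : R -> R[i] :=
  2^-1 \*o (u_num c tau u0 n \+ conjf (u_num c tau u0 n)).

Definition zt_num c tau u0 n : R -> R[i] :=
  ('i / 2) \*o bra c (u_num c tau u0 n \- conjf (u_num c tau u0 n)).

End Integrator.

(* Main.v *)
Require Import Defs.
From mathcomp Require Import all_boot all_order all_algebra.
From mathcomp Require Import all_classical all_reals all_analysis.
From mathcomp Require Import measurable_realfun ess_sup_inf complex ring lra zify.

Set Implicit Arguments.
Unset Strict Implicit.
Unset Printing Implicit Defensive.

Import Order.TTheory GRing.Theory Num.Theory.
Import numFieldNormedType.Exports.
Local Open Scope classical_set_scope.
Local Open Scope ring_scope.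
Local Open Scope complex_scope.

(** Everything happens on Fourier coefficients. The operator <dxx>_c is -dxx + A,
    where the symbol of A lies between 0 and 1 + c, so in the frame of the free
    flow, v(s) = e^(i s dxx) u(t + s), the solution moves slowly: Duhamel's formula
    gives v(s) = v(0) + O(s) in H^3 and v(s) = v(0) + i s P(v(0)) + O(s^2) in l1 and
    in l2, where P is the operator of the scheme ([vincr_bd], [vrem_bd]). Inserted
    in the Duhamel integral over one step, this expansion produces the integrand of
    the scheme up to O(s^2), with a single exception. The product of the two
    conjugate factors oscillates like e^(-i s (j^2 + (k - j)^2 + k^2)) on the pair
    (j, k - j), and its time integral is not a product in x; the scheme replaces
    this phase by a sum of three phases for which it is. The replacement error has
    kernel (e^(i a) - 1) (e^(i b) - 1) with a = -2 s k^2 and b = 2 s j (k - j). For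
    data in H^3 it is O(s^2) in l2, three of the four derivatives falling on one
    factor, but bounding it in l1 leaves only O(s) ([lp_gap2], [lp_gap1]). The local
    error is therefore O(tau^3) in l2 and O(tau^2) in l1 ([local_error]).

    By Young's inequality, one step of the scheme expands distances in l1 and in l2
    by a factor 1 + O(tau) on bounded sets of l1 ([step_coef_stable]). First-order
    convergence in l1 follows as long as the iterates stay bounded in l1, and for
    small tau that same estimate keeps them bounded; stability in l2 then gives the
    rate tau^2 in L^2 ([converges]). As z is the real part of u, and z_t is the
    operator <dxx>_c applied to minus its imaginary part, this is the theorem
    ([error_bound]).

    Two translations precede this argument. A field of the scheme is identified
    with its coefficients ([rep]); products become convolutions because an
    integrable function with summable coefficients is almost everywhere the sum of
    its Fourier series, which rests on the uniqueness of Fourier coefficients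
    ([fourier_uniq]), and all multipliers of the scheme, including the one of J_3,
    become time integrals of oscillating exponentials ([rep_Psi]). On the side of
    the exact solution, Duhamel's formula, which holds almost everywhere in x,
    becomes a formula for coefficients, and it propagates the bound in H^3 from
    almost every time to every time ([ucoef_sup], [duhamel]). Time integrals of
    sequences are estimated by Minkowski's inequality ([lp_cint]). *)

(** * Complex modulus and unit exponentials *)

Notation nm := Normc.normc.
Arguments Normc.normc : simpl never.

Section ComplexModulus.
Context {R : realType}.
Implicit Types (x y z : R[i]) (t : R).

Lemma eq_ler (s t : R) : s = t -> s <= t.
Proof. by move=> ->. Qed.

Lemma nmE x : nm x = Num.sqrt (complex.Re x ^+ 2 + complex.Im x ^+ 2).
Proof. by case: x. Qed.

Lemma nm_ge0 x : 0 <= nm x.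
Proof. by rewrite nmE sqrtr_ge0. Qed.

Lemma sqr_nm x : nm x ^+ 2 = complex.Re x ^+ 2 + complex.Im x ^+ 2.
Proof. by rewrite nmE sqr_sqrtr // addr_ge0 // sqr_ge0. Qed.

Lemma nmM x y : nm (x * y) = nm x * nm y.
Proof. exact: Normc.normcM. Qed.

Lemma nmD x y : nm (x + y) <= nm x + nm y.
Proof. exact: le_normcD. Qed.

Lemma nmN x : nm (- x) = nm x.
Proof. exact: normcN. Qed.

Lemma nmB x y : nm (x - y) <= nm x + nm y.
Proof. by rewrite -(nmN y) nmD. Qed.

Lemma nm0 : nm (0 : R[i]) = 0.
Proof. exact: Normc.normc0. Qed.

Lemma nm1 : nm (1 : R[i]) = 1.
Proof. exact: Normc.normc1. Qed.

Lemma nm_real t : nm (t%:C) = `|t|.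
Proof. by rewrite nmE /= expr0n addr0 sqrtr_sqr. Qed.

Lemma nmi : nm ('i : R[i]) = 1.
Proof. by rewrite nmE /= expr0n add0r expr1n sqrtr1. Qed.

Lemma nm_conj x : nm (conjc x) = nm x.
Proof. by rewrite !nmE; case: x => a b /=; rewrite sqrrN. Qed.

Lemma Re_le_nm x : `|complex.Re x| <= nm x.
Proof.
rewrite nmE -sqrtr_sqr ler_wsqrtr //.
by rewrite lerDl sqr_ge0.
Qed.

Lemma Im_le_nm x : `|complex.Im x| <= nm x.
Proof.
rewrite nmE -sqrtr_sqr ler_wsqrtr //.
by rewrite lerDr sqr_ge0.
Qed.

Lemma nm_le_ReIm x : nm x <= `|complex.Re x| + `|complex.Im x|.
Proof.
rewrite -(ler_pXn2r (n := 2)) ?nnegrE ?nm_ge0 ?addr_ge0 //.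
rewrite sqr_nm sqrrD !real_normK ?num_real // lerD2r lerDl.
by rewrite mulrn_wge0 // mulr_ge0.
Qed.

Lemma nm_sum I (r : seq I) (F : I -> R[i]) :
  nm (\sum_(i <- r) F i) <= \sum_(i <- r) nm (F i).
Proof.
elim: r => [|i r IH]; first by rewrite !big_nil nm0.
by rewrite !big_cons (le_trans (nmD _ _)) // lerD2l.
Qed.

Lemma cReD x y : complex.Re (x + y) = complex.Re x + complex.Re y.
Proof. by case: x y => [? ?] [? ?]. Qed.
Lemma cImD x y : complex.Im (x + y) = complex.Im x + complex.Im y.
Proof. by case: x y => [? ?] [? ?]. Qed.
Lemma cReN x : complex.Re (- x) = - complex.Re x.
Proof. by case: x. Qed.
Lemma cImN x : complex.Im (- x) = - complex.Im x.
Proof. by case: x. Qed.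
Lemma cReM x y : complex.Re (x * y) =
  complex.Re x * complex.Re y - complex.Im x * complex.Im y.
Proof. by case: x y => [? ?] [? ?]. Qed.
Lemma cImM x y : complex.Im (x * y) =
  complex.Re x * complex.Im y + complex.Im x * complex.Re y.
Proof. by case: x y => [? ?] [? ?]. Qed.
Lemma cReJ x : complex.Re (conjc x) = complex.Re x.
Proof. by case: x. Qed.
Lemma cImJ x : complex.Im (conjc x) = - complex.Im x.
Proof. by case: x. Qed.
Lemma conjcM x y : conjc (x * y) = conjc x * conjc y.
Proof. exact: rmorphM. Qed.
Lemma conjcD x y : conjc (x + y) = conjc x + conjc y.
Proof. exact: rmorphD. Qed.
Lemma conjcN x : conjc (- x) = - conjc x.
Proof. exact: rmorphN. Qed.
Lemma cRe_sum I (r : seq I) (F : I -> R[i]) :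
  complex.Re (\sum_(i <- r) F i) = \sum_(i <- r) complex.Re (F i).
Proof. by apply: (big_morph (@complex.Re R)) => // x y; exact: cReD. Qed.
Lemma cIm_sum I (r : seq I) (F : I -> R[i]) :
  complex.Im (\sum_(i <- r) F i) = \sum_(i <- r) complex.Im (F i).
Proof. by apply: (big_morph (@complex.Im R)) => // x y; exact: cImD. Qed.

Lemma complex_eq x y :
  complex.Re x = complex.Re y -> complex.Im x = complex.Im y -> x = y.
Proof. by case: x y => [? ?] [? ?] /= -> ->. Qed.

Lemma cis0 : cis 0 = 1 :> R[i].
Proof. by rewrite /cis cos0 sin0. Qed.

Lemma cisD s t : cis (s + t) = cis s * cis t :> R[i].
Proof.
by apply: complex_eq; rewrite ?cReM ?cImM /= ?cosD ?sinD //; ring.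
Qed.

Lemma conj_cis t : conjc (cis t) = cis (- t) :> R[i].
Proof. by rewrite /cis cosN sinN. Qed.

Lemma nm_cis t : nm (cis t) = 1.
Proof. by rewrite nmE /= cos2Dsin2 sqrtr1. Qed.

Lemma abs_sin_le t : `|sin t| <= `|t|.
Proof.
have H s : 0 <= s -> `|sin s| <= s.
  move=> s0.
  have [|c _] := @MVT_segment _ sin cos 0 s s0.
  - by apply: continuous_subspaceT => x; exact: continuous_sin.
  rewrite sin0 !subr0 => ->; rewrite normrM (ger0_norm s0).
  by rewrite ler_piMl // cos_max.
case: (leP 0 t) => t0; first by rewrite (ger0_norm t0) H.
by rewrite -normrN -sinN (ltr0_norm t0) H // oppr_ge0 ltW.
Qed.

(** The chord is shorter than the arc: its length is 2 |sin (t / 2)|. *)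
Lemma nm_cisB1_le t : nm (cis t - 1) <= `|t|.
Proof.
rewrite -(ler_pXn2r (n := 2)) ?nnegrE ?nm_ge0 // sqr_nm cReD cImD cReN cImN /=.
rewrite oppr0 addr0.
have -> : (cos t - 1) ^+ 2 + sin t ^+ 2 = 4 * sin (t / 2) ^+ 2.
  have {1 2}-> : t = t / 2 + t / 2 by field.
  rewrite cosD sinD; have := cos2Dsin2 (t / 2).
  set a := cos _; set b := sin _ => h.
  have h2 : a ^+ 2 = 1 - b ^+ 2 by rewrite -h addrK.
  have -> : (a * a - b * b - 1) ^+ 2 + (b * a + a * b) ^+ 2 =
    (a ^+ 2 - b ^+ 2 - 1) ^+ 2 + 4 * (b ^+ 2 * a ^+ 2) by ring.
  by rewrite h2; ring.
have : `|sin (t / 2)| ^+ 2 <= `|t / 2| ^+ 2.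
  by rewrite ler_pXn2r ?nnegrE // abs_sin_le.
rewrite !real_normK ?num_real // expr_div_n.
lra.
Qed.

(** The mean value theorem for the sine and the half-angle formula for the cosine. *)
Lemma nm_cis_taylor2 t : nm (cis t - 1 - 'i * t%:C) <= 2 * t ^+ 2.
Proof.
have Hs (s : R) : 0 <= s -> `|sin s - s| <= s ^+ 2.
  move=> s0.
  have dg (v : R) : is_derive v 1 (fun r => sin r - r) (cos v - 1).
    by apply: is_deriveB.
  have [|c cs] := @MVT_segment _ (fun r => sin r - r) (fun r => cos r - 1) 0 s s0.
  - apply: continuous_subspaceT => x.
    by apply: continuousB; [exact: continuous_sin|exact: cvg_id].
  rewrite sin0 !subr0 => ->; rewrite normrM (ger0_norm s0) expr2.
  apply: ler_wpM2r => //.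
  have := Re_le_nm (cis c - 1); rewrite cReD cReN /= => /le_trans; apply.
  move: cs; rewrite in_itv /= => /andP[c0 cs].
  by rewrite (le_trans (nm_cisB1_le _)) // ger0_norm.
have Hs' : `|sin t - t| <= t ^+ 2.
  case: (leP 0 t) => t0; first exact: Hs.
  rewrite -normrN opprB -sqrrN.
  have -> : t - sin t = sin (- t) - (- t) by rewrite sinN; ring.
  by apply: Hs; rewrite oppr_ge0 ltW.
have Hc : `|cos t - 1| <= t ^+ 2.
  have -> : cos t - 1 = - 2 * sin (t / 2) ^+ 2.
    have {1}-> : t = t / 2 + t / 2 by field.
    rewrite cosD; have := cos2Dsin2 (t / 2).
    set a := cos _; set b := sin _ => h.
    have h2 : a ^+ 2 = 1 - b ^+ 2 by rewrite -h addrK.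
    by rewrite -!expr2 h2; ring.
  rewrite normrM normrX normrN (ger0_norm (_ : 0 <= 2)) //.
  have : `|sin (t / 2)| ^+ 2 <= `|t / 2| ^+ 2.
    by rewrite ler_pXn2r ?nnegrE // abs_sin_le.
  rewrite [X in _ <= X -> _]real_normK ?num_real // expr_div_n.
  have := sqr_ge0 t; lra.
apply: (le_trans (nm_le_ReIm _)).
have -> : complex.Re (cis t - 1 - 'i * t%:C) = cos t - 1.
  by rewrite !cReD !cReN cReM /=; ring.
have -> : complex.Im (cis t - 1 - 'i * t%:C) = sin t - t.
  by rewrite !cImD !cImN cImM /=; ring.
lra.
Qed.

End ComplexModulus.

(** * Finite sums *)

Section FiniteSums.
Context {R : realType}.

(** The discriminant of the nonnegative polynomial t |-> sum (x - t y)^2. *)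
Lemma cauchy_schwarz I (r : seq I) (x y : I -> R) :
  (\sum_(i <- r) x i * y i) ^+ 2 <=
  (\sum_(i <- r) x i ^+ 2) * (\sum_(i <- r) y i ^+ 2).
Proof.
set S := \sum_(i <- r) x i * y i; set X := \sum_(i <- r) x i ^+ 2.
set Y := \sum_(i <- r) y i ^+ 2.
have E t : 0 <= X - 2 * t * S + t ^+ 2 * Y.
  have -> : X - 2 * t * S + t ^+ 2 * Y = \sum_(i <- r) (x i - t * y i) ^+ 2.
    rewrite /X /S /Y !mulr_sumr -sumrN -!big_split /=.
    by apply: eq_bigr => i _; ring.
  by apply: sumr_ge0 => i _; exact: sqr_ge0.
have Y0 : 0 <= Y by apply: sumr_ge0 => i _; exact: sqr_ge0.
have [Y0'|Yn] := eqVneq Y 0.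
  rewrite Y0' mulr0.
  have [->|Sn] := eqVneq S 0; first by rewrite expr0n.
  (* If Y = 0, then S = 0: otherwise this value of t makes the polynomial equal to -1. *)
  have := E ((X + 1) / (2 * S)).
  rewrite Y0' mulr0 addr0.
  have -> : X - 2 * ((X + 1) / (2 * S)) * S = - 1 by field.
  by rewrite lerNr oppr0 ler10.
have Yp : 0 < Y by rewrite lt_def Yn.
have := E (S / Y).
have -> : X - 2 * (S / Y) * S + (S / Y) ^+ 2 * Y = X - S ^+ 2 / Y by field.
by rewrite subr_ge0 ler_pdivrMr.
Qed.

Lemma minkowski2 I (r : seq I) (x y : I -> R) A B : 0 <= A -> 0 <= B ->
  \sum_(i <- r) x i ^+ 2 <= A ^+ 2 -> \sum_(i <- r) y i ^+ 2 <= B ^+ 2 ->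
  \sum_(i <- r) (x i + y i) ^+ 2 <= (A + B) ^+ 2.
Proof.
move=> A0 B0 hx hy.
have hxy : \sum_(i <- r) x i * y i <= A * B.
  apply: (le_trans (ler_norm _)).
  rewrite -(ler_pXn2r (n := 2)) ?nnegrE ?mulr_ge0 // real_normK ?num_real //.
  rewrite (le_trans (cauchy_schwarz _ _ _)) // exprMn ler_pM //.
  - by apply: sumr_ge0 => i _; exact: sqr_ge0.
  - by apply: sumr_ge0 => i _; exact: sqr_ge0.
have -> : \sum_(i <- r) (x i + y i) ^+ 2 =
  \sum_(i <- r) x i ^+ 2 + 2 * (\sum_(i <- r) x i * y i) +
  \sum_(i <- r) y i ^+ 2.
  by rewrite mulr_sumr -!big_split /=; apply: eq_bigr => i _; ring.
by rewrite sqrrD; lra.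
Qed.

Lemma ler_sum_incl (I : eqType) (r s : seq I) (p : I -> R) :
  (forall i, 0 <= p i) -> uniq r -> {subset r <= s} ->
  \sum_(i <- r) p i <= \sum_(i <- s) p i.
Proof.
move=> p0; elim: r s => [|i r IH] s /=.
  by rewrite big_nil => _ _; apply: sumr_ge0.
move=> /andP[ir ur] sub.
have is_ : i \in s by apply: sub; rewrite inE eqxx.
rewrite big_cons (perm_big _ (perm_to_rem is_)) big_cons lerD2l.
apply: IH => // j jr.
have := sub j; rewrite inE jr orbT => /(_ isT) js.
by apply: (mem_rem_neq _ js) || (have := perm_mem (perm_to_rem is_) j;
  rewrite js inE => /esym/orP[/eqP ji|//]; move: ir; rewrite -ji jr).
Qed.

End FiniteSums.

Section Symmetric.

(** The frequencies -N, ..., N, in the order of the partial sums of Fourier series. *)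
Definition irange (N : nat) : seq int :=
  [seq (j%:Z - N%:Z)%R | j <- iota 0 N.*2.+1].

Lemma irange_uniq N : uniq (irange N).
Proof.
rewrite map_inj_uniq ?iota_uniq // => i j.
by move=> /addIr [].
Qed.

Lemma mem_irange N k : (k \in irange N) = (`|k| <= N)%N.
Proof.
apply/mapP/idP => [[j]|kN].
  by rewrite mem_iota add0n => /andP[_ jN] ->; lia.
exists (`|(k + N%:Z)%R|)%N; last by lia.
by rewrite mem_iota; lia.
Qed.

Lemma subset_irange (s : seq int) : exists N, {subset s <= irange N}.
Proof.
exists (\max_(k <- s) `|k|)%N => k ks; rewrite mem_irange.
by rewrite (big_rem k) //= leq_maxl.
Qed.

End Symmetric.

(** * Sequences bounded in l1 or l2, and sums over the integers *)

Section Lp.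
Context {R : realType}.
Implicit Types (a b x y : int -> R[i]) (K L C : R).

(** A bound on the l1 norm (p false) or on the l2 norm (p true), the exponent being
    p.+1. Quantifying over finite sets of indices makes the norm itself, and the
    question whether it is finite, disappear from all estimates; one statement
    covers the two norms in which the scheme is analysed. *)
Definition lp (p : bool) a K : Prop :=
  0 <= K /\ forall s : seq int, uniq s ->
    \sum_(k <- s) nm (a k) ^+ p.+1 <= K ^+ p.+1.

Lemma lp_ge0 p a K : lp p a K -> 0 <= K.
Proof. by case. Qed.

Lemma lp0 p : lp p (fun=> 0) 0.
Proof.
by split => // s _; rewrite big1 ?expr0n // => k _; rewrite nm0 expr0n.
Qed.

Lemma lpW p a K L : K <= L -> lp p a K -> lp p a L.
Proof.
move=> KL [K0 H]; split; first exact: le_trans KL.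
move=> s us; apply: (le_trans (H s us)).
by rewrite ler_pXn2r // nnegrE // (le_trans K0).
Qed.

Lemma eq_lp p a b K : a =1 b -> lp p a K -> lp p b K.
Proof. by move=> ab; rewrite (funext ab). Qed.

Lemma le_lp p a b C K : 0 <= C -> (forall k, nm (a k) <= C * nm (b k)) ->
  lp p b K -> lp p a (C * K).
Proof.
move=> C0 h [K0 H]; split; first exact: mulr_ge0.
move=> s us; rewrite exprMn.
apply: (@le_trans _ _ (C ^+ p.+1 * \sum_(k <- s) nm (b k) ^+ p.+1)).
  rewrite mulr_sumr; apply: ler_sum => k _; rewrite -exprMn.
  by rewrite ler_pXn2r ?nnegrE ?mulr_ge0 // nm_ge0.
by apply: ler_wpM2l; [exact: exprn_ge0|exact: H].
Qed.

Lemma le_lp1 p a b K : (forall k, nm (a k) <= nm (b k)) -> lp p b K -> lp p a K.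
Proof.
move=> h H; rewrite -[K]mul1r; apply: le_lp H => // k.
by rewrite mul1r.
Qed.

Lemma lpM p (m : int -> R[i]) a C K : 0 <= C -> (forall k, nm (m k) <= C) ->
  lp p a K -> lp p (fun k => m k * a k) (C * K).
Proof.
move=> C0 h; apply: le_lp => // k.
by rewrite nmM ler_wpM2r // nm_ge0.
Qed.

Lemma lpM1 p (m : int -> R[i]) a K : (forall k, nm (m k) <= 1) ->
  lp p a K -> lp p (fun k => m k * a k) K.
Proof. by move=> h H; rewrite -[K]mul1r; apply: lpM. Qed.

Lemma lpZ p (c : R[i]) a K : lp p a K -> lp p (fun k => c * a k) (nm c * K).
Proof. by move=> H; apply: (lpM (m := fun=> c)) => //; exact: nm_ge0. Qed.

Lemma lpN p a K : lp p a K -> lp p (fun k => - a k) K.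
Proof. by apply: le_lp1 => k; rewrite nmN. Qed.

Lemma lpD p a b K L : lp p a K -> lp p b L -> lp p (fun k => a k + b k) (K + L).
Proof.
move=> [K0 hK] [L0 hL]; split; first exact: addr_ge0.
move=> s us.
apply: (@le_trans _ _ (\sum_(k <- s) (nm (a k) + nm (b k)) ^+ p.+1)).
  apply: ler_sum => k _; rewrite ler_pXn2r ?nnegrE ?addr_ge0 ?nm_ge0 //.
  exact: nmD.
case: p hK hL => hK hL; first by apply: minkowski2 => //; [exact: hK|exact: hL].
rewrite expr1.
have -> : \sum_(k <- s) (nm (a k) + nm (b k)) ^+ false.+1 =
  \sum_(k <- s) nm (a k) ^+ 1 + \sum_(k <- s) nm (b k) ^+ 1.
  by rewrite -big_split /=; apply: eq_bigr => k _; rewrite !expr1.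
by apply: lerD; [exact: hK|exact: hL].
Qed.

Lemma lpB p a b K L : lp p a K -> lp p b L -> lp p (fun k => a k - b k) (K + L).
Proof. by move=> hK hL; apply: lpD => //; exact: lpN. Qed.

Lemma lp_sup p a K k : lp p a K -> nm (a k) <= K.
Proof.
move=> [K0 /(_ [:: k] isT)]; rewrite big_seq1.
by rewrite ler_pXn2r ?nnegrE ?nm_ge0.
Qed.

Lemma lp_reindex p a K (h : int -> int) : injective h ->
  lp p a K -> lp p (a \o h) K.
Proof.
move=> ih [K0 H]; split => // s us.
have := H [seq h k | k <- s]; rewrite map_inj_uniq // big_map; exact.
Qed.

(** The coefficients of the complex conjugate of a function. *)
Definition cj a : int -> R[i] := fun k => conjc (a (- k)).

Lemma lp_cj p a K : lp p a K -> lp p (cj a) K.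
Proof.
move=> /(lp_reindex (@oppr_inj _)) H.
by apply: (le_lp1 _ H) => k; rewrite /cj nm_conj.
Qed.

Lemma lp_l1_l2 a K : lp false a K -> lp true a K.
Proof.
move=> [K0 H]; split => // s us.
apply: (@le_trans _ _ ((\sum_(k <- s) nm (a k)) ^+ 2)); last first.
  have S0 : 0 <= \sum_(k <- s) nm (a k) by apply: sumr_ge0 => k _; exact: nm_ge0.
  rewrite ler_pXn2r ?nnegrE //.
  have := H s us; rewrite expr1.
  by under eq_bigr do rewrite expr1.
elim: s {us} => [|k s IH]; first by rewrite !big_nil expr0n.
rewrite !big_cons sqrrD; set S := \sum_(_ <- _) nm _.
have S0 : 0 <= S by apply: sumr_ge0 => j _; exact: nm_ge0.
rewrite -addrA lerD2l (le_trans IH) // lerDr mulrn_wge0 // mulr_ge0 //.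
exact: nm_ge0.
Qed.

Lemma le_lpD p x a b K L : (forall k, nm (x k) <= nm (a k) + nm (b k)) ->
  lp p a K -> lp p b L -> lp p x (K + L).
Proof.
move=> H ha hb.
have habs c M : lp p c M -> lp p (fun k => real_complex R (nm (c k))) M.
  apply: le_lp1 => k; rewrite nm_real ger0_norm //; exact: nm_ge0.
apply: (le_lp1 _ (lpD (habs _ _ ha) (habs _ _ hb))) => k.
by rewrite -rmorphD nm_real ger0_norm // addr_ge0 // nm_ge0.
Qed.

Lemma lp_sum p I (r : seq I) (x : I -> int -> R[i]) (K : I -> R) :
  (forall i, lp p (x i) (K i)) ->
  lp p (fun k => \sum_(i <- r) x i k) (\sum_(i <- r) K i).
Proof.
move=> H; elim: r => [|i r IH].
  rewrite big_nil; apply: eq_lp (lp0 p) => k; by rewrite big_nil.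
rewrite big_cons; apply: eq_lp (lpD (H i) IH) => k; by rewrite big_cons.
Qed.

End Lp.

Section ComplexLimits.
Context {R : realType}.
Implicit Types (u : nat -> R[i]) (l : R[i]).

Definition ccvg u l : Prop :=
  ((fun n => complex.Re (u n)) @ \oo --> complex.Re l) /\
  ((fun n => complex.Im (u n)) @ \oo --> complex.Im l).

Lemma ccvg_clim u l : ccvg u l -> clim u = l.
Proof.
move=> [hr hi]; apply: complex_eq; rewrite /clim /=; exact/cvg_lim.
Qed.

Lemma ccvg_cst l : ccvg (fun=> l) l.
Proof. by split; exact: cvg_cst. Qed.

Lemma ccvgD u v l m : ccvg u l -> ccvg v m -> ccvg (fun n => u n + v n) (l + m).
Proof.
move=> [h1 h2] [h3 h4]; split; rewrite ?cReD ?cImD.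
  by under eq_fun do rewrite cReD; exact: cvgD.
by under eq_fun do rewrite cImD; exact: cvgD.
Qed.

Lemma ccvgN u l : ccvg u l -> ccvg (fun n => - u n) (- l).
Proof.
move=> [h1 h2]; split; rewrite ?cReN ?cImN.
  by under eq_fun do rewrite cReN; exact: cvgN.
by under eq_fun do rewrite cImN; exact: cvgN.
Qed.

Lemma ccvgM u v l m : ccvg u l -> ccvg v m -> ccvg (fun n => u n * v n) (l * m).
Proof.
move=> [h1 h2] [h3 h4]; split; rewrite ?cReM ?cImM.
  under eq_fun do rewrite cReM; apply: cvgB; exact: cvgM.
under eq_fun do rewrite cImM; apply: cvgD; exact: cvgM.
Qed.

Lemma ccvg_conj u l : ccvg u l -> ccvg (fun n => conjc (u n)) (conjc l).
Proof.
move=> [h1 h2]; split; rewrite ?cReJ ?cImJ.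
  by under eq_fun do rewrite cReJ.
under eq_fun do rewrite cImJ; exact: cvgN.
Qed.

Lemma ccvg_nm u l : ccvg u l -> (fun n => nm (u n)) @ \oo --> nm l.
Proof.
move=> [h1 h2]; rewrite nmE; under eq_fun do rewrite nmE.
have h : (fun n => complex.Re (u n) ^+ 2 + complex.Im (u n) ^+ 2) @ \oo -->
    complex.Re l ^+ 2 + complex.Im l ^+ 2.
  by rewrite !expr2; under eq_fun do rewrite !expr2; apply: cvgD; exact: cvgM.
exact: (@continuous_cvg nat R R \oo _ _ Num.sqrt _ (@sqrt_continuous R _) h).
Qed.

Lemma ccvg_nm_le u l (K : R) : ccvg u l -> (forall n, nm (u n) <= K) -> nm l <= K.
Proof.
move=> /ccvg_nm h H; rewrite -(cvg_lim _ h) //.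
apply: limr_le; first by apply/cvg_ex; eexists; exact: h.
by apply: nearW.
Qed.

(** Fatou's lemma for sequences: every finite partial sum passes to the limit. *)
Lemma lp_lim p (X : nat -> int -> R[i]) (x : int -> R[i]) K :
  (forall n, lp p (X n) K) -> (forall k, ccvg (X ^~ k) (x k)) -> lp p x K.
Proof.
move=> H hc; split; first exact: lp_ge0 (H 0%N).
move=> s us.
have h : (fun n => \sum_(k <- s) nm (X n k) ^+ p.+1) @ \oo -->
         \sum_(k <- s) nm (x k) ^+ p.+1.
  elim: s {us} => [|k s IH].
    rewrite big_nil; under eq_fun do rewrite big_nil; exact: cvg_cst.
  rewrite big_cons; under eq_fun do rewrite big_cons.
  apply: cvgD => //; have := ccvg_nm (hc k) => hk.
  case: p {H IH} => /=; last by rewrite expr1; under eq_fun do rewrite expr1.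
  rewrite expr2; under eq_fun do rewrite expr2; exact: cvgM.
rewrite -(cvg_lim _ h) //; apply: limr_le.
  by apply/cvg_ex; eexists; exact: h.
by apply: nearW => n; have [_] := H n; exact.
Qed.

End ComplexLimits.

Section SymmetricSums.
Context {R : realType}.
Implicit Types (a b x y : int -> R[i]) (K L C : R).

(** The symmetric summation by which Fourier multipliers are defined. *)
Definition csum x : R[i] :=
  clim (fun N => \sum_(j < N.*2.+1) x (j%:Z - N%:Z)).

Lemma sum_irange (V : nmodType) (x : int -> V) N :
  \sum_(j < N.*2.+1) x (j%:Z - N%:Z) = \sum_(k <- irange N) x k.
Proof.
rewrite /irange big_map -[iota 0 _]/(index_iota 0 N.*2.+1) big_mkord.
exact: eq_bigr.
Qed.

Definition csummable x := exists K, lp false x K.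

Lemma lp_csummable x K : lp false x K -> csummable x.
Proof. by exists K. Qed.

Lemma real_cvg_irange (p : int -> R) K : (forall k, 0 <= p k) ->
  (forall s, uniq s -> \sum_(k <- s) p k <= K) ->
  cvg ((fun N => \sum_(k <- irange N) p k) @ \oo).
Proof.
move=> p0 H; apply: nondecreasing_is_cvgn.
  apply/nondecreasing_seqP => n; apply: ler_sum_incl => //.
    exact: irange_uniq.
  by move=> k; rewrite !mem_irange => h; exact: leqW.
by exists K => _ [n _ <-]; apply: H; exact: irange_uniq.
Qed.

Lemma real_abs_cvg_irange (q : int -> R) K :
  (forall s, uniq s -> \sum_(k <- s) `|q k| <= K) ->
  cvg ((fun N => \sum_(k <- irange N) q k) @ \oo).
Proof.
move=> H.
have -> : (fun N => \sum_(k <- irange N) q k) =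
  (fun N => \sum_(k <- irange N) (q k + `|q k|)) -
  (fun N => \sum_(k <- irange N) `|q k|).
  apply: funext => N; rewrite fctE -sumrB; apply: eq_bigr => k _.
  by rewrite addrK.
apply: is_cvgB.
  apply: (@real_cvg_irange _ (K + K)) => [k|s us].
    by rewrite addrC -[X in _ + X]opprK subr_ge0 -normrN ler_norm.
  rewrite big_split /= lerD ?H //.
  by apply: le_trans (H s us); apply: ler_sum => k _; exact: ler_norm.
by apply: (@real_cvg_irange _ K).
Qed.

(** A real absolutely summable family q is the difference of the families q + |q| and
    |q|, and these have monotone bounded partial sums. *)
Lemma csum_cvg x : csummable x -> ccvg (fun N => \sum_(k <- irange N) x k) (csum x).
Proof.
move=> [K [K0 H]].
have HK s : uniq s -> \sum_(k <- s) nm (x k) <= K.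
  by move=> us; have := H s us; rewrite expr1; under eq_bigr do rewrite expr1.
have E : (fun N => \sum_(j < N.*2.+1) x (j%:Z - N%:Z)) =
         (fun N => \sum_(k <- irange N) x k).
  by apply: funext => N; exact: sum_irange.
rewrite /csum E /clim; split => /=.
  apply/(_ : cvg _); under eq_fun do rewrite cRe_sum.
  apply: (@real_abs_cvg_irange _ K) => s us; apply: le_trans (HK s us).
  by apply: ler_sum => k _; exact: Re_le_nm.
apply/(_ : cvg _); under eq_fun do rewrite cIm_sum.
apply: (@real_abs_cvg_irange _ K) => s us; apply: le_trans (HK s us).
by apply: ler_sum => k _; exact: Im_le_nm.
Qed.

Lemma csum_eq x l : ccvg (fun N => \sum_(k <- irange N) x k) l -> csum x = l.
Proof.
move=> h; rewrite /csum; apply: ccvg_clim.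
by under eq_fun do rewrite sum_irange.
Qed.

Lemma eq_csum x y : x =1 y -> csum x = csum y.
Proof. by move=> /funext ->. Qed.

Lemma csumD x y : csummable x -> csummable y ->
  csum (fun k => x k + y k) = csum x + csum y.
Proof.
move=> hx hy; apply: csum_eq; under eq_fun do rewrite big_split /=.
by apply: ccvgD; exact: csum_cvg.
Qed.

Lemma csumZ c x : csummable x -> csum (fun k => c * x k) = c * csum x.
Proof.
move=> hx; apply: csum_eq; under eq_fun do rewrite -mulr_sumr.
by apply: ccvgM; [exact: ccvg_cst|exact: csum_cvg].
Qed.

Lemma csumN x : csummable x -> csum (fun k => - x k) = - csum x.
Proof.
move=> hx; apply: csum_eq; under eq_fun do rewrite sumrN.
by apply: ccvgN; exact: csum_cvg.
Qed.

Lemma csumB x y : csummable x -> csummable y ->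
  csum (fun k => x k - y k) = csum x - csum y.
Proof.
move=> hx [K hy]; rewrite csumD ?csumN //; last by exists K; exact: lpN.
by exists K.
Qed.

Lemma csum_conj x : csummable x -> csum (fun k => conjc (x k)) = conjc (csum x).
Proof.
move=> hx; apply: csum_eq.
under eq_fun do rewrite -rmorph_sum.
by apply: ccvg_conj; exact: csum_cvg.
Qed.

Lemma sum_irange_opp (V : nmodType) (x : int -> V) N :
  \sum_(k <- irange N) x (- k) = \sum_(k <- irange N) x k.
Proof.
rewrite -[LHS](big_map (@GRing.opp _) xpredT x); apply: perm_big.
apply: uniq_perm; rewrite ?(map_inj_uniq oppr_inj) ?irange_uniq // => k.
by rewrite -{1}(opprK k) (mem_map oppr_inj) !mem_irange abszN.
Qed.

Lemma csum_opp x : csum (fun k => x (- k)) = csum x.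
Proof.
rewrite /csum; congr clim; apply: funext => N.
by rewrite (sum_irange (fun k => x (- k))) sum_irange_opp sum_irange.
Qed.

Lemma csum_nm_le x K : lp false x K -> nm (csum x) <= K.
Proof.
move=> H; apply: (ccvg_nm_le (csum_cvg (lp_csummable H))) => N.
apply: (le_trans (nm_sum _ _)).
have [_ /(_ _ (irange_uniq N))] := H; rewrite expr1.
by under eq_bigr do rewrite expr1.
Qed.

Lemma csummableD x y : csummable x -> csummable y -> csummable (fun k => x k + y k).
Proof. by move=> [K hx] [L hy]; exists (K + L); exact: lpD. Qed.

Lemma csum_single x j : (forall k, k != j -> x k = 0) -> csum x = x j.
Proof.
move=> H; apply: csum_eq.
have E : \forall N \near \oo, \sum_(k <- irange N) x k = x j.
  exists `|j|%N => // N /= jN.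
  have jr : j \in irange N by rewrite mem_irange.
  by rewrite (bigD1_seq j jr (irange_uniq N)) /= big1 ?addr0.
split.
- apply: cvg_near_cst; apply: filterS E => N -> //.
- apply: cvg_near_cst; apply: filterS E => N -> //.
Qed.

End SymmetricSums.

(** * Young's inequality and weighted sequences *)

Section Young.
Context {R : realType}.
Implicit Types (a b x y : int -> R[i]) (K L C A B : R).
Local Notation rc := (real_complex R).

Let young_fin_r p (s : seq int) a b A B : uniq s ->
  lp false a A -> lp p b B ->
  lp p (fun k => \sum_(j <- s) rc (nm (a j) * nm (b (k - j)))) (A * B).
Proof.
move=> us ha hb.
have H j : lp p (fun k => rc (nm (a j) * nm (b (k - j)))) (nm (a j) * B).
  have ij : injective (fun k : int => k - j) by exact: addIr.
  apply: (le_lp _ _ (lp_reindex ij hb)); first exact: nm_ge0.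
  by move=> k; rewrite nm_real ger0_norm // mulr_ge0 // nm_ge0.
apply: lpW (lp_sum s H); rewrite -mulr_suml ler_wpM2r ?(lp_ge0 hb) //.
have [_ /(_ s us)] := ha; rewrite expr1.
by under eq_bigr do rewrite expr1.
Qed.

Let nm_sum_rc (r : seq int) (f : int -> R) : (forall j, 0 <= f j) ->
  nm (\sum_(j <- r) rc (f j)) = \sum_(j <- r) f j.
Proof.
move=> f0; rewrite -(rmorph_sum rc) nm_real ger0_norm //.
exact: sumr_ge0.
Qed.

Let young_fin_l p (s : seq int) a b A B : uniq s ->
  lp p a A -> lp false b B ->
  lp p (fun k => \sum_(j <- s) rc (nm (a j) * nm (b (k - j)))) (A * B).
Proof.
move=> us ha hb; split=> [|t ut].
  by rewrite mulr_ge0 ?(lp_ge0 ha) ?(lp_ge0 hb).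
have [M HM] := subset_irange [seq k - j | k <- t, j <- s].
have [_ /(_ t ut)] := young_fin_r (irange_uniq M) hb ha.
rewrite mulrC; apply: le_trans.
have p0 (i j : int) c d : 0 <= nm ((c : int -> R[i]) i) * nm ((d : int -> R[i]) j).
  by rewrite mulr_ge0 // nm_ge0.
rewrite big_seq [leRHS]big_seq; apply: ler_sum => k kt.
rewrite !nm_sum_rc // ler_pXn2r ?nnegrE ?sumr_ge0 //.
have -> : \sum_(j <- s) nm (a j) * nm (b (k - j)) =
    \sum_(i <- [seq k - j | j <- s]) nm (b i) * nm (a (k - i)).
  rewrite big_map; apply: eq_bigr => j _.
  by rewrite opprB addrCA subrr addr0 mulrC.
apply: ler_sum_incl => //.
  by rewrite map_inj_uniq // => i j /addrI /oppr_inj.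
move=> _ /mapP[j js ->]; apply: HM; exact: allpairs_f.
Qed.

(** Young's inequality for kernels dominated by two convolutions; the two terms
    let either factor carry the larger norm, as when the weight of the output
    frequency is distributed on the two inputs. *)
Lemma young p (x : int -> int -> R[i]) a b c d A B C D :
  (forall k j, nm (x k j) <= nm (a j) * nm (b (k - j))
                           + nm (c j) * nm (d (k - j))) ->
  lp p a A -> lp false b B -> lp false c C -> lp p d D ->
  (forall k, csummable (x k)) /\
  lp p (fun k => csum (x k)) (A * B + C * D).
Proof.
move=> H ha hb hc hd.
have S k : csummable (x k).
  have ik : injective (fun j : int => k - j) by move=> i j /addrI /oppr_inj.
  (* In each convolution one factor is summable and the other one bounded. *)
  exists (nm (rc A) * B + nm (rc D) * C).
  apply: (le_lpD _ (lpZ (rc A) (lp_reindex ik hb)) (lpZ (rc D) hc)) => j.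
  rewrite !nmM !nm_real !ger0_norm ?(lp_ge0 ha) ?(lp_ge0 hd) //.
  apply: (le_trans (H k j)); apply: lerD.
    by rewrite ler_wpM2r ?nm_ge0 // (lp_sup j ha).
  by rewrite mulrC ler_wpM2r ?nm_ge0 // (lp_sup _ hd).
split => //.
(* With j restricted to a finite set, this is the triangle inequality for translates. *)
apply: (lp_lim (X := fun N k => \sum_(j <- irange N) x k j)); last first.
  by move=> k; exact: csum_cvg.
move=> N.
have uN := irange_uniq N.
apply: (le_lp1 _ (lpD (young_fin_l uN ha hb) (young_fin_r uN hc hd))) => k.
rewrite -big_split /=.
under [X in _ <= nm X]eq_bigr do rewrite -rmorphD.
rewrite nm_sum_rc; last first.
  by move=> j; rewrite addr_ge0 // mulr_ge0 // nm_ge0.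
apply: (le_trans (nm_sum _ _)); apply: ler_sum => j _; exact: H.
Qed.

End Young.

Section Weights.
Context {R : realType}.
Implicit Types (a b x y : int -> R[i]) (K L C A B : R).
Local Notation rc := (real_complex R).

(** The weight 1 + |k|, comparable to (1 + k^2)^(1/2) and submultiplicative, with
    integer powers. *)
Definition W (k : int) : R := (`|k|.+1)%N%:R.

Definition wt (m : nat) a : int -> R[i] := fun k => rc (W k ^+ m) * a k.

Lemma W_ge1 k : 1 <= W k.
Proof. by rewrite /W ler1n. Qed.

Lemma W_gt0 k : 0 < W k.
Proof. exact: lt_le_trans (W_ge1 k). Qed.

Lemma W_ge0 k : 0 <= W k.
Proof. exact: ltW (W_gt0 k). Qed.

Lemma W_opp k : W (- k) = W k.
Proof. by rewrite /W abszN. Qed.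

Lemma W_leD k j : W k <= W j + W (k - j).
Proof.
rewrite /W -natrD ler_nat.
have := leqD_dist k j 0; rewrite !subr0; lia.
Qed.

Lemma W_leM k j : W k <= W j * W (k - j).
Proof. rewrite /W -natrM ler_nat; nia. Qed.

Lemma W_le_abs k : `|(k%:~R : R)| <= W k.
Proof. by rewrite /W -intr_norm -abszE ler_nat. Qed.

Lemma W_sqr_le k : W k ^+ 2 <= 2 * (1 + (k%:~R : R) ^+ 2).
Proof.
have -> : W k = 1 + `|(k%:~R : R)|.
  by rewrite /W -intr_norm -abszE -addn1 natrD addrC.
rewrite -[X in _ <= 2 * (1 + X)]real_normK ?num_real //.
have := sqr_ge0 (1 - `|(k%:~R : R)|).
set t := `|_|; rewrite sqrrB sqrrD; lra.
Qed.

Lemma sqr_le_W k : 1 + (k%:~R : R) ^+ 2 <= W k ^+ 2.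
Proof.
have -> : W k = 1 + `|(k%:~R : R)|.
  by rewrite /W -intr_norm -abszE -addn1 natrD addrC.
rewrite -[X in 1 + X <= _]real_normK ?num_real //.
have := normr_ge0 (k%:~R : R); set t := `|_|; rewrite sqrrD; lra.
Qed.

Lemma W_exp_ge0 m k : 0 <= W k ^+ m.
Proof. by rewrite exprn_ge0 // W_ge0. Qed.

Lemma nm_wt m a k : nm (wt m a k) = W k ^+ m * nm (a k).
Proof. by rewrite nmM nm_real ger0_norm // W_exp_ge0. Qed.

(** One of the two frequencies j and k - j is at least half as large as k. *)
Lemma W_expD m k j : W k ^+ m <= 2 ^+ m * (W j ^+ m + W (k - j) ^+ m).
Proof.
wlog h : j / W (k - j) <= W j.
  move=> H; case: (leP (W (k - j)) (W j)) => [/H//|/ltW h].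
  have := H (k - j); rewrite subKr => /(_ h).
  by rewrite addrC.
apply: (@le_trans _ _ ((2 * W j) ^+ m)).
  apply: lerXn2r; rewrite ?nnegrE ?mulr_ge0 ?W_ge0 //.
  by rewrite (le_trans (W_leD k j)) // mulr_natl mulr2n lerD2l.
by rewrite exprMn ler_wpM2l ?exprn_ge0 // lerDl W_exp_ge0.
Qed.

Lemma W_expM m k j : W k ^+ m <= W j ^+ m * W (k - j) ^+ m.
Proof.
rewrite -exprMn; apply: lerXn2r; rewrite ?nnegrE ?mulr_ge0 ?W_ge0 //.
exact: W_leM.
Qed.

Lemma le_wt m n a k : (m <= n)%N -> nm (wt m a k) <= nm (wt n a k).
Proof.
by move=> mn; rewrite !nm_wt ler_wpM2r ?nm_ge0 // ler_weXn2l // W_ge1.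
Qed.

Lemma lp_wt_le p m n a K : (m <= n)%N -> lp p (wt n a) K -> lp p (wt m a) K.
Proof. by move=> mn; apply: le_lp1 => k; exact: le_wt. Qed.

Lemma wt0 a : wt 0 a =1 a.
Proof. by move=> k; rewrite /wt expr0 mul1r. Qed.

Lemma lp_wt0 p m a K : lp p (wt m a) K -> lp p a K.
Proof. by move=> H; apply: (eq_lp (wt0 a)); exact: lp_wt_le H. Qed.

Lemma le_lp_wt p m a b C K : 0 <= C -> (forall k, nm (a k) <= C * nm (b k)) ->
  lp p (wt m b) K -> lp p (wt m a) (C * K).
Proof.
move=> C0 h; apply: le_lp => // k; rewrite !nm_wt mulrCA.
by rewrite ler_wpM2l // W_exp_ge0.
Qed.

Lemma le_lpD_wt p m x a b K L : (forall k, nm (x k) <= nm (a k) + nm (b k)) ->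
  lp p (wt m a) K -> lp p (wt m b) L -> lp p (wt m x) (K + L).
Proof.
move=> h; apply: le_lpD => k; rewrite !nm_wt -mulrDr.
by rewrite ler_wpM2l // W_exp_ge0.
Qed.

Lemma lp_wt_cj p m a K : lp p (wt m a) K -> lp p (wt m (cj a)) K.
Proof.
move=> /lp_cj; apply: le_lp1 => k.
by rewrite /cj nm_conj !nm_wt W_opp nm_conj.
Qed.

Lemma sum_irangeS (p : int -> R) N :
  \sum_(k <- irange N.+1) p k =
  p N.+1%:Z + p (- N.+1%:Z) + \sum_(k <- irange N) p k.
Proof.
have E (x y : int) (s : seq int) :
    p x + p y + \sum_(k <- s) p k = \sum_(k <- [:: x, y & s]) p k.
  by rewrite !big_cons addrA.
rewrite E; apply: perm_big; apply: uniq_perm; first exact: irange_uniq.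
  by rewrite 2!cons_uniq irange_uniq inE !mem_irange; lia.
by move=> k; rewrite !(in_cons, mem_irange); lia.
Qed.

(** Comparison with a telescoping series. *)
Lemma sum_Winv2 (s : seq int) : uniq s -> \sum_(k <- s) ((W k)^-1) ^+ 2 <= 4.
Proof.
move=> us; have [N HN] := subset_irange s.
apply: (le_trans (ler_sum_incl _ us HN)); first by move=> k; exact: sqr_ge0.
(* Both new terms of the partial sum are at most 1 / (N + 1) - 1 / (N + 2). *)
suff : \sum_(k <- irange N) ((W k)^-1) ^+ 2 <= 3 - 2 / N.+1%:R.
  move=> /le_trans; apply.
  have : 0 <= 2 / (N.+1%:R : R) by rewrite divr_ge0.
  by set t : R := 2 / _; clearbody t; lra.
elim: N {HN} => [|N IH].
  have -> : irange 0 = [:: 0] by [].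
  by rewrite big_seq1 /W absz0 !mulr1n invr1 expr1n mulr1; lra.
rewrite sum_irangeS W_opp.
have -> : W N.+1%:Z = N.+2%:R by [].
apply: (le_trans (lerD (lexx _) IH)).
have h1 : (N.+2%:R : R) = N.+1%:R + 1 by rewrite -natr1.
have h0 : 0 < (N.+1%:R : R) by rewrite ltr0n.
rewrite h1; set t : R := N.+1%:R in h0 *.
have E : 2 / t - 2 / (t + 1) - ((t + 1)^-1 ^+ 2 + (t + 1)^-1 ^+ 2) =
   2 / (t * (t + 1) ^+ 2).
  by field; rewrite !gt_eqF // addr_gt0.
have : 0 <= 2 / (t * (t + 1) ^+ 2).
  by rewrite divr_ge0 // mulr_ge0 ?exprn_ge0 ?addr_ge0 // ltW.
rewrite -E => h; rewrite -subr_ge0; apply: le_trans h _; apply: eq_ler.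
by ring.
Qed.

(** One weight buys summability: Cauchy-Schwarz against the square summable
    sequence 1/W. *)
Lemma l2_l1 m a K : lp true (wt m.+1 a) K -> lp false (wt m a) (2 * K).
Proof.
move=> [K0 H]; split; first by rewrite mulr_ge0.
move=> s us; rewrite expr1; under eq_bigr do rewrite expr1.
have S0 : 0 <= \sum_(k <- s) nm (wt m a k) by apply: sumr_ge0 => k _; exact: nm_ge0.
rewrite -(ler_pXn2r (n := 2)) ?nnegrE ?mulr_ge0 //.
have -> : \sum_(k <- s) nm (wt m a k) =
    \sum_(k <- s) ((W k)^-1) * nm (wt m.+1 a k).
  apply: eq_bigr => k _; rewrite !nm_wt exprS mulrA mulrA mulVf ?mul1r //.
  by rewrite gt_eqF // W_gt0.
apply: (le_trans (cauchy_schwarz _ _ _)); rewrite exprMn.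
apply: ler_pM.
- by apply: sumr_ge0 => k _; exact: sqr_ge0.
- by apply: sumr_ge0 => k _; exact: sqr_ge0.
- by rewrite (le_trans (sum_Winv2 us)) // expr2 -natrM.
- exact: H.
Qed.

Definition convol a b : int -> R[i] := fun k => csum (fun j => a j * b (k - j)).

Lemma convol_young p a b A B : lp false a A -> lp p b B ->
  (forall k, csummable (fun j => a j * b (k - j))) /\ lp p (convol a b) (A * B).
Proof.
move=> ha hb.
have [|S H] := @young R p (fun k j => a j * b (k - j)) (fun=> 0) (fun=> 0) a b
    0 0 A B _ (lp0 p) (lp0 false) ha hb.
  by move=> k j; rewrite !nmM nm0 mul0r add0r.
by split=> //; move: H; rewrite mul0r add0r.
Qed.

Lemma convol_young_l p a b A B : lp p a A -> lp false b B ->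
  lp p (convol a b) (A * B).
Proof.
move=> ha hb.
have [|S H] := @young R p (fun k j => a j * b (k - j)) a b (fun=> 0) (fun=> 0)
    A B 0 0 _ ha hb (lp0 false) (lp0 p).
  by move=> k j; rewrite !nmM nm0 mul0r addr0.
by move: H; rewrite mul0r addr0.
Qed.

Lemma csummable_convol a b : csummable a -> csummable b ->
  forall k, csummable (fun j => a j * b (k - j)).
Proof. by move=> [A ha] [B hb]; have [] := convol_young ha hb. Qed.

(** The algebra property of H^m, m > 0: by [W_expD] the weight falls on one factor,
    the other being summable by [l2_l1]. *)
Lemma convol_H m a b A B : lp true (wt m.+1 a) A -> lp true (wt m.+1 b) B ->
  lp true (wt m.+1 (convol a b)) (2 ^+ m.+1 * (4 * A * B)).
Proof.
move=> ha hb.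
have sa : lp false a (2 * A) by apply: lp_wt0 (l2_l1 ha).
have sb : lp false b (2 * B) by apply: lp_wt0 (l2_l1 hb).
have Sab := csummable_convol (lp_csummable sa) (lp_csummable sb).
have [|||S H] := @young R true (fun k j => rc (W k ^+ m.+1) * (a j * b (k - j)))
  (wt m.+1 a) (fun k => rc (2 ^+ m.+1) * b k)
  (fun k => rc (2 ^+ m.+1) * a k) (wt m.+1 b)
  A (2 ^+ m.+1 * (2 * B)) (2 ^+ m.+1 * (2 * A)) B _ ha _ _ hb.
- move=> k j; rewrite !nm_wt !nmM !nm_real ger0_norm ?W_exp_ge0 //.
  rewrite ger0_norm ?exprn_ge0 //.
  apply: (le_trans (ler_wpM2r _ (W_expD m.+1 k j))).
    by rewrite mulr_ge0 // nm_ge0.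
  by apply: eq_ler; ring.
- by apply: lpM sb => [|k]; rewrite ?nm_real ?exprn_ge0 // ger0_norm ?exprn_ge0.
- by apply: lpM sa => [|k]; rewrite ?nm_real ?exprn_ge0 // ger0_norm ?exprn_ge0.
have E k : csum (fun j => rc (W k ^+ m.+1) * (a j * b (k - j))) =
  wt m.+1 (convol a b) k by rewrite csumZ.
have -> : 2 ^+ m.+1 * (4 * A * B) =
  A * (2 ^+ m.+1 * (2 * B)) + 2 ^+ m.+1 * (2 * A) * B by ring.
exact: eq_lp E H.
Qed.

Lemma convol_l1_wt m a b A B : lp false (wt m a) A -> lp false (wt m b) B ->
  lp false (wt m (convol a b)) (A * B).
Proof.
move=> ha hb.
have Sab := csummable_convol (lp_csummable (lp_wt0 ha)) (lp_csummable (lp_wt0 hb)).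
have [|S H] := @young R false (fun k j => rc (W k ^+ m) * (a j * b (k - j)))
  (fun=> 0) (fun=> 0) (wt m a) (wt m b)
  0 0 A B _ (lp0 false) (lp0 false) ha hb.
  move=> k j; rewrite !nm_wt !nmM nm_real ger0_norm ?W_exp_ge0 // nm0 mul0r add0r.
  apply: (le_trans (ler_wpM2r _ (W_expM m k j))).
    by rewrite mulr_ge0 // nm_ge0.
  by apply: eq_ler; ring.
move: H; rewrite mul0r add0r; apply: eq_lp => k.
by rewrite csumZ.
Qed.

End Weights.

(** * Integrals of complex functions *)

Section ComplexMeasurable.
Context {R : realType}.
Implicit Types (D : set R) (f g : R -> R[i]).

Definition cmeas D f : Prop :=
  measurable_fun D (fun x => complex.Re (f x)) /\
  measurable_fun D (fun x => complex.Im (f x)).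

Lemma cmeas_cst D (z : R[i]) : cmeas D (fun=> z).
Proof. by split; exact: measurable_cst. Qed.

Lemma cmeasD D f g : cmeas D f -> cmeas D g -> cmeas D (fun x => f x + g x).
Proof.
move=> [f1 f2] [g1 g2]; split.
  by under eq_fun do rewrite cReD; exact: measurable_funD.
by under eq_fun do rewrite cImD; exact: measurable_funD.
Qed.

Lemma cmeasN D f : cmeas D f -> cmeas D (fun x => - f x).
Proof.
move=> [f1 f2]; split.
  by under eq_fun do rewrite cReN; exact: measurableT_comp.
by under eq_fun do rewrite cImN; exact: measurableT_comp.
Qed.

Lemma cmeasB D f g : cmeas D f -> cmeas D g -> cmeas D (fun x => f x - g x).
Proof. by move=> hf hg; apply: cmeasD => //; exact: cmeasN. Qed.

Lemma cmeasM D f g : cmeas D f -> cmeas D g -> cmeas D (fun x => f x * g x).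
Proof.
move=> [f1 f2] [g1 g2]; split.
  under eq_fun do rewrite cReM; apply: measurable_funB; exact: measurable_funM.
under eq_fun do rewrite cImM; apply: measurable_funD; exact: measurable_funM.
Qed.

Lemma cmeas_conj D f : cmeas D f -> cmeas D (fun x => conjc (f x)).
Proof.
move=> [f1 f2]; split; first by under eq_fun do rewrite cReJ.
by under eq_fun do rewrite cImJ; exact: measurableT_comp.
Qed.

Lemma cmeas_real D (r : R -> R) : measurable_fun D r ->
  cmeas D (fun x => real_complex R (r x)).
Proof. by move=> h; split => //=; exact: measurable_cst. Qed.

Lemma cmeas_cis D (r : R -> R) : measurable_fun D r -> cmeas D (fun x => cis (r x)).
Proof.
move=> h; split => /=.
  apply: measurableT_comp h; apply: continuous_measurable_fun.
  exact: continuous_cos.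
apply: measurableT_comp h; apply: continuous_measurable_fun.
exact: continuous_sin.
Qed.

Lemma cmeas_sum D I (r : seq I) (F : I -> R -> R[i]) :
  (forall i, cmeas D (F i)) -> cmeas D (fun x => \sum_(i <- r) F i x).
Proof.
move=> H; elim: r => [|i r IH].
  by under eq_fun do rewrite big_nil; exact: cmeas_cst.
by under eq_fun do rewrite big_cons; exact: cmeasD.
Qed.

Lemma cmeas_lim D (u : nat -> R -> R[i]) f : (forall n, cmeas D (u n)) ->
  (forall x, D x -> ccvg (u ^~ x) (f x)) -> cmeas D f.
Proof.
move=> hu H; split.
  apply: (@measurable_fun_cvg _ _ _ D (fun n x => complex.Re (u n x))).
    by move=> n; case: (hu n).
  by move=> x /H [].
apply: (@measurable_fun_cvg _ _ _ D (fun n x => complex.Im (u n x))).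
  by move=> n; case: (hu n).
by move=> x /H [].
Qed.

Lemma cmeas_csum D (b : int -> R -> R[i]) : (forall k, cmeas D (b k)) ->
  (forall x, D x -> csummable (b ^~ x)) -> cmeas D (fun x => csum (b ^~ x)).
Proof.
move=> hb H; apply: (cmeas_lim (u := fun N x => \sum_(k <- irange N) b k x)).
  by move=> N; exact: cmeas_sum.
by move=> x /H; exact: csum_cvg.
Qed.

Lemma cmeasS D E f : measurable E -> D `<=` E -> cmeas E f -> cmeas D f.
Proof. by move=> mE DE [h1 h2]; split; exact: measurable_funS mE DE _. Qed.

Lemma eq_cmeas D f g : {in D, f =1 g} -> cmeas D f -> cmeas D g.
Proof.
move=> fg [h1 h2]; split.
  by apply: eq_measurable_fun h1 => x xD; rewrite fg.
by apply: eq_measurable_fun h2 => x xD; rewrite fg.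
Qed.

End ComplexMeasurable.

Section AlmostEverywhere.
Context {R : realType}.
Notation mu := (@lebesgue_measure R).

Lemma ae_mono (P Q : R -> Prop) : {ae mu, forall x, P x} ->
  (forall x, P x -> Q x) -> {ae mu, forall x, Q x}.
Proof. by move=> H h; exact: (@filterS _ _ (ae_filter_ringOfSetsType mu) _ _ h H). Qed.

Lemma ae_and (P Q : R -> Prop) : {ae mu, forall x, P x} ->
  {ae mu, forall x, Q x} -> {ae mu, forall x, P x /\ Q x}.
Proof.
by move=> H1 H2; exact: (@filterS2 _ _ (ae_filter_ringOfSetsType mu) _ _ _
  (fun x h1 h2 => conj h1 h2) H1 H2).
Qed.

Lemma ae_all (P : R -> Prop) : (forall x, P x) -> {ae mu, forall x, P x}.
Proof. by move=> h; apply: aeW => x; exact: h. Qed.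

End AlmostEverywhere.

Section ComplexIntegral.
Context {R : realType}.
Notation mu := (@lebesgue_measure R).
Variable D : set R.
Hypothesis mD : measurable D.
Implicit Types f g : R -> R[i].

Definition cinteg f : Prop :=
  mu.-integrable D (EFin \o (fun x => complex.Re (f x))) /\
  mu.-integrable D (EFin \o (fun x => complex.Im (f x))).

Lemma cinteg_meas f : cinteg f -> cmeas D f.
Proof. by move=> [/measurable_int/measurable_EFinP h1 /measurable_int/measurable_EFinP h2]. Qed.

Lemma eq_cint f g : {in D, f =1 g} -> cint D f = cint D g.
Proof.
by move=> fg; apply: complex_eq => /=; apply: eq_Rintegral => x xD; rewrite fg.
Qed.

Lemma Rint_ae_eq (f g : R -> R) : measurable_fun D f -> measurable_fun D g ->
  {ae mu, forall x, D x -> f x = g x} ->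
  \int[mu]_(x in D) f x = \int[mu]_(x in D) g x.
Proof.
move=> mf mg H; congr fine; apply: ae_eq_integral => //.
- exact/measurable_EFinP.
- exact/measurable_EFinP.
by apply: (ae_mono H) => x fg Dx; rewrite fg.
Qed.

Lemma cint_ae_eq f g : cmeas D f -> cmeas D g ->
  {ae mu, forall x, D x -> f x = g x} -> cint D f = cint D g.
Proof.
move=> [f1 f2] [g1 g2] H; apply: complex_eq => /=; apply: Rint_ae_eq => //.
  by apply: (ae_mono H) => x fg Dx; rewrite fg.
by apply: (ae_mono H) => x fg Dx; rewrite fg.
Qed.

Lemma cinteg_ae_eq f g : cmeas D f -> cmeas D g ->
  {ae mu, forall x, D x -> f x = g x} -> cinteg f -> cinteg g.
Proof.
have E (u v : R -> R) : measurable_fun D u -> measurable_fun D v ->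
  {ae mu, forall x, D x -> u x = v x} ->
  mu.-integrable D (EFin \o u) -> mu.-integrable D (EFin \o v).
  move=> mu_ mv H /integrableP[_ h]; apply/integrableP; split.
    exact/measurable_EFinP.
  rewrite -(_ : \int[mu]_(x in D) `|(EFin \o u) x| =
    \int[mu]_(x in D) `|(EFin \o v) x|)%E //.
  apply: ae_eq_integral => //.
  - by apply: measurableT_comp => //; exact/measurable_EFinP.
  - by apply: measurableT_comp => //; exact/measurable_EFinP.
  - by apply: (ae_mono H) => x fg Dx /=; rewrite fg.
move=> [f1 f2] [g1 g2] H [i1 i2]; split.
  by apply: E i1 => //; apply: (ae_mono H) => x fg Dx; rewrite fg.
by apply: E i2 => //; apply: (ae_mono H) => x fg Dx; rewrite fg.
Qed.

Lemma cintegD f g : cinteg f -> cinteg g -> cinteg (fun x => f x + g x).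
Proof.
move=> [f1 f2] [g1 g2]; split.
  rewrite (_ : _ \o _ = (EFin \o (fun x => complex.Re (f x))) \+
    (EFin \o (fun x => complex.Re (g x))))%E; first exact: integrableD.
  by apply/funext => x /=; rewrite cReD.
rewrite (_ : _ \o _ = (EFin \o (fun x => complex.Im (f x))) \+
  (EFin \o (fun x => complex.Im (g x))))%E; first exact: integrableD.
by apply/funext => x /=; rewrite cImD.
Qed.

Let integZ (c : R) (u : R -> R) : mu.-integrable D (EFin \o u) ->
  mu.-integrable D (EFin \o (fun x => c * u x)).
Proof. exact: integrableZl. Qed.

Let integD (u v : R -> R) : mu.-integrable D (EFin \o u) ->
  mu.-integrable D (EFin \o v) -> mu.-integrable D (EFin \o (fun x => u x + v x)).
Proof. exact: integrableD. Qed.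

Let integB (u v : R -> R) : mu.-integrable D (EFin \o u) ->
  mu.-integrable D (EFin \o v) -> mu.-integrable D (EFin \o (fun x => u x - v x)).
Proof. exact: integrableB. Qed.

Lemma cintegZ (c : R[i]) f : cinteg f -> cinteg (fun x => c * f x).
Proof.
move=> [f1 f2]; split.
  under eq_fun do rewrite cReM; apply: integB; exact: integZ.
under eq_fun do rewrite cImM; apply: integD; exact: integZ.
Qed.

Lemma cintegN f : cinteg f -> cinteg (fun x => - f x).
Proof.
by move=> /(cintegZ (-1)); under [X in cinteg X -> _]eq_fun do rewrite mulN1r.
Qed.

Lemma cintegB f g : cinteg f -> cinteg g -> cinteg (fun x => f x - g x).
Proof. by move=> hf hg; apply: cintegD => //; exact: cintegN. Qed.

Lemma cinteg_conj f : cinteg f -> cinteg (fun x => conjc (f x)).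
Proof.
move=> [f1 f2]; split; first by under eq_fun do rewrite cReJ.
under eq_fun do rewrite cImJ -mulN1r; exact: integZ.
Qed.

Lemma cintD f g : cinteg f -> cinteg g ->
  cint D (fun x => f x + g x) = cint D f + cint D g.
Proof.
move=> [f1 f2] [g1 g2]; apply: complex_eq; rewrite ?cReD ?cImD /=.
  by rewrite -RintegralD //; apply: eq_Rintegral => x _; rewrite cReD.
by rewrite -RintegralD //; apply: eq_Rintegral => x _; rewrite cImD.
Qed.

Lemma cintZ (c : R[i]) f : cinteg f -> cint D (fun x => c * f x) = c * cint D f.
Proof.
move=> [f1 f2]; apply: complex_eq; rewrite ?cReM ?cImM /=.
  rewrite -!RintegralZl // -RintegralB //; try exact: integZ.
  by apply: eq_Rintegral => x _; rewrite cReM.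
rewrite -!RintegralZl // -RintegralD //; try exact: integZ.
by apply: eq_Rintegral => x _; rewrite cImM.
Qed.

Lemma cintN f : cinteg f -> cint D (fun x => - f x) = - cint D f.
Proof.
by move=> hf; rewrite -[RHS]mulN1r -cintZ //; congr cint; apply/funext => x; rewrite mulN1r.
Qed.

Lemma cintB f g : cinteg f -> cinteg g ->
  cint D (fun x => f x - g x) = cint D f - cint D g.
Proof. by move=> hf hg; rewrite cintD ?cintN //; exact: cintegN. Qed.

Lemma cint_conj f : cinteg f -> cint D (fun x => conjc (f x)) = conjc (cint D f).
Proof.
move=> [f1 f2]; apply: complex_eq; rewrite ?cReJ ?cImJ /=.
  by apply: eq_Rintegral => x _; rewrite cReJ.
rewrite -mulN1r -RintegralZl //; apply: eq_Rintegral => x _.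
by rewrite cImJ mulN1r.
Qed.

Lemma cinteg0 : cinteg (fun=> 0).
Proof. by split; exact: integrable0. Qed.

Lemma cint0 : cint D (fun=> 0) = 0 :> R[i].
Proof.
rewrite -[RHS](mul0r (cint D (fun=> 0))) -cintZ; last exact: cinteg0.
by apply: eq_cint => x _; rewrite mulr0.
Qed.

Lemma cinteg_sum I (r : seq I) (F : I -> R -> R[i]) :
  (forall i, cinteg (F i)) -> cinteg (fun x => \sum_(i <- r) F i x).
Proof.
move=> H; elim: r => [|i r IH].
  by under eq_fun do rewrite big_nil; exact: cinteg0.
by under eq_fun do rewrite big_cons; exact: cintegD.
Qed.

Lemma cint_sum I (r : seq I) (F : I -> R -> R[i]) : (forall i, cinteg (F i)) ->
  cint D (fun x => \sum_(i <- r) F i x) = \sum_(i <- r) cint D (F i).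
Proof.
move=> H; elim: r => [|i r IH].
  rewrite big_nil; apply: etrans cint0.
  by apply: eq_cint => x _; rewrite big_nil.
rewrite big_cons -IH -cintD //; last exact: cinteg_sum.
by apply: eq_cint => x _; rewrite big_cons.
Qed.

Hypothesis muD : (mu D < +oo)%E.
Local Notation m := (fine (mu D)).

Lemma bounded_cinteg f K : cmeas D f -> (forall x, D x -> nm (f x) <= K) -> cinteg f.
Proof.
move=> [h1 h2] H; split; apply: measurable_bounded_integrable => //.
  exists K; split; first exact: num_real.
  by move=> M KM x /= /H h; rewrite (le_trans (Re_le_nm _)) // (le_trans h) // ltW.
exists K; split; first exact: num_real.
by move=> M KM x /= /H h; rewrite (le_trans (Im_le_nm _)) // (le_trans h) // ltW.
Qed.

Let integ_cst (K : R) : mu.-integrable D (EFin \o (cst K : R -> R)).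
Proof.
apply: measurable_bounded_integrable => //; exists `|K|; split.
  exact: num_real.
by move=> M KM x _ /=; exact: ltW.
Qed.

Lemma Rint_le_ae (g : R -> R) K : mu.-integrable D (EFin \o g) ->
  {ae mu, forall x, D x -> g x <= K} -> \int[mu]_(x in D) g x <= K * m.
Proof.
move=> ig H.
have mg : measurable_fun D g by apply/measurable_EFinP; exact: (measurable_int mu).
have iK := integ_cst K.
have mh : measurable_fun D (fun x => Num.min (g x) K).
  by apply: measurable_minr => //; exact: measurable_cst.
have E : {ae mu, forall x, D x -> g x = Num.min (g x) K}.
  by apply: (ae_mono H) => x h Dx; apply/esym/min_idPl; exact: h.
rewrite (Rint_ae_eq mg mh E) -Rintegral_cst //; apply: le_Rintegral => //.
  apply/integrableP; split; first exact/measurable_EFinP.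
  have /integrableP[_] := ig; rewrite (_ : (\int[mu]_(x in D) `|(EFin \o g) x|)%E =
    (\int[mu]_(x in D) `|(EFin \o (fun x => Num.min (g x) K)) x|)%E) //.
  apply: ae_eq_integral => //.
  - by apply: measurableT_comp => //; exact/measurable_EFinP.
  - by apply: measurableT_comp => //; exact/measurable_EFinP.
  - by apply: (ae_mono E) => x h Dx /=; rewrite -h.
by move=> x _; rewrite ge_min lexx orbT.
Qed.

(** Minkowski's integral inequality, by duality: the norm of the integral is
    attained by pairing it with a fixed sequence, and the pairing commutes with
    the integral. *)
Lemma lp_cint p (x : int -> R -> R[i]) K : 0 <= K -> (forall k, cinteg (x k)) ->
  {ae mu, forall t, D t -> lp p (x ^~ t) K} ->
  lp p (fun k => cint D (x k)) (K * m).
Proof.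
move=> K0 ix H.
have m0 : 0 <= m by exact: fine_ge0.
pose y k := cint D (x k).
split; first exact: mulr_ge0.
move=> s us; rewrite -/y.
(* The dual sequence: the integral itself in l2, its phases in l1. Where y vanishes the
   phase is 0, as the inverse of 0 is 0. *)
pose q k : R[i] := if p then y k else (nm (y k))^-1%:C * y k.
have Eq k : complex.Re (conjc (q k) * y k) = nm (y k) ^+ p.+1.
  have E2 : complex.Re (conjc (y k) * y k) = nm (y k) ^+ 2.
    by rewrite sqr_nm; case: (y k) => a b /=; ring.
  rewrite /q; case: (p); first exact: E2.
  have [n0|n0] := eqVneq (nm (y k)) 0.
    by rewrite n0 (Normc.eq0_normc n0) !mulr0 expr1.
  rewrite expr1 conjcM conjc_real -mulrA cReM E2 mul0r subr0 expr2 mulrA.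
  by rewrite mulVf // mul1r.
pose G t := \sum_(k <- s) complex.Re (conjc (q k) * x k t).
have iG k : cinteg (fun t => conjc (q k) * x k t) by exact: cintegZ.
have EG : \sum_(k <- s) nm (y k) ^+ p.+1 = \int[mu]_(t in D) G t.
  have := cint_sum s iG => /(congr1 (@complex.Re R)) /=.
  rewrite cRe_sum => E; rewrite /G.
  under [RHS]eq_Rintegral do rewrite -cRe_sum.
  by rewrite E; apply: eq_bigr => k _; rewrite -Eq cintZ.
have iGG : mu.-integrable D (EFin \o G).
  have [+ _] := cinteg_sum s iG.
  by rewrite /G; under [X in mu.-integrable _ (_ \o X) -> _]eq_fun do rewrite cRe_sum.
pose S := \sum_(k <- s) nm (y k) ^+ p.+1.
have S0 : 0 <= S by apply: sumr_ge0 => k _; rewrite exprn_ge0 // nm_ge0.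
have HG t : lp p (x ^~ t) K -> G t <= (if p then Num.sqrt S else 1) * K.
  move=> ht.
  apply: (@le_trans _ _ (\sum_(k <- s) nm (q k) * nm (x k t))).
    apply: ler_sum => k _; apply: (le_trans (ler_norm _)).
    by rewrite (le_trans (Re_le_nm _)) // nmM nm_conj.
  case: ht => _ /(_ s us); rewrite /q /S; case: (p) => /= ht.
    rewrite -(ler_pXn2r (n := 2)) ?nnegrE ?mulr_ge0 ?sqrtr_ge0 //; last first.
      by apply: sumr_ge0 => k _; rewrite mulr_ge0 // nm_ge0.
    rewrite (le_trans (cauchy_schwarz _ _ _)) // exprMn sqr_sqrtr; last first.
      by apply: sumr_ge0 => k _; exact: sqr_ge0.
    by apply: ler_pM => //; apply: sumr_ge0 => k _; exact: sqr_ge0.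
  rewrite mul1r -[K]expr1; apply: le_trans ht; apply: ler_sum => k _.
  rewrite expr1 ler_piMl ?nm_ge0 // nmM nm_real ger0_norm ?invr_ge0 ?nm_ge0 //.
  have [->|n0] := eqVneq (nm (y k)) 0; first by rewrite mulr0.
  by rewrite mulVf.
have : S <= (if p then Num.sqrt S else 1) * K * m.
  rewrite [leLHS](EG : S = _); apply: Rint_le_ae => //.
  by apply: (ae_mono H) => t h /h; exact: HG.
rewrite -/S; case: (p) S S0 {EG HG} => S S0; last by rewrite mul1r expr1.
have [S00|Sn] := eqVneq S 0.
  by rewrite S00 => _; rewrite exprn_ge0 // mulr_ge0.
have Sp : 0 < Num.sqrt S by rewrite sqrtr_gt0 lt_def Sn.
rewrite -mulrA -{1}(sqr_sqrtr S0) expr2 ler_pM2l // => h.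
by rewrite -(sqr_sqrtr S0) ler_pXn2r ?nnegrE ?sqrtr_ge0 ?mulr_ge0.
Qed.

Lemma nm_cint_le f K : 0 <= K -> cinteg f -> (forall t, D t -> nm (f t) <= K) ->
  nm (cint D f) <= K * m.
Proof.
move=> K0 hf H.
have := @lp_cint false (fun k => if k == 0 then f else fun=> 0) K K0.
move=> /(_ _ _)/(lp_sup 0); apply.
  by move=> k; case: ifP => // _; exact: cinteg0.
apply: aeW => t Dt; split => // s us.
rewrite (eq_bigr (fun k => if k == 0 then nm (f t) else 0)); last first.
  by move=> k _; case: ifP => // _; rewrite nm0 expr1.
rewrite expr1 -big_mkcond /= -big_filter.
have := filter_pred1_uniq us.
have [s0 /(_ 0 s0) ->|s0 _] := boolP (0 \in s); first by rewrite big_seq1 H.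
rewrite (_ : [seq i <- s | i == 0] = [::]) ?big_nil //.
by apply/eqP; rewrite -(negbK (_ == _)) -has_filter; apply/hasPn => k ks /=;
  apply: contra s0 => /eqP <-.
Qed.

Lemma integ_ae_bounded (g : R -> R) (K : R) : measurable_fun D g ->
  {ae mu, forall x, D x -> `|g x| <= K} -> mu.-integrable D (EFin \o g).
Proof.
move=> mg H.
have mf : measurable_fun D (EFin \o g) by exact/measurable_EFinP.
have [||iG _ _] := @dominated_convergence _ _ _ mu D mD (fun=> EFin \o g) (EFin \o g)
  (EFin \o cst K) (fun=> mf) mf _ (integ_cst K).
- by apply: aeW => t _; exact: cvg_cst.
- by apply: (ae_mono H) => t h _ Dt /=; rewrite lee_fin h.
- exact: iG.
Qed.

Lemma Rint_dominated (u : nat -> R -> R) (g : R -> R) (K : R) :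
  (forall n, measurable_fun D (u n)) -> measurable_fun D g ->
  (forall x, D x -> u ^~ x @ \oo --> g x) ->
  {ae mu, forall x, D x -> forall n, `|u n x| <= K} ->
  (fun n => \int[mu]_(x in D) u n x) @ \oo --> \int[mu]_(x in D) g x.
Proof.
move=> hu mg ug H.
have ig : mu.-integrable D (EFin \o g).
  apply: (@integ_ae_bounded _ K mg); apply: (ae_mono H) => x h Dx.
  have cg : (fun n => `|u n x|) @ \oo --> `|g x| by apply: cvg_norm; exact: ug.
  rewrite -(cvg_lim _ cg) //.
  apply: limr_le; first by apply/cvg_ex; eexists; exact: cg.
  by apply: nearW => n; exact: h.
have hu' n : measurable_fun D (EFin \o u n) by exact/measurable_EFinP.
have mg' : measurable_fun D (EFin \o g) by exact/measurable_EFinP.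
have [||_ _ h] := @dominated_convergence _ _ _ mu D mD
  (fun n => EFin \o u n) (EFin \o g) (EFin \o cst K) hu' mg' _ (integ_cst K).
- by apply: aeW => x Dx; apply: cvg_EFin; [exact: nearW|exact: ug].
- by apply: (ae_mono H) => x h n Dx /=; rewrite lee_fin h.
apply: fine_cvg; rewrite fineK; last exact: integrable_fin_num.
exact: h.
Qed.

(** Dominated convergence for the symmetric partial sums. *)
Lemma cint_csum (b : int -> R -> R[i]) K : 0 <= K -> (forall k, cmeas D (b k)) ->
  (forall t, D t -> csummable (b ^~ t)) ->
  {ae mu, forall t, D t -> lp false (b ^~ t) K} ->
  [/\ cinteg (fun t => csum (b ^~ t)), forall k, cinteg (b k) &
      cint D (fun t => csum (b ^~ t)) = csum (fun k => cint D (b k))].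
Proof.
move=> K0 mb sb H.
have mS := cmeas_csum mb sb.
have mP N : cmeas D (fun t => \sum_(k <- irange N) b k t) by exact: cmeas_sum.
have iK := integ_cst K.
have bS t N : lp false (b ^~ t) K -> nm (\sum_(k <- irange N) b k t) <= K.
  move=> [_ /(_ _ (irange_uniq N))]; rewrite expr1; apply: le_trans.
  by apply: (le_trans (nm_sum _ _)); apply: ler_sum => k _; rewrite expr1.
have ib k : cinteg (b k).
  have [h1 h2] := mb k; split; apply: integ_ae_bounded => //.
    by apply: (ae_mono H) => t ht Dt; exact: le_trans (Re_le_nm _) (lp_sup k (ht Dt)).
  by apply: (ae_mono H) => t ht Dt; exact: le_trans (Im_le_nm _) (lp_sup k (ht Dt)).
have iS N : cinteg (fun t => \sum_(k <- irange N) b k t) by exact: cinteg_sum.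
have cvR : (fun N => \int[mu]_(t in D) complex.Re (\sum_(k <- irange N) b k t)) @ \oo
    --> \int[mu]_(t in D) complex.Re (csum (b ^~ t)).
  apply: (Rint_dominated (K := K)).
  - by move=> N; case: (mP N).
  - by case: mS.
  - by move=> t /sb/csum_cvg [].
  - by apply: (ae_mono H) => t ht Dt N; exact: le_trans (Re_le_nm _) (bS t N (ht Dt)).
have cvI : (fun N => \int[mu]_(t in D) complex.Im (\sum_(k <- irange N) b k t)) @ \oo
    --> \int[mu]_(t in D) complex.Im (csum (b ^~ t)).
  apply: (Rint_dominated (K := K)).
  - by move=> N; case: (mP N).
  - by case: mS.
  - by move=> t /sb/csum_cvg [].
  - by apply: (ae_mono H) => t ht Dt N; exact: le_trans (Im_le_nm _) (bS t N (ht Dt)).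
split => //.
  case: mS => mS1 mS2; split; apply: integ_ae_bounded => //.
    by apply: (ae_mono H) => t ht Dt; exact: le_trans (Re_le_nm _) (csum_nm_le (ht Dt)).
  by apply: (ae_mono H) => t ht Dt; exact: le_trans (Im_le_nm _) (csum_nm_le (ht Dt)).
apply/esym/csum_eq; under eq_fun do rewrite -cint_sum //.
by split.
Qed.

End ComplexIntegral.

(** * Integrals over intervals *)

Section Intervals.
Context {R : realType}.
Notation mu := (@lebesgue_measure R).
Implicit Types (f g : R -> R[i]) (a b t tau : R).

Lemma mu_itv a b : a <= b -> fine (mu `[a, b]) = b - a.
Proof.
move=> ab; rewrite lebesgue_measure_itv /= lte_fin.
case: ltP => [//|ba]; apply/esym/eqP; rewrite subr_eq0 eq_le ab /=.
by rewrite (le_trans _ ba) // lexx.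
Qed.

Lemma mu_itv_lty a b : (mu `[a, b] < +oo)%E.
Proof. by rewrite lebesgue_measure_itv /=; case: ifP => _; rewrite ?ltry. Qed.

Lemma cint_split f a b c : a <= b -> b <= c -> cinteg `[a, c] f ->
  cint `[a, c] f = cint `[a, b] f + cint `[b, c] f.
Proof.
move=> ab bc [h1 h2].
have E (g : R -> R) : mu.-integrable `[a, c] (EFin \o g) ->
    \int[mu]_(x in `[a, c]) g x =
    \int[mu]_(x in `[a, b]) g x + \int[mu]_(x in `[b, c]) g x.
  move=> ig; apply/eqP; rewrite addrC -subr_eq; apply/eqP.
  rewrite (@Rintegral_itvB _ g (BLeft a) (BRight c) b ig) ?bnd_simp //.
  rewrite Rintegral_itv_obnd_cbnd //; apply: integrableS ig => //.
  by apply: subset_itvr; rewrite bnd_simp.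
by apply: complex_eq; rewrite ?cReD ?cImD /= E.
Qed.

Lemma cintegS f a b c d : a <= c -> d <= b -> cinteg `[a, b] f ->
  cinteg `[c, d] f.
Proof.
move=> ac db [h1 h2]; split; [apply: integrableS h1|apply: integrableS h2] => //;
  by apply: subset_itv; rewrite bnd_simp.
Qed.

(** Translation invariance: the translated measure agrees with Lebesgue measure on
    half-open intervals. *)
Lemma Rint_shift (h : R -> R) a b t : a <= b ->
  mu.-integrable `[t + a, t + b] (EFin \o h) ->
  measurable_fun `[a, b] (fun s => h (t + s)) /\
  \int[mu]_(x in `[t + a, t + b]) h x = \int[mu]_(s in `[a, b]) h (t + s).
Proof.
move=> ab ih.
pose phi : measurableTypeR R -> measurableTypeR R := fun s => t + s.
have mphi : measurable_fun setT phi.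
  by apply: measurable_funD => //; exact: measurable_cst.
pose nu := measure_function.measure_function_pushforward__canonical__measure_function_Measure
  mu mphi.
have mushift A : measurable A -> mu A = nu A.
  apply: lebesgue_measure_unique.
  move=> _ /ocitvP[->|[[c d] /= cd ->]]; first by rewrite !measure0.
  rewrite /= /pushforward.
  have -> : phi @^-1` `]c, d]%classic = `]c - t, d - t]%classic.
    apply/seteqP; split => s; rewrite /phi /= !in_itv /=.
      by rewrite ltrBlDl lerBrDl.
    by rewrite ltrBlDl lerBrDl.
  rewrite !lebesgue_measure_itv /= !lte_fin ltrD2r cd -!EFinB; congr EFin.
  by ring.
pose h' := h \_ `[t + a, t + b].
have mh' : measurable_fun setT h'.
  apply/measurable_restrict => //; rewrite setTI.
  by apply/measurable_EFinP; exact: (measurable_int mu).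
have pre : phi @^-1` `[t + a, t + b]%classic = `[a, b]%classic.
  by apply/seteqP; split => s; rewrite /phi /= !in_itv /= !lerD2l.
have hh' s : `[a, b]%classic s -> h' (t + s) = h (t + s).
  move=> abs; rewrite /h' patchE mem_set //=.
  by move: abs; rewrite /= !in_itv /= !lerD2l.
have mhs : measurable_fun setT (h' \o phi) by exact: measurableT_comp.
have mhab : measurable_fun `[a, b] (fun s => h (t + s)).
  apply: (@eq_measurable_fun _ _ _ _ _ (h' \o phi)); last exact: measurable_funTS.
  by move=> s /set_mem abs; rewrite /= hh'.
split=> //.
pose D := `[t + a, t + b]%classic.
have e1 : (\int[mu]_(x in D) (h x)%:E = \int[mu]_(x in D) (h' x)%:E)%E.
  by apply: eq_integral => x xab; rewrite /h' patchE xab.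
have e2 : (\int[mu]_(s in `[a, b]) (h (t + s)%R)%:E =
    \int[mu]_(s in `[a, b]) ((EFin \o h') \o phi) s)%E.
  by apply: eq_integral => s /set_mem abs; rewrite /= hh'.
rewrite /Rintegral -/D e1 e2 -pre; congr fine.
rewrite (eq_measure_integral nu); last by move=> A mA _; exact: mushift.
rewrite (@integral_pushforward _ _ _ _ _ phi mphi mu _ (EFin \o h')) //.
- exact/measurable_EFinP.
- rewrite pre.
  have ih' : mu.-integrable `[t + a, t + b] (EFin \o h').
    apply: eq_integrable ih => // x xab; by rewrite /= /h' patchE xab.
  apply/integrableP; split.
    by apply/measurable_funTS/measurable_EFinP.
  move: ih' => /integrableP[mih]; apply: le_lt_trans.
  rewrite [leRHS](eq_measure_integral nu); last by move=> A mA _; exact: mushift.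
  rewrite ge0_integral_pushforward //; last exact: measurableT_comp.
  by rewrite pre.
- exact: measurable_itv.
Qed.

Lemma cint_shift f a b t : a <= b -> cinteg `[t + a, t + b] f ->
  cint `[t + a, t + b] f = cint `[a, b] (fun s => f (t + s)).
Proof.
move=> ab [h1 h2]; apply: complex_eq => /=.
  by have [_ ->] := Rint_shift ab h1.
by have [_ ->] := Rint_shift ab h2.
Qed.

Lemma Rint_FTC (F h : R -> R) a b : a < b -> (forall x : R, is_derive x (1 : R) F (h x)) ->
  continuous h -> \int[mu]_(x in `[a, b]) h x = F b - F a.
Proof.
move=> ab dF ch; rewrite /Rintegral (@continuous_FTC2 R h F a b) //.
- exact: continuous_subspaceT.
- have cF : continuous F.
    by move=> x; apply/differentiable_continuous/derivable1_diffP; case: (dF x).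
  split; first by move=> x _; case: (dF x).
    by apply: cvg_at_right_filter; exact: cF.
  by apply: cvg_at_left_filter; exact: cF.
- by move=> x _; rewrite derive1E; case: (dF x).
Qed.

End Intervals.

(** * Oscillatory integrals *)

Section Oscillatory.
Context {R : realType}.
Notation mu := (@lebesgue_measure R).
Implicit Types (l t tau : R).
Local Notation rc := (real_complex R).

Let cis_der l : [/\ forall x : R, is_derive x (1 : R) (fun s => sin (l * s)) (l * cos (l * x)),
  forall x : R, is_derive x (1 : R) (fun s => cos (l * s)) (- (l * sin (l * x))),
  continuous (fun s : R => cos (l * s)) & continuous (fun s : R => sin (l * s))].
Proof.
have dl (x : R) : is_derive x (1 : R) (fun s => l * s) l.
  by apply: is_derive_eq; rewrite /GRing.scale /= mulr1.
have d1 (x : R) : is_derive x (1 : R) (fun s => sin (l * s)) (l * cos (l * x)).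
  by rewrite mulrC; apply: (@is_derive1_comp R sin (fun s => l * s)).
have d2 (x : R) : is_derive x (1 : R) (fun s => cos (l * s)) (- (l * sin (l * x))).
  by rewrite mulrC -mulNr; apply: (@is_derive1_comp R cos (fun s => l * s)).
split => // x; apply/differentiable_continuous/derivable1_diffP.
  by case: (d2 x).
by case: (d1 x).
Qed.

Let integ_cont a b (h : R -> R) : continuous h -> mu.-integrable `[a, b] (EFin \o h).
Proof.
move=> ch; apply: continuous_compact_integrable; first exact: segment_compact.
exact: continuous_subspaceT.
Qed.

Lemma cinteg_cis a b l : cinteg `[a, b] (fun s => cis (l * s) : R[i]).
Proof. by have [_ _ c1 c2] := cis_der l; split; exact: integ_cont. Qed.

Let contZ (k : R) (h : R -> R) : continuous h -> continuous (fun s => k * h s).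
Proof. by move=> ch x; apply: cvgM; [exact: cvg_cst|exact: ch]. Qed.

(** The fundamental theorem of calculus for both coordinates. Multiplying by i l
    instead of dividing covers the frequency l = 0. *)
Lemma cint_cis l tau : 0 < tau ->
  'i * rc l * cint `[0, tau] (fun s => cis (l * s)) = cis (l * tau) - 1.
Proof.
move=> t0; have [d1 d2 c1 c2] := cis_der l.
have E1 := Rint_FTC t0 d1 (@contZ l _ c1).
have d2' (x : R) : is_derive x (1 : R) (fun s => cos (l * s)) (- l * sin (l * x)).
  by rewrite mulNr.
have E2 := Rint_FTC t0 d2' (@contZ (- l) _ c2).
have mI : measurable (`[0, tau] : set R) by exact: measurable_itv.
have i1 := integ_cont 0 tau c1.
have i2 := integ_cont 0 tau c2.
move: E1 E2; rewrite mulr0 sin0 cos0 subr0 !RintegralZl //.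
move=> E1 E2.
apply: complex_eq; rewrite ?cReM ?cImM ?cReD ?cImD ?cReN ?cImN /=.
  by rewrite -E2; ring.
by rewrite oppr0 addr0 -E1; ring.
Qed.

(** Integration by parts. *)
Lemma cint_scis l tau : 0 < tau ->
  'i * rc l * cint `[0, tau] (fun s => rc s * cis (l * s)) =
  rc tau * cis (l * tau) - cint `[0, tau] (fun s => cis (l * s)).
Proof.
move=> t0; have [d1 d2 c1 c2] := cis_der l.
have cs (h : R -> R) : continuous h -> continuous (fun s : R => s * h s).
  by move=> ch x; apply: cvgM; [exact: cvg_id|exact: ch].
have D1 (x : R) : is_derive x (1 : R) (fun s : R => s * sin (l * s))
    (sin (l * x) + l * (x * cos (l * x))).
  have h := is_deriveM (is_derive_id x (1 : R)) (d1 x).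
  refine (is_derive_eq h _); rewrite /GRing.scale /=; ring.
have D2 (x : R) : is_derive x (1 : R) (fun s : R => s * cos (l * s))
    (cos (l * x) + - l * (x * sin (l * x))).
  have h := is_deriveM (is_derive_id x (1 : R)) (d2 x).
  refine (is_derive_eq h _); rewrite /GRing.scale /=; ring.
have C1 : continuous (fun x : R => sin (l * x) + l * (x * cos (l * x))).
  by move=> x; apply: cvgD; [exact: c2|exact: (@contZ l _ (cs _ c1) x)].
have C2 : continuous (fun x : R => cos (l * x) + - l * (x * sin (l * x))).
  by move=> x; apply: cvgD; [exact: c1|exact: (@contZ (- l) _ (cs _ c2) x)].
have mI : measurable (`[0, tau] : set R) by exact: measurable_itv.
have i1 := integ_cont 0 tau c1.
have i2 := integ_cont 0 tau c2.
have j1 := integ_cont 0 tau (cs _ c1).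
have j2 := integ_cont 0 tau (cs _ c2).
have k1 := integ_cont 0 tau (@contZ l _ (cs _ c1)).
have k2 := integ_cont 0 tau (@contZ (- l) _ (cs _ c2)).
have E1 := Rint_FTC t0 D1 C1.
have E2 := Rint_FTC t0 D2 C2.
rewrite mul0r subr0 RintegralD // RintegralZl // in E1.
rewrite mul0r subr0 RintegralD // RintegralZl // in E2.
have r1 : \int[mu]_(x in `[0, tau]) complex.Re (rc x * cis (l * x)) =
    \int[mu]_(x in `[0, tau]) (x * cos (l * x)).
  by apply: eq_Rintegral => x _; rewrite cReM /= mul0r subr0.
have r2 : \int[mu]_(x in `[0, tau]) complex.Im (rc x * cis (l * x)) =
    \int[mu]_(x in `[0, tau]) (x * sin (l * x)).
  by apply: eq_Rintegral => x _; rewrite cImM /= mul0r addr0.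
apply: complex_eq; rewrite ?cReM ?cImM ?cReD ?cImD ?cReN ?cImN /cint r1 r2.
  by rewrite /= !mul0r !mul1r !subr0 -E2; ring.
by rewrite /= !mul0r !mul1r !addr0 ?add0r -E1; ring.
Qed.

Lemma cint_s tau : 0 < tau -> cint `[0, tau] (fun s => rc s) = rc (tau ^+ 2 / 2).
Proof.
move=> t0; apply: complex_eq => /=; last first.
  by rewrite Rintegral_cst ?mul0r //; exact: measurable_itv.
have D1 (x : R) : is_derive x (1 : R) (fun s : R => 2^-1 * (s * s)) x.
  have h := is_deriveZ 2^-1 (is_deriveM (is_derive_id x (1 : R)) (is_derive_id x (1 : R))).
  refine (is_derive_eq h _); rewrite /GRing.scale /=; lra.
rewrite (Rint_FTC t0 D1); last by move=> x; exact: cvg_id.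
by field.
Qed.

Lemma cint_1 tau : 0 < tau -> cint `[0, tau] (fun=> 1) = rc tau.
Proof.
move=> t0; apply: complex_eq => /=.
  rewrite Rintegral_cst ?mul1r; last exact: measurable_itv.
  by rewrite mu_itv ?subr0 // ltW.
by rewrite Rintegral_cst ?mul0r //; exact: measurable_itv.
Qed.

Lemma cexp_imag (y s : R) : cexp ((0 +i* y) * rc s) = cis (y * s).
Proof.
rewrite /cexp /= !mul0r mulr0 subrr expR0 add0r.
by rewrite -[_%:C]/(1 : R[i]) mul1r.
Qed.

(** The change of variable s -> tau s turns psi_1 into a time integral over one step. *)
Lemma psi1_int l tau : 0 < tau ->
  rc tau * psi1 (0 +i* (l * tau)) = cint `[0, tau] (fun s => cis (l * s)).
Proof.
move=> t0.
have E : psi1 (0 +i* (l * tau)) = cint `[0, 1] (fun s => cis (l * tau * s)).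
  by apply: eq_cint => s _; exact: cexp_imag.
rewrite E; have [->|l0] := eqVneq l 0.
  have C (T : R) : cint `[0, T] (fun s => cis (0 * s)) = cint `[0, T] (fun=> 1).
    by apply: eq_cint => s _; rewrite mul0r cis0.
  by rewrite mul0r !C !cint_1 // mulr1.
have il : 'i * rc l != 0.
  rewrite mulf_neq0 //; first by rewrite eq_complex /= oner_eq0 andbF.
  by rewrite eq_complex /= negb_and l0.
apply: (mulfI il); rewrite cint_cis //.
rewrite -[in RHS](mulr1 (l * tau)) -cint_cis ?ltr01 //.
by rewrite rmorphM /= -!mulrA.
Qed.

Lemma psi2_int l tau : 0 < tau ->
  rc (tau ^+ 2) * psi2 (0 +i* (l * tau)) =
  cint `[0, tau] (fun s => rc s * cis (l * s)).
Proof.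
move=> t0.
have E : psi2 (0 +i* (l * tau)) = cint `[0, 1] (fun s => rc s * cis (l * tau * s)).
  by apply: eq_cint => s _; rewrite cexp_imag.
have [l0|l0] := eqVneq l 0.
  have C (T : R) : cint `[0, T] (fun s => rc s * cis (l * s)) = cint `[0, T] (fun s => rc s).
    by apply: eq_cint => s _; rewrite l0 mul0r cis0 mulr1.
  have C' : cint `[0, 1] (fun s => rc s * cis (l * tau * s)) = cint `[0, 1] (fun s => rc s).
    by apply: eq_cint => s _; rewrite l0 !mul0r cis0 mulr1.
  by rewrite E C C' !cint_s // -rmorphM expr1n div1r.
have il : 'i * rc l != 0.
  rewrite mulf_neq0 //; first by rewrite eq_complex /= oner_eq0 andbF.
  by rewrite eq_complex /= negb_and l0.
apply: (mulfI il); rewrite cint_scis // -psi1_int // E.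
have -> : psi1 (0 +i* (l * tau)) = cint `[0, 1] (fun s => cis (l * tau * s)).
  by apply: eq_cint => s _; exact: cexp_imag.
have := cint_scis (l * tau) ltr01; rewrite mulr1 mul1r => E1.
have -> : cint `[0, 1] (fun s => cis (l * tau * s)) = cis (l * tau) -
   'i * rc (l * tau) * cint `[0, 1] (fun s => rc s * cis (l * tau * s)).
  by rewrite E1; ring.
by rewrite expr2 !rmorphM; ring.
Qed.

(** J_3 is the integral of s e^(2 i s dxx) over the step, written in closed form by an
    integration by parts; undoing it puts J_3 on the same footing as J_1 and J_2. *)
Lemma J3_symbol (q tau : R) : 0 < tau -> q != 0 ->
  - ('i * rc tau / 2) * cis (- (2 * tau * q)) * rc (- q^-1)
  + 'i * rc tau / 2 * psi1 (0 +i* (- (2 * tau * q))) * rc (- q^-1) =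
  cint `[0, tau] (fun s => rc s * cis (- 2 * q * s)).
Proof.
move=> t0 q0.
have il : 'i * rc (- 2 * q) != 0.
  rewrite mulf_neq0 //; first by rewrite eq_complex /= oner_eq0 andbF.
  by rewrite eq_complex /= negb_and mulf_neq0 // oppr_eq0 pnatr_eq0.
apply: (mulfI il); rewrite cint_scis // -psi1_int //.
have -> : - (2 * tau * q) = - 2 * q * tau by ring.
set c := cis _; set p := psi1 _.
have ii : 'i * 'i = -1 :> R[i] by rewrite -expr2 sqr_i.
have qq : rc q * rc q^-1 = 1 by rewrite -rmorphM mulfV.
have two : (2 : R[i]) != 0 by rewrite pnatr_eq0.
transitivity (- ('i * 'i) * (rc q * rc q^-1) * (rc tau * c - rc tau * p)).
  have -> : rc (- 2 * q) = - 2 * rc q by rewrite rmorphM rmorphN rmorph_nat.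
  have -> : rc (- q^-1) = - rc q^-1 by rewrite rmorphN.
  by move: (rc q) (rc q^-1) (rc tau) => a b t; field.
by rewrite ii qq; ring.
Qed.

End Oscillatory.

(** * Fourier series with summable coefficients *)

Section FourierSeries.
Context {R : realType}.
Notation mu := (@lebesgue_measure R).
Notation Om := (@Omega R).
Local Notation rc := (real_complex R).
Implicit Types (a b : int -> R[i]) (f g : R -> R[i]) (k : int).

Lemma mOm : measurable Om.
Proof. exact: measurable_itv. Qed.

Lemma muOm_lty : (mu Om < +oo)%E.
Proof. by rewrite lebesgue_measure_itv /=; case: ifP => _; rewrite ?ltry. Qed.

Lemma muOm : fine (mu Om) = 2 * pi.
Proof.
rewrite lebesgue_measure_itv /= lte_fin.
have p0 := pi_gt0 R.
by rewrite (_ : - pi < pi) /=; [ring|lra].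
Qed.

Lemma cis_2pi k : cis (k%:~R * (2 * pi)) = 1 :> R[i].
Proof.
have N (n : nat) : cis (n%:R * (2 * pi)) = 1 :> R[i].
  elim: n => [|n IH]; first by rewrite mul0r cis0.
  rewrite -natr1 mulrDl cisD IH mul1r mul1r /cis.
  have -> : 2 * pi = pi *+ 2 :> R by rewrite mulr_natl.
  by rewrite cos2pi sin2pi.
case: k => n; first exact: N.
rewrite NegzE mulrNz mulNr -conj_cis -[_.+1%:~R]/(n.+1%:R) N.
by rewrite conjc1.
Qed.

Lemma cint_Om_cis k : cint Om (fun x => cis (k%:~R * x)) =
  if k == 0 then rc (2 * pi) else 0.
Proof.
have p0 := pi_gt0 R.
case: eqVneq => [->|k0].
  apply: complex_eq => /=.
    rewrite (@eq_Rintegral _ _ _ mu Om (cst 1)); last by move=> x _; rewrite mul0r cos0.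
    by rewrite Rintegral_cst ?mul1r ?muOm //; exact: mOm.
  rewrite (@eq_Rintegral _ _ _ mu Om (cst 0)); last by move=> x _; rewrite mul0r sin0.
  by rewrite Rintegral_cst ?mul0r //; exact: mOm.
have -> : cint Om (fun x => cis (k%:~R * x)) =
    cint `[- pi, pi] (fun x => cis (k%:~R * x)).
  have [i1 i2] := @cinteg_cis R (- pi) pi k%:~R.
  have E (h : R -> R) : mu.-integrable `[- pi, pi] (EFin \o h) ->
     \int[mu]_(x in Om) h x = \int[mu]_(x in `[- pi, pi]) h x.
    move=> ih; rewrite /Omega Rintegral_itv_bndo_bndc; last first.
      by apply: integrableS ih => //; apply: subset_itv; rewrite bnd_simp.
    rewrite Rintegral_itv_obnd_cbnd //.
    by apply: integrableS ih => //; apply: subset_itv; rewrite bnd_simp.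
  by apply: complex_eq; rewrite /= E.
have kn : k%:~R != 0 :> R by rewrite intr_eq0.
have il : 'i * rc k%:~R != 0.
  rewrite mulf_neq0 //; first by rewrite eq_complex /= oner_eq0 andbF.
  by rewrite eq_complex /= negb_and kn.
apply: (mulfI il); rewrite mulr0.
have e1 : - pi + 0 = - pi :> R by rewrite addr0.
have e2 : - pi + 2 * pi = pi :> R by ring.
rewrite -e1 -{2}e2 cint_shift; last 2 first.
- by rewrite mulr_ge0 // ltW.
- exact: cinteg_cis.
rewrite (eq_cint (g := fun s => cis (k%:~R * - pi) * cis (k%:~R * s))); last first.
  by move=> s _; rewrite mulrDr cisD.
rewrite cintZ; last 2 first.
- exact: measurable_itv.
- exact: cinteg_cis.
by rewrite mulrCA cint_cis ?mulr_gt0 // cis_2pi subrr mulr0.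
Qed.

(** The sum of the Fourier series with given coefficients. *)
Definition Fs a (x : R) : R[i] := csum (fun k => a k * cis (k%:~R * x)).

Lemma fmultE (s : int -> R[i]) f : fmult s f = Fs (fun k => s k * fourier f k).
Proof. by []. Qed.

Lemma csummable_cis a (t : int -> R) : csummable a ->
  csummable (fun k => a k * cis (t k)).
Proof.
move=> [K ha]; exists K; apply: (le_lp1 _ ha) => k.
by rewrite nmM nm_cis mulr1.
Qed.

Lemma Fs_bounded a K x : lp false a K -> nm (Fs a x) <= K.
Proof.
move=> ha; apply: csum_nm_le; apply: (le_lp1 _ ha) => k.
by rewrite nmM nm_cis mulr1.
Qed.

Lemma cmeas_cisl (D : set R) (l : R) : cmeas D (fun x => cis (l * x)).
Proof.
by apply: cmeas_cis; apply: measurable_funM => //; exact: measurable_cst.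
Qed.

Lemma cmeas_cisNl (D : set R) (l : R) : cmeas D (fun x => cis (- (l * x))).
Proof.
apply: cmeas_cis; apply: measurableT_comp => //.
Qed.

Lemma cmeas_Fs (D : set R) a : csummable a -> cmeas D (Fs a).
Proof.
move=> ha; apply: (cmeas_csum (b := fun k x => a k * cis (k%:~R * x))).
  by move=> k; apply: cmeasM; [exact: cmeas_cst|exact: cmeas_cisl].
by move=> x _; exact: csummable_cis.
Qed.

Lemma cinteg_Fs a : csummable a -> cinteg Om (Fs a).
Proof.
move=> ha; have [K hK] := ha.
apply: (bounded_cinteg mOm muOm_lty (cmeas_Fs _ ha)) => x _; exact: Fs_bounded hK.
Qed.

(** The series is integrated against g term by term. *)
Lemma fourier_FsM a g G : csummable a -> cmeas Om g -> (forall x, nm (g x) <= G) ->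
  forall k, fourier (fun x => Fs a x * g x) k =
            csum (fun j => a j * fourier g (k - j)).
Proof.
move=> sa mg hG k; have [K ha] := sa.
have G0 : 0 <= G by exact: le_trans (nm_ge0 _) (hG 0).
pose b j x := a j * (g x * cis (- ((k - j)%:~R * x))).
have mb j : cmeas Om (b j).
  by apply: cmeasM; [exact: cmeas_cst|apply: cmeasM => //; exact: cmeas_cisNl].
have lb x : lp false (b ^~ x) (G * K).
  apply: (le_lp G0 _ ha) => j; rewrite /b !nmM nm_cis mulr1 mulrC.
  by rewrite ler_wpM2r // nm_ge0.
have [_ ib Eb] := cint_csum mOm muOm_lty (mulr_ge0 G0 (lp_ge0 ha)) mb
  (fun x _ => lp_csummable (lb x)) (ae_all (fun x _ => lb x)).
have ig j : cinteg Om (fun x => g x * cis (- ((k - j)%:~R * x))).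
  apply: (bounded_cinteg (K := G) mOm muOm_lty) => [|x _].
    by apply: cmeasM => //; exact: cmeas_cisNl.
  by rewrite nmM nm_cis mulr1.
rewrite /fourier.
have -> : cint Om (fun x => Fs a x * g x * cis (- (k%:~R * x))) =
    cint Om (fun x => csum (b ^~ x)).
  apply: eq_cint => x _; rewrite -mulrA mulrC /Fs -csumZ; last exact: csummable_cis.
  apply: eq_csum => j; rewrite /b.
  have -> : - ((k - j)%:~R * x) = j%:~R * x + - (k%:~R * x).
    by rewrite rmorphB /=; ring.
  by rewrite cisD; ring.
rewrite Eb -csumZ.
  apply: eq_csum => j; rewrite /b cintZ //; last exact: mOm.
  by rewrite mulrCA.
have mu0 : 0 <= fine (mu Om) by exact: fine_ge0.
exists (G * K * fine (mu Om)).
apply: (lp_cint mOm muOm_lty _ ib (ae_all (fun x _ => lb x))).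
exact: mulr_ge0 G0 (lp_ge0 ha).
Qed.

Lemma fourier1 k : fourier (fun=> 1) k = if k == 0 then 1 else 0 :> R[i].
Proof.
rewrite /fourier (eq_cint (g := fun x => cis ((- k)%:~R * x))); last first.
  by move=> x _; rewrite mul1r rmorphN /= mulNr.
rewrite cint_Om_cis oppr_eq0; case: eqP => _; last by rewrite mulr0.
rewrite -rmorphM mulVf // mulf_neq0 // gt_eqF //; exact: pi_gt0.
Qed.

Lemma fourier_Fs a : csummable a -> forall k, fourier (Fs a) k = a k.
Proof.
move=> sa k.
have := @fourier_FsM a (fun=> 1) 1 sa (cmeas_cst _ _) _ k.
rewrite (_ : (fun x => Fs a x * 1) = Fs a); last by apply/funext => x; rewrite mulr1.
move=> -> //; last by move=> _; rewrite nm1.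
rewrite (csum_single (j := k)).
  by rewrite subrr fourier1 eqxx mulr1.
by move=> j jk; rewrite fourier1 subr_eq0 eq_sym (negbTE jk) mulr0.
Qed.

Lemma fourier_FsFs a b : csummable a -> csummable b ->
  forall k, fourier (fun x => Fs a x * Fs b x) k = convol a b k.
Proof.
move=> sa sb k; have [B hb] := sb.
rewrite (@fourier_FsM a (Fs b) B sa (cmeas_Fs _ sb)); last first.
  by move=> x; exact: Fs_bounded hb.
by apply: eq_csum => j; rewrite fourier_Fs.
Qed.

(** Both sides are the coefficients of the same pointwise product. *)
Lemma convol_comm a b : csummable a -> csummable b -> convol a b =1 convol b a.
Proof.
move=> ha hb k; have E : (fun x => Fs a x * Fs b x) = (fun x => Fs b x * Fs a x).
  by apply/funext => x; rewrite mulrC.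
by rewrite -fourier_FsFs // E fourier_FsFs.
Qed.

End FourierSeries.

(** * A function is determined by its Fourier coefficients *)

Section Uniqueness.
Context {R : realType}.
Notation mu := (@lebesgue_measure R).
Notation Om := (@Omega R).
Local Notation rc := (real_complex R).
Implicit Types (f g : R -> R[i]) (k : int).

(** Polynomials that converge boundedly to the indicator of y < 1/2 on [0, 1]. *)
Definition stepoly (y : R) (n : nat) : R := (1 - y ^+ n) ^+ (2 ^ n).

Lemma bernoulli_ge (x : R) n : 0 <= x -> 1 + n%:R * x <= (1 + x) ^+ n.
Proof.
move=> x0; elim: n => [|n IH]; first by rewrite mul0r addr0 expr0.
rewrite exprS; apply: le_trans (ler_wpM2l _ IH); last by rewrite addr_ge0.
rewrite -natr1 mulrDl mul1r mulrDl mul1r mulrDr mulr1.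
have : 0 <= x * (n%:R * x) by rewrite !mulr_ge0.
by lra.
Qed.

Lemma bernoulli_le (x : R) n : 0 <= x <= 1 -> 1 - n%:R * x <= (1 - x) ^+ n.
Proof.
move=> /andP[x0 x1]; elim: n => [|n IH]; first by rewrite mul0r subr0 expr0.
rewrite exprS; apply: le_trans (ler_wpM2l _ IH); last by rewrite subr_ge0.
have : 0 <= x * (n%:R * x) by rewrite !mulr_ge0.
by rewrite -natr1; lra.
Qed.

Lemma stepoly01 (y : R) n : 0 <= y <= 1 -> 0 <= stepoly y n <= 1.
Proof.
move=> /andP[y0 y1]; have h : 0 <= 1 - y ^+ n <= 1.
  by rewrite subr_ge0 exprn_ile1 //= lerBlDr lerDl exprn_ge0.
case/andP: h => h1 h2; by rewrite /stepoly exprn_ge0 //= exprn_ile1.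
Qed.

(** By Bernoulli's inequality, 1 - (2 y)^n is a lower bound. *)
Lemma stepoly_lt (y : R) : 0 <= y < 2^-1 -> stepoly y @ \oo --> (1 : R).
Proof.
move=> /andP[y0 y1].
have h0 : (fun n => 1 - (2 * y) ^+ n) @ \oo --> (1 : R).
  rewrite -[X in _ --> X]subr0; apply: cvgB; first exact: cvg_cst.
  apply: cvg_expr; rewrite ger0_norm ?mulr_ge0 //; lra.
have h1 : (fun _ : nat => 1 : R) @ \oo --> (1 : R) by exact: cvg_cst.
apply: (squeeze_cvgr _ h0 h1); apply: nearW => n.
have y01 : 0 <= y <= 1 by rewrite y0 /=; lra.
have /andP[_ ->] := stepoly01 n y01; rewrite andbT.
rewrite /stepoly; apply: le_trans (bernoulli_le _ _).
  by rewrite natrX exprMn.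
by rewrite exprn_ge0 //= exprn_ile1 //; lra.
Qed.

(** As (1 - x)^m (1 + x)^m <= 1, the polynomial is at most 1 / (m x) with m = 2^n and
    x = y^n. *)
Lemma stepoly_gt (y : R) : 2^-1 < y <= 1 -> stepoly y @ \oo --> (0 : R).
Proof.
move=> /andP[y0 y1].
have yp : 0 < y by lra.
have h0 : (fun n => (2 * y)^-1 ^+ n) @ \oo --> (0 : R).
  apply: cvg_expr; rewrite ger0_norm ?invr_ge0 ?mulr_ge0 ?ltW //.
  by rewrite invf_lt1; lra.
have h1 : (fun _ : nat => 0 : R) @ \oo --> (0 : R) by exact: cvg_cst.
apply: (squeeze_cvgr _ h1 h0); apply: nearW => n.
have y01 : 0 <= y <= 1 by rewrite (ltW yp).
have /andP[-> _] := stepoly01 n y01; rewrite /=.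
set x := y ^+ n; have x0 : 0 <= x by rewrite exprn_ge0 // ltW.
have x1 : x <= 1 by rewrite exprn_ile1 // ltW.
have D : 0 < (2 ^ n)%:R * x by rewrite mulr_gt0 ?exprn_gt0 // ltr0n expn_gt0.
rewrite exprVn exprMn -natrX -/x -[leRHS]mul1r ler_pdivlMr //.
apply: (@le_trans _ _ ((1 - x) ^+ (2 ^ n) * (1 + x) ^+ (2 ^ n))).
  apply: ler_wpM2l; first by rewrite exprn_ge0 // subr_ge0.
  by apply: le_trans (bernoulli_ge _ x0); rewrite lerDr.
rewrite -exprMn exprn_ile1 //.
  by rewrite mulr_ge0 ?subr_ge0 ?addr_ge0.
have := sqr_ge0 x; rewrite expr2; lra.
Qed.

(** Orthogonality to all exponentials is inherited by products with
    trigonometric polynomials. *)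
Definition trig_null f : Prop :=
  cinteg Om f /\ forall k, cint Om (fun x => f x * cis (k%:~R * x)) = 0.

Lemma cinteg_trig f k : cinteg Om f -> cinteg Om (fun x => f x * cis (k%:~R * x)).
Proof.
move=> hf; have [mf1 mf2] := cinteg_meas hf.
have mp : cmeas Om (fun x => f x * cis (k%:~R * x)).
  by apply: cmeasM; [exact: cinteg_meas|exact: cmeas_cisl].
case: hf => i1 i2.
have iab : mu.-integrable Om (EFin \o (fun x => `|complex.Re (f x)| + `|complex.Im (f x)|)).
  rewrite (_ : _ \o _ = ((abse \o (EFin \o (fun x => complex.Re (f x)))) \+
    (abse \o (EFin \o (fun x => complex.Im (f x)))))%E) //.
  by apply: integrableD => //; [exact: mOm|exact: integrable_abse|exact: integrable_abse].
case: mp => m1 m2; split.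
  apply: (@le_integrable _ _ _ mu Om mOm _ _ _ _ iab); first exact/measurable_EFinP.
  move=> x _ /=; rewrite lee_fin (le_trans (Re_le_nm _)) // nmM nm_cis mulr1.
  by rewrite (le_trans (nm_le_ReIm _)) // ler_norm.
apply: (@le_integrable _ _ _ mu Om mOm _ _ _ _ iab); first exact/measurable_EFinP.
move=> x _ /=; rewrite lee_fin (le_trans (Im_le_nm _)) // nmM nm_cis mulr1.
by rewrite (le_trans (nm_le_ReIm _)) // ler_norm.
Qed.

Let trig_nullM f k : trig_null f -> trig_null (fun x => f x * cis (k%:~R * x)).
Proof.
move=> [hf h]; split; first exact: cinteg_trig.
move=> j; rewrite -[RHS](h (k + j)); congr cint; apply/funext => x.
by rewrite rmorphD /= mulrDl cisD mulrA.
Qed.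

Let trig_nullZ (c : R[i]) f : trig_null f -> trig_null (fun x => c * f x).
Proof.
move=> [hf h]; split; first exact: (cintegZ mOm c hf).
move=> k; rewrite (eq_cint (g := fun x => c * (f x * cis (k%:~R * x)))).
  by rewrite cintZ ?h ?mulr0 //; [exact: mOm|exact: cinteg_trig].
by move=> x _; rewrite mulrA.
Qed.

Let trig_nullD f g : trig_null f -> trig_null g -> trig_null (fun x => f x + g x).
Proof.
move=> [hf h] [hg h']; split; first exact: (cintegD mOm hf hg).
move=> k; rewrite (eq_cint (g := fun x => f x * cis (k%:~R * x) + g x * cis (k%:~R * x))).
  by rewrite cintD ?h ?h' ?addr0 //; [exact: mOm|exact: cinteg_trig|exact: cinteg_trig].
by move=> x _; rewrite mulrDl.
Qed.

(** A trigonometric polynomial with values in [0, 1] that exceeds 1/2 on the interval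
    of centre x0 and radius d and is below 1/2 on the rest of the period. *)
Definition hill (x0 d x : R) : R := 2^-1 + (cos (x - x0) - cos d) / 4.

Lemma hill01 x0 d x : 0 <= hill x0 d x <= 1.
Proof.
rewrite /hill; have := cos_le1 (x - x0); have := cos_geN1 (x - x0).
have := cos_le1 d; have := cos_geN1 d; lra.
Qed.

Let trig_null_hill x0 d f : trig_null f -> trig_null (fun x => f x * rc (hill x0 d x)).
Proof.
move=> hf.
have := trig_nullD (trig_nullZ (rc (2^-1 - cos d / 4)) hf)
  (trig_nullD (trig_nullZ (rc 8^-1 * cis (- x0)) (trig_nullM 1 hf))
              (trig_nullZ (rc 8^-1 * cis x0) (trig_nullM (-1) hf))).
congr trig_null; apply/funext => x.
have -> : rc (hill x0 d x) = rc (2^-1 - cos d / 4) +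
   (rc 8^-1 * cis (- x0) * cis (1%:~R * x) + rc 8^-1 * cis x0 * cis ((-1)%:~R * x)).
  rewrite -!mulrA -!cisD -mulrDr mul1r mulN1r addrC [- x0 + x]addrC.
  have -> : x0 - x = - (x - x0) by ring.
  rewrite /hill; apply: complex_eq; rewrite ?cReD ?cReM ?cImD ?cImM ?cReD ?cImD /=.
    by rewrite cosN; field.
  by rewrite sinN; ring.
by ring.
Qed.

Let trig_null_step x0 d n f : trig_null f ->
  trig_null (fun x => f x * rc (stepoly (hill x0 d x) n)).
Proof.
move=> hf.
have P1 m g : trig_null g -> trig_null (fun x => g x * rc (hill x0 d x ^+ m)).
  elim: m g => [|m IH] g hg.
    by move: hg; congr trig_null; apply/funext => x; rewrite expr0 mulr1.
  have := IH _ (trig_null_hill x0 d hg); congr trig_null; apply/funext => x.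
  by rewrite exprS rmorphM mulrA.
have P2 g : trig_null g -> trig_null (fun x => g x * rc (1 - hill x0 d x ^+ n)).
  move=> hg; have := trig_nullD hg (trig_nullZ (-1) (P1 n _ hg)).
  by congr trig_null; apply/funext => x; rewrite rmorphB rmorph1; ring.
have P3 m g : trig_null g -> trig_null (fun x => g x * rc ((1 - hill x0 d x ^+ n) ^+ m)).
  elim: m g => [|m IH] g hg.
    by move: hg; congr trig_null; apply/funext => x; rewrite expr0 mulr1.
  have := IH _ (P2 _ hg); congr trig_null; apply/funext => x.
  by rewrite exprS rmorphM mulrA.
exact: P3.
Qed.

Lemma trig_null_step_int x0 d n f : trig_null f ->
  cint Om (fun x => f x * rc (stepoly (hill x0 d x) n)) = 0.
Proof.
move=> /(trig_null_step x0 d n)[_ /(_ 0)] <-; congr cint; apply/funext => x.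
by rewrite mul0r cis0 mulr1.
Qed.

Lemma hill_half (a b x : R) : - pi <= a -> a < b -> b <= pi -> Om x ->
  let y := hill ((a + b) / 2) ((b - a) / 2) x in
  (a < x < b -> 2^-1 < y) /\ (x < a \/ b < x -> y < 2^-1).
Proof.
move=> ha ab hb /=; rewrite /Omega /= in_itv /= => /andP[x1 x2].
rewrite /hill; set x0 := (a + b) / 2; set d := (b - a) / 2.
have -> : cos (x - x0) = cos `|x - x0| by rewrite cos_norm.
have d0 : 0 < d by rewrite /d; lra.
have dpi : d <= pi by rewrite /d; lra.
have t0 : 0 <= `|x - x0| by [].
have dI : d \in `[0, pi] by rewrite in_itv /= (ltW d0).
split=> H.
  have td : `|x - x0| < d by rewrite ltr_norml /x0 /d; lra.
  have tI : `|x - x0| \in `[0, pi] by rewrite in_itv /= t0 /=; lra.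
  have : cos d < cos `|x - x0| by rewrite ltr_cos.
  lra.
have td : d < `|x - x0| by rewrite ltr_normr /x0 /d; case: H => h; apply/orP; [right|left]; lra.
suff : cos `|x - x0| < cos d by lra.
(* At a distance from x0 larger than pi, the cosine is that of the reflected angle. *)
have [tp|tp] := leP `|x - x0| pi.
  by rewrite ltr_cos // in_itv /= t0.
have t2 : `|x - x0| < 2 * pi - d by rewrite ltr_norml /x0 /d; lra.
have -> : cos `|x - x0| = cos (pi *+ 2 - `|x - x0|).
  by rewrite cosB cos2pi sin2pi; ring.
have e : pi *+ 2 = 2 * pi :> R by rewrite mulr_natl.
rewrite ltr_cos // ?e; first by lra.
by rewrite in_itv /=; lra.
Qed.

(** The trigonometric polynomials [stepoly] of [hill] converge boundedly to the
    indicator of the complement of the interval. *)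
Let null_itv (h : R -> R) (a b : R) : - pi <= a -> a < b -> b <= pi ->
  mu.-integrable Om (EFin \o h) -> \int[mu]_(x in Om) h x = 0 ->
  (forall x0 d n, \int[mu]_(x in Om) (h x * stepoly (hill x0 d x) n) = 0) ->
  \int[mu]_(x in `]a, b[) h x = 0.
Proof.
move=> ha ab hb ih h0 hn.
set x0 := (a + b) / 2; set d := (b - a) / 2.
have mh : measurable_fun Om h by apply/measurable_EFinP; exact: (measurable_int mu).
have mO : measurable Om := @mOm R.
pose hab := h \_ `]a, b[.
have mhab : measurable_fun Om hab.
  apply/measurable_restrict => //.
  by apply: measurable_funS mh => // x [].
have ms n : measurable_fun Om (fun x => stepoly (hill x0 d x) n).
  apply: measurable_funTS; apply: continuous_measurable_fun => x.
  rewrite /stepoly; apply: (@continuous_comp _ _ _ (fun x => hill x0 d x)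
     (fun y => (1 - y ^+ n) ^+ (2 ^ n))).
    rewrite /hill; apply: cvgD; first exact: cvg_cst.
    apply: cvgM; last exact: cvg_cst.
    apply: cvgB; last exact: cvg_cst.
    apply: continuous_comp; last exact: continuous_cos.
    by apply: cvgB; [exact: cvg_id|exact: cvg_cst].
  apply: (@continuous_comp _ _ _ (fun y : R => 1 - y ^+ n) (fun y => y ^+ (2 ^ n))).
    by apply: cvgB; [exact: cvg_cst|exact: exprn_continuous].
  exact: exprn_continuous.
have Dn n : measurable_fun Om (EFin \o (fun x => h x * stepoly (hill x0 d x) n)).
  by apply/measurable_EFinP; exact: measurable_funM.
have D' : measurable_fun Om (EFin \o (fun x => h x - hab x)).
  by apply/measurable_EFinP; exact: measurable_funB.
have ne (c : R) : {ae mu, forall x : R, x != c}.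
  exists [set c]; split; [exact: measurable_set1|exact: lebesgue_measure_set1|].
  by move=> x /= /negP; rewrite negbK => /eqP.
have L : {ae mu, forall x, Om x ->
    (fun n => (EFin \o (fun x => h x * stepoly (hill x0 d x) n)) x) @ \oo
      --> (EFin \o (fun x => h x - hab x)) x}.
  apply: (ae_mono (ae_and (ne a) (ne b))) => x [xa xb] Ox.
  apply: cvg_EFin; first exact: nearW.
  have [H1 H2] := hill_half ha ab hb Ox.
  have /andP[y0 y1] := hill01 x0 d x.
  rewrite /hab patchE; case: ifPn.
    rewrite inE /= in_itv /= => /H1 h1; rewrite subrr.
    rewrite -[X in _ --> X](mulr0 (h x)); apply: cvgM; first exact: cvg_cst.
    by apply: stepoly_gt; rewrite h1.
  rewrite notin_setE /= in_itv /= => H.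
  have : x < a \/ b < x.
    case: (ltP x a) => [|ax]; [by left|right].
    rewrite lt_neqAle eq_sym xb /= leNgt; apply/negP => xlb; apply: H.
    by rewrite xlb lt_neqAle eq_sym xa ax.
  move=> /H2 h2; rewrite /point /= subr0.
  rewrite -[X in _ --> X](mulr1 (h x)); apply: cvgM; first exact: cvg_cst.
  by apply: stepoly_lt; rewrite y0.
have Dom : {ae mu, forall x, forall n : nat, Om x ->
    (`|(EFin \o (fun x => h x * stepoly (hill x0 d x) n)%R) x| <=
     (abse \o (EFin \o h)) x)%E}.
  apply: ae_all => x n _ /=; rewrite lee_fin normrM ler_piMr //.
  by have /andP[s0 s1] := stepoly01 n (hill01 x0 d x); rewrite ger0_norm.
have [iL _ cv] := @dominated_convergence _ _ _ mu Om mO _ _ _ Dn D' L (integrable_abse ih) Dom.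
have e0 : \int[mu]_(x in Om) (h x - hab x) = 0.
  have : (fun n => \int[mu]_(x in Om) (h x * stepoly (hill x0 d x) n)) @ \oo
     --> \int[mu]_(x in Om) (h x - hab x).
    by apply: fine_cvg; rewrite fineK; [exact: cv|exact: integrable_fin_num].
  move=> /cvg_lim <- //; under eq_fun do rewrite hn.
  by apply: lim_cst.
have ihab : mu.-integrable Om (EFin \o hab).
  rewrite (_ : _ \o _ = (EFin \o h) \- (EFin \o (fun x => h x - hab x)%R))%E.
    exact: integrableB.
  by apply/funext => x /=; rewrite -EFinB subKr.
rewrite RintegralB // h0 sub0r in e0.
have : \int[mu]_(x in Om) hab x = 0 by apply/eqP; rewrite -oppr_eq0 e0.
rewrite /hab -Rintegral_mkcondr; congr (_ = 0); congr (Rintegral _ _ _).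
apply/seteqP; split => x /=; first by case.
move=> xab; split => //; move: xab; rewrite /Omega /= !in_itv /= => /andP[h1 h2].
by rewrite (le_lt_trans ha h1) (lt_le_trans h2 hb).
Qed.

(** The primitive of h vanishes, hence so does h at its Lebesgue points. *)
Let null_real (h : R -> R) : mu.-integrable Om (EFin \o h) ->
  \int[mu]_(x in Om) h x = 0 ->
  (forall x0 d n, \int[mu]_(x in Om) (h x * stepoly (hill x0 d x) n) = 0) ->
  {ae mu, forall x, Om x -> h x = 0}.
Proof.
move=> ih h0 hn.
pose g := h \_ Om.
have mO : measurable Om := @mOm R.
have ig : mu.-integrable setT (EFin \o g).
  by rewrite /g -restrict_EFin; apply/integrable_restrict => //; rewrite setTI.
have ig' (A : set R) : measurable A -> mu.-integrable A (EFin \o g).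
  by move=> mA; apply: integrableS ig.
have lg : locally_integrable setT g by exact: integrable_locally.
have H := @FTC1 R g (BRight (- pi)) (fun y => ig' _ (measurable_itv _)) lg.
apply: (ae_mono H) => x Hx Ox.
have xpi : - pi < x < pi by move: Ox; rewrite /Omega /= in_itv.
have bx : (BRight (- pi : R)%R < BRight x)%O by rewrite bnd_simp; case/andP: xpi.
have [_] := Hx bx.
have -> : g x = h x by rewrite /g patchE mem_set.
move=> <-.
rewrite derive1E.
set F := (X in 'D_1 X x).
have F0 : \forall y \near x, F y = (fun=> 0) y.
  have : \forall y \near x, - pi < y < pi.
    by near=> y; apply/andP; split; near: y; [apply: lt_nbhsr|apply: lt_nbhsl]; case/andP: xpi.
  apply: filterS => y /andP[y1 y2]; rewrite /F /=.
  rewrite -(null_itv (a := - pi) (b := y) _ y1 (ltW y2) ih h0 hn) //.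
  rewrite -Rintegral_itv_bndo_bndc; last by apply: ig'; exact: measurable_itv.
  apply: eq_Rintegral => t; rewrite inE /= in_itv /= => /andP[t1 t2].
  rewrite /g patchE mem_set // /Omega /= in_itv /= t1 /=.
  exact: lt_trans t2 y2.
rewrite (near_eq_derive _ F0) ?oner_eq0 //.
exact: derive_cst.
Unshelve. all: by end_near. Qed.

Lemma fourier_uniq f : cinteg Om f -> (forall k, fourier f k = 0) ->
  {ae mu, forall x, Om x -> f x = 0}.
Proof.
move=> hf f0.
have tf : trig_null f.
  split=> // k; have := f0 (- k); rewrite /fourier => /eqP.
  rewrite mulf_eq0 => /orP[|/eqP].
    rewrite eq_complex /= eqxx andbT invr_eq0 mulf_eq0 pnatr_eq0 /=.
    by rewrite gt_eqF // pi_gt0.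
  move=> <-; congr cint; apply/funext => x.
  by rewrite rmorphN /= mulNr opprK.
have [_ /(_ 0) f00] := tf.
have f01 : cint Om f = 0.
  by rewrite -[RHS]f00; congr cint; apply/funext => x; rewrite mul0r cis0 mulr1.
have hn x0 d n := trig_null_step_int x0 d n tf.
have [i1 i2] := hf.
have r0 : {ae mu, forall x, Om x -> complex.Re (f x) = 0}.
  apply: null_real i1 _ _ => [|x0 d n]; first by have := congr1 (@complex.Re R) f01.
  have := congr1 (@complex.Re R) (hn x0 d n) => /= E; rewrite -[RHS]E.
  by apply: eq_Rintegral => x _; rewrite cReM /= mulr0 subr0.
have m0 : {ae mu, forall x, Om x -> complex.Im (f x) = 0}.
  apply: null_real i2 _ _ => [|x0 d n]; first by have := congr1 (@complex.Im R) f01.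
  have := congr1 (@complex.Im R) (hn x0 d n) => /= E; rewrite -[RHS]E.
  by apply: eq_Rintegral => x _; rewrite cImM /= mulr0 add0r.
apply: (ae_mono (ae_and r0 m0)) => x [h1 h2] Ox.
by apply: complex_eq; [rewrite h1|rewrite h2].
Qed.

End Uniqueness.

(** * Functions represented by their coefficients *)

Section Representation.
Context {R : realType}.
Notation mu := (@lebesgue_measure R).
Notation Om := (@Omega R).
Local Notation rc := (real_complex R).
Implicit Types (a b : int -> R[i]) (f g : R -> R[i]) (k : int).

(** The dictionary between functions and coefficients. The coefficients of an
    operation on functions are the corresponding operation on coefficients; the
    coefficient sequence, unlike the function, does not see null sets. *)
Definition rep f a : Prop := cinteg Om f /\ fourier f =1 a.

Lemma rep_ext f a b : a =1 b -> rep f a -> rep f b.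
Proof. by move=> /funext ->. Qed.

Lemma cinteg_fourier f k : cinteg Om f ->
  cinteg Om (fun x => f x * cis (- (k%:~R * x))).
Proof.
move=> hf.
rewrite (_ : (fun x => _) = (fun x => f x * cis ((- k)%:~R * x))); last first.
  by apply/funext => x; rewrite rmorphN /= mulNr.
exact: cinteg_trig.
Qed.

Lemma rep_Fs a : csummable a -> rep (Fs a) a.
Proof. by move=> sa; split; [exact: cinteg_Fs|exact: fourier_Fs]. Qed.

Lemma repD f g a b : rep f a -> rep g b ->
  rep (fun x => f x + g x) (fun k => a k + b k).
Proof.
move=> [hf fa] [hg gb]; split; first exact: (cintegD mOm hf hg).
move=> k; rewrite -fa -gb /fourier -mulrDr -(cintD mOm) //; last 2 first.
- exact: cinteg_fourier.
- exact: cinteg_fourier.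
by congr (_ * cint _ _); apply/funext => x; rewrite mulrDl.
Qed.

Lemma repZ (c : R[i]) f a : rep f a -> rep (fun x => c * f x) (fun k => c * a k).
Proof.
move=> [hf fa]; split; first exact: (cintegZ mOm c hf).
move=> k; rewrite -fa /fourier mulrCA -(cintZ mOm c); last exact: cinteg_fourier.
by congr (_ * cint _ _); apply/funext => x; rewrite mulrA.
Qed.

Lemma repN f a : rep f a -> rep (fun x => - f x) (fun k => - a k).
Proof.
move=> /(repZ (-1)).
rewrite (_ : (fun x => -1 * f x) = (fun x => - f x)); last first.
  by apply/funext => x; rewrite mulN1r.
by apply: rep_ext => k; rewrite mulN1r.
Qed.

Lemma repB f g a b : rep f a -> rep g b ->
  rep (fun x => f x - g x) (fun k => a k - b k).
Proof. by move=> hf hg; apply: repD => //; exact: repN. Qed.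

Lemma rep_conj f a : rep f a -> rep (conjf f) (cj a).
Proof.
move=> [hf fa]; split; first exact: (cinteg_conj mOm hf).
move=> k; rewrite /cj -fa /fourier conjcM conjc_real -(cint_conj mOm); last first.
  exact: cinteg_fourier.
congr (_ * cint _ _); apply/funext => x.
by rewrite conjcM conj_cis opprK rmorphN /= mulNr.
Qed.

Lemma rep_cst (z : R[i]) : rep (fun=> z) (fun k => if k == 0 then z else 0).
Proof.
have r1 : rep (fun=> 1) (fun k => if k == 0 then 1 else 0).
  split; last exact: fourier1.
  apply: (bounded_cinteg (K := 1) mOm muOm_lty (cmeas_cst _ _)) => x _.
  by rewrite nm1.
have := repZ z r1; rewrite (_ : (fun=> z * 1) = (fun=> z)); last first.
  by apply/funext => x; rewrite mulr1.
by apply: rep_ext => k; case: ifP => _; rewrite ?mulr1 ?mulr0.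
Qed.

(** The difference with the sum of the Fourier series has zero coefficients. *)
Lemma rep_ae f a : rep f a -> csummable a ->
  {ae mu, forall x, Om x -> f x = Fs a x}.
Proof.
move=> hf sa; have [hd fd] := repB hf (rep_Fs sa).
have := fourier_uniq hd (fun k => etrans (fd k) (subrr _)).
by move=> H; apply: (ae_mono H) => x h /h /eqP; rewrite subr_eq0 => /eqP.
Qed.

Lemma rep_ae_eq f g a : cmeas Om f -> {ae mu, forall x, Om x -> f x = g x} ->
  rep g a -> rep f a.
Proof.
move=> mf H [hg ga].
have mg := cinteg_meas hg.
have H' : {ae mu, forall x, Om x -> g x = f x}.
  by apply: (ae_mono H) => x h Ox; rewrite h.
split; first exact: (cinteg_ae_eq mOm mg mf H' hg).
move=> k; rewrite -ga /fourier; congr (_ * _); apply: (cint_ae_eq mOm).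
- by apply: cmeasM => //; exact: cmeas_cisNl.
- by apply: cmeasM => //; exact: cmeas_cisNl.
by apply: (ae_mono H) => x h Ox; rewrite h.
Qed.

(** Both functions may be replaced by the sums of their Fourier series, and these
    multiply by [fourier_FsFs]. *)
Lemma repM f g a b : rep f a -> rep g b -> csummable a -> csummable b ->
  rep (fun x => f x * g x) (convol a b).
Proof.
move=> hf hg sa sb.
have mf := cinteg_meas (proj1 hf); have mg := cinteg_meas (proj1 hg).
apply: (@rep_ae_eq _ (fun x => Fs a x * Fs b x)).
- exact: cmeasM.
- apply: (ae_mono (ae_and (rep_ae hf sa) (rep_ae hg sb))) => x [h1 h2] Ox.
  by rewrite h1 ?h2.
split; last by move=> k; exact: fourier_FsFs.
have [A ha] := sa; have [B hb] := sb.
apply: (bounded_cinteg (K := A * B) mOm muOm_lty).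
  by apply: cmeasM; exact: cmeas_Fs.
move=> x _; rewrite nmM ler_pM ?nm_ge0 //; exact: Fs_bounded.
Qed.

Lemma rep_fmult (s : int -> R[i]) f a : rep f a ->
  csummable (fun k => s k * a k) -> rep (fmult s f) (fun k => s k * a k).
Proof.
move=> [_ fa] ss; rewrite fmultE (_ : (fun k => s k * fourier f k) = (fun k => s k * a k)).
  exact: rep_Fs.
by apply/funext => k; rewrite fa.
Qed.

Lemma rep_inner f g a b : rep f a -> rep g b -> csummable a -> csummable b ->
  inner f g = convol a (cj b) 0.
Proof.
move=> hf hg sa [B hb].
have [_ <-] := repM hf (rep_conj hg) sa (lp_csummable (lp_cj hb)).
rewrite /inner /fourier; congr (_ * cint _ _); apply/funext => x.
by rewrite mul0r oppr0 cis0 mulr1.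
Qed.

End Representation.

Section TimeFamilies.
Context {R : realType}.
Notation mu := (@lebesgue_measure R).
Notation Om := (@Omega R).
Local Notation rc := (real_complex R).
Implicit Types (a : int -> R[i]) (k : int) (b d : R -> int -> R[i]).

(** Two derivatives in the Wiener algebra: enough for the multipliers dxx and
    <dxx>_c to give summable coefficients, implied by H^3, and preserved by the
    scheme. *)
Definition S2 a : Prop := exists K, lp false (wt 2 a) K.

Lemma S2_csummable a : S2 a -> csummable a.
Proof. by move=> [K h]; exists K; exact: lp_wt0 h. Qed.

Lemma S2_ext a a' : a =1 a' -> S2 a -> S2 a'.
Proof. by move=> /funext ->. Qed.

Lemma S2_le a a' C : 0 <= C -> (forall k, nm (a k) <= C * nm (a' k)) -> S2 a' -> S2 a.
Proof. by move=> C0 h [K hK]; exists (C * K); exact: le_lp_wt hK. Qed.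

Lemma S2D a a' : S2 a -> S2 a' -> S2 (fun k => a k + a' k).
Proof.
move=> [K h] [K' h']; exists (K + K'); apply: (le_lpD_wt _ h h') => k.
exact: nmD.
Qed.

Lemma S2Z (c : R[i]) a : S2 a -> S2 (fun k => c * a k).
Proof. by apply: (S2_le (nm_ge0 c)) => k; rewrite nmM. Qed.

Lemma S2N a : S2 a -> S2 (fun k => - a k).
Proof. by apply: (S2_le ler01) => k; rewrite nmN mul1r. Qed.

Lemma S2B a a' : S2 a -> S2 a' -> S2 (fun k => a k - a' k).
Proof. by move=> h h'; apply: S2D => //; exact: S2N. Qed.

Lemma S2M (s : int -> R[i]) C a : (forall k, nm (s k) <= C) -> S2 a ->
  S2 (fun k => s k * a k).
Proof.
move=> hs; apply: (@S2_le _ _ C) => [|k]; first exact: le_trans (nm_ge0 _) (hs 0).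
by rewrite nmM ler_wpM2r // nm_ge0.
Qed.

Lemma S2_cj a : S2 a -> S2 (cj a).
Proof. by move=> [K h]; exists K; exact: lp_wt_cj. Qed.

Lemma S2_convol a a' : S2 a -> S2 a' -> S2 (convol a a').
Proof. by move=> [K h] [K' h']; exists (K * K'); exact: convol_l1_wt. Qed.

Lemma S2_mul2 (s : int -> R[i]) C a : (forall k, nm (s k) <= C * W k ^+ 2) ->
  S2 a -> csummable (fun k => s k * a k).
Proof.
move=> hs [K h]; exists (C * K).
have C0 : 0 <= C.
  have := le_trans (nm_ge0 _) (hs 0); rewrite pmulr_lge0 //.
  by rewrite exprn_gt0 // W_gt0.
apply: (le_lp C0 _ h) => k; rewrite nm_wt nmM mulrA.
by rewrite ler_wpM2r // nm_ge0.
Qed.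

(** The integrands of the scheme: the bound, uniform in time, makes every
    coefficient integrable and allows sums over frequencies and integrals over
    time to be exchanged. *)
Definition tfam (D : set R) b : Prop :=
  (forall k, cmeas D (b ^~ k)) /\
  exists K, forall s, D s -> lp false (wt 2 (b s)) K.

Lemma tfam_S2 D b s : tfam D b -> D s -> S2 (b s).
Proof. by move=> [_ [K h]] /h; exists K. Qed.

Lemma tfam_cst D a : S2 a -> tfam D (fun=> a).
Proof. by move=> [K h]; split; [move=> k; exact: cmeas_cst|exists K]. Qed.

Lemma tfamD D b d : tfam D b -> tfam D d -> tfam D (fun s k => b s k + d s k).
Proof.
move=> [mb [K h]] [md [K' h']]; split; first by move=> k; exact: cmeasD.
exists (K + K') => s Ds; apply: (le_lpD_wt _ (h s Ds) (h' s Ds)) => k; exact: nmD.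
Qed.

Lemma tfamM D (th : R -> int -> R[i]) C b : (forall k, cmeas D (th ^~ k)) ->
  0 <= C -> (forall s k, D s -> nm (th s k) <= C) -> tfam D b ->
  tfam D (fun s k => th s k * b s k).
Proof.
move=> mth C0 hth [mb [K h]]; split; first by move=> k; exact: cmeasM.
exists (C * K) => s Ds; apply: (le_lp_wt C0 _ (h s Ds)) => k.
by rewrite nmM ler_wpM2r ?nm_ge0 // hth.
Qed.

Lemma tfamZ D (c : R[i]) b : tfam D b -> tfam D (fun s k => c * b s k).
Proof.
move=> hb; apply: (@tfamM D (fun _ _ => c) (nm c) b) => //; exact: nm_ge0.
Qed.

Lemma tfamN D b : tfam D b -> tfam D (fun s k => - b s k).
Proof.
move=> /(tfamZ (-1)); congr tfam.
by apply/funext => s; apply/funext => k; rewrite mulN1r.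
Qed.

Lemma tfamB D b d : tfam D b -> tfam D d -> tfam D (fun s k => b s k - d s k).
Proof. by move=> hb hd; apply: tfamD => //; exact: tfamN. Qed.

Lemma tfam_cj D b : tfam D b -> tfam D (fun s => cj (b s)).
Proof.
move=> [mb [K h]]; split.
  by move=> k; apply: cmeas_conj; exact: mb.
by exists K => s Ds; exact: lp_wt_cj (h s Ds).
Qed.

Lemma tfam_convol D b d : tfam D b -> tfam D d ->
  tfam D (fun s => convol (b s) (d s)).
Proof.
move=> [mb [K h]] [md [K' h']]; split; last first.
  by exists (K * K') => s Ds; apply: convol_l1_wt; [exact: h|exact: h'].
move=> k; apply: (cmeas_csum (b := fun j s => b s j * d s (k - j))).
  by move=> j; exact: cmeasM.
move=> s Ds; apply: csummable_convol; apply: lp_csummable.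
  exact: lp_wt0 (h s Ds).
exact: lp_wt0 (h' s Ds).
Qed.

Lemma tfam_cinteg D b : measurable D -> (mu D < +oo)%E -> tfam D b ->
  forall k, cinteg D (b ^~ k).
Proof.
move=> mD muD [mb [K h]] k; apply: (bounded_cinteg mD muD (mb k)) => s Ds.
exact: lp_sup (lp_wt0 (h s Ds)).
Qed.

Lemma tfam_cint D b : measurable D -> (mu D < +oo)%E -> tfam D b ->
  S2 (fun k => cint D (b ^~ k)).
Proof.
move=> mD muD hb; have ib := tfam_cinteg mD muD hb.
have [mb [K h]] := hb.
exists (Num.max K 0 * fine (mu D)).
have ibw k : cinteg D (fun s => wt 2 (b s) k) by exact: cintegZ.
have E k : cint D (fun s => wt 2 (b s) k) = wt 2 (fun k => cint D (b ^~ k)) k.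
  by rewrite [RHS]/wt -(cintZ mD _ (ib k)).
apply: (eq_lp E); apply: (lp_cint mD muD _ ibw).
  by rewrite le_max lexx orbT.
apply: ae_all => s Ds; apply: lpW (h s Ds); by rewrite le_max lexx.
Qed.

Lemma rep_time D b (G : R -> R -> R[i]) : measurable D -> (mu D < +oo)%E ->
  tfam D b -> (forall s x, D s -> G s x = Fs (b s) x) ->
  rep (fun x => cint D (G ^~ x)) (fun k => cint D (b ^~ k)).
Proof.
move=> mD muD hb HG; have [mb [K h]] := hb.
have sb := S2_csummable (tfam_cint mD muD hb).
rewrite (_ : (fun x => cint D (G ^~ x)) = Fs (fun k => cint D (b ^~ k))).
  exact: rep_Fs.
apply/funext => x.
rewrite (eq_cint (g := fun s => csum (fun k => b s k * cis (k%:~R * x)))); last first.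
  by move=> s /set_mem Ds; rewrite HG.
have l s : D s -> lp false (fun k => b s k * cis (k%:~R * x)) (Num.max K 0).
  move=> Ds; apply: lpW (_ : lp false _ K); first by rewrite le_max lexx.
  apply: (le_lp1 _ (lp_wt0 (h s Ds))) => k; by rewrite nmM nm_cis mulr1.
have K0 : 0 <= Num.max K 0 by rewrite le_max lexx orbT.
have mm k : cmeas D (fun s => b s k * cis (k%:~R * x)).
  by apply: cmeasM => //; exact: cmeas_cst.
have [_ _ ->] := cint_csum mD muD K0 mm (fun s Ds => lp_csummable (l s Ds)) (ae_all l).
apply: eq_csum => k; rewrite [RHS]mulrC -(cintZ mD); last exact: (tfam_cinteg mD muD hb).
by apply: eq_cint => s _; rewrite mulrC.
Qed.

End TimeFamilies.

(** * Symbols, and the scheme on coefficients *)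

Section Symbols.
Context {R : realType}.
Local Notation rc := (real_complex R).
Implicit Types (c : R) (k : int).

Definition sq k : R := k%:~R ^+ 2.

(** The symbol of A. It is bounded because omega = k^2 + O(1), which is why the free
    Schroedinger flow is a good approximation of the linear flow. *)
Definition asym c k : R := - sq k + omega c k.

Lemma sq_ge0 k : 0 <= sq k.
Proof. exact: sqr_ge0. Qed.

Lemma sq_opp k : sq (- k) = sq k.
Proof. by rewrite /sq rmorphN sqrrN. Qed.

Lemma sq_le_W k : sq k <= W k ^+ 2.
Proof. by apply: le_trans (sqr_le_W k); rewrite lerDr. Qed.

Lemma omega_sqr c k : 0 < c -> omega c k ^+ 2 = sq k ^+ 2 + sq k + c.
Proof.
move=> c0; rewrite /omega sqr_sqrtr; first by rewrite /sq -exprM.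
by rewrite !addr_ge0 ?(ltW c0) // ?sqr_ge0 // -[4%N]/(2 * 2)%N exprM sqr_ge0.
Qed.

Lemma omega_ge0 c k : 0 <= omega c k.
Proof. exact: sqrtr_ge0. Qed.

Lemma omega_gt0 c k : 0 < c -> 0 < omega c k.
Proof.
move=> c0; rewrite lt_def omega_ge0 andbT -sqrf_eq0 omega_sqr // gt_eqF //.
by rewrite ltr_wpDl // addr_ge0 ?sqr_ge0 // sq_ge0.
Qed.

Lemma omega_opp c k : omega c (- k) = omega c k.
Proof.
rewrite /omega rmorphN sqrrN; congr (Num.sqrt (_ + _ + _)).
by rewrite -[4%N]/(2 * 2)%N !exprM sqrrN.
Qed.

Lemma sq_le_omega c k : 0 < c -> sq k <= omega c k.
Proof.
move=> c0; rewrite -(ler_pXn2r (n := 2)) ?nnegrE ?sq_ge0 ?omega_ge0 //.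
by rewrite omega_sqr // -addrA lerDl addr_ge0 ?sq_ge0 // ltW.
Qed.

Lemma omega_le c k : 0 < c -> omega c k <= sq k + (1 + c).
Proof.
move=> c0; have s0 := sq_ge0 k.
rewrite -(ler_pXn2r (n := 2)) ?nnegrE ?omega_ge0 ?addr_ge0 ?(ltW c0) //.
rewrite omega_sqr //; have := mulr_ge0 s0 (ltW c0); have := sqr_ge0 c.
rewrite !expr2; nra.
Qed.

Lemma asym_ge0 c k : 0 < c -> 0 <= asym c k.
Proof. by move=> c0; rewrite /asym addrC subr_ge0 sq_le_omega. Qed.

Lemma asym_le c k : 0 < c -> asym c k <= 1 + c.
Proof. by move=> c0; rewrite /asym addrC lerBlDl omega_le. Qed.

Lemma nm_asym c k : 0 < c -> nm (rc (asym c k)) <= 1 + c.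
Proof. by move=> c0; rewrite nm_real ger0_norm ?asym_ge0 ?asym_le. Qed.

Lemma omega_le_W c k : 0 < c -> omega c k <= (1 + c) * W k ^+ 2.
Proof.
move=> c0; apply: (le_trans (omega_le k c0)).
have s0 := sq_ge0 k; have c0' := ltW c0.
apply: (@le_trans _ _ ((1 + c) * (1 + sq k))).
  by have := mulr_ge0 c0' s0; lra.
by apply: ler_wpM2l; [lra|exact: sqr_le_W].
Qed.

Lemma nm_omegaV c k : 0 < c -> nm (rc (omega c k)^-1) = (omega c k)^-1.
Proof. by move=> c0; rewrite nm_real ger0_norm // invr_ge0 omega_ge0. Qed.

(** The symbol omega is at least k^2 and at least c^(1/2). *)
Lemma W_omegaV c k : 0 < c -> W k ^+ 2 * (omega c k)^-1 <= 4 + 2 / c.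
Proof.
move=> c0; have w0 := omega_gt0 k c0.
rewrite ler_pdivrMr //; apply: (le_trans (W_sqr_le k)).
have -> : 4 + 2 / c = 2 * (2 + c^-1) by field; rewrite gt_eqF.
rewrite -mulrA ler_pM2l // -(ler_pXn2r (n := 2) (erefl _)) ?nnegrE; last 2 first.
- by rewrite addr_ge0 // sq_ge0.
- by rewrite mulr_ge0 ?omega_ge0 // addr_ge0 // invr_ge0 ltW.
have s0 := sq_ge0 k; rewrite exprMn omega_sqr // -/(sq k).
have ci0 : 0 < c^-1 by rewrite invr_gt0.
have cc : c^-1 * c = 1 by rewrite mulVf // gt_eqF.
apply: (@le_trans _ _ ((4 + 4 * c^-1) * (sq k ^+ 2 + sq k + c))).
  have -> : (4 + 4 * c^-1) * (sq k ^+ 2 + sq k + c) =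
    4 * sq k ^+ 2 + 4 * sq k + 4 * c + 4 * (c^-1 * sq k ^+ 2) + 4 * (c^-1 * sq k)
    + 4 * (c^-1 * c) by ring.
  rewrite cc; have := mulr_ge0 (ltW ci0) (sqr_ge0 (sq k)).
  have := mulr_ge0 (ltW ci0) s0; have := sqr_ge0 (sq k).
  rewrite sqrrD expr1n mul1r; lra.
apply: ler_wpM2r; first by rewrite addr_ge0 ?addr_ge0 ?sqr_ge0 // ltW.
rewrite sqrrD; have := sqr_ge0 c^-1; rewrite -mulr_natl; lra.
Qed.

Lemma sq_omegaV c k : 0 < c -> sq k * (omega c k)^-1 <= 1.
Proof. by move=> c0; rewrite ler_pdivrMr ?omega_gt0 // mul1r sq_le_omega. Qed.

Lemma omegaV_le c k : 0 < c -> (omega c k)^-1 <= 4 + 2 / c.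
Proof.
move=> c0; apply: le_trans (W_omegaV k c0).
rewrite ler_peMl ?invr_ge0 ?omega_ge0 //.
by rewrite exprn_ege1 // W_ge1.
Qed.

Lemma c_omegaV c k : 0 < c -> c * (omega c k)^-1 <= 1 + c.
Proof.
move=> c0; rewrite ler_pdivrMr ?omega_gt0 //.
rewrite -(ler_pXn2r (n := 2)) ?nnegrE ?(ltW c0) ?mulr_ge0 ?addr_ge0 ?(ltW c0) ?omega_ge0 //.
rewrite exprMn omega_sqr //; have s0 := sq_ge0 k; have c0' := ltW c0.
apply: (@le_trans _ _ ((1 + c) ^+ 2 * c)).
  by rewrite expr2 sqrrD expr1n mul1r; have := sqr_ge0 c; rewrite expr2 => ?; nra.
by apply: ler_wpM2l; [exact: sqr_ge0|rewrite lerDr addr_ge0 ?sqr_ge0].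
Qed.

End Symbols.

Section SchemeCoefficients.
Context {R : realType}.
Local Notation rc := (real_complex R).
Local Notation sq := (@sq R).
Implicit Types (a b : int -> R[i]) (c s tau : R) (k : int).

(** The coefficients of e^(i s dxx) f. *)
Definition ex s a : int -> R[i] := fun k => cis (- (s * sq k)) * a k.

(** The integrands of I_1 and J_1, of I_2 and J_2, and of I_3 and J_3. *)
Definition T1 a b s := ex s (convol (ex (- s) a) (ex (- s) b)).
Definition T2 a b s := ex s (convol (ex (- s) a) (ex s (cj b))).
Definition T3 a b s := ex (2 * s) (convol (cj a) (cj b)).

(** The coefficients of f + conj f. *)
Definition twice_re a : int -> R[i] := fun k => a k + cj a k.

Definition nls c a : int -> R[i] := fun k =>
  rc (2 * c) * twice_re a k + rc (- sq k) * convol (twice_re a) (twice_re a) k.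

Definition P_coef c a : int -> R[i] := fun k =>
  rc (asym c k) * a k - 4^-1 * (rc (omega c k)^-1 * nls c a k).

(** The two parts of the scheme are time integrals of this sequence and of
    [quad_integrand]. *)
Definition lin_integrand c a s : int -> R[i] := fun k =>
  (a k - 'i * rc s * (rc (asym c k) * a k - P_coef c a k))
  + (ex (2 * s) (cj a) k
     - 'i * rc s * ex (2 * s) (fun k => rc (asym c k) * cj a k + cj (P_coef c a) k) k).

Definition quad_integrand c a s : int -> R[i] := fun k =>
  - 'i * (T1 a a s k + cj (T1 a a s) k + 2 * T2 a a s k + T3 a a s k
          - convol (cj a) (cj a) k)
  - rc (asym c k) * (rc s * (T1 a a s k + 2 * T2 a a s k + T3 a a s k))
  + 2 * (rc s * (T1 a (P_coef c a) s k + T2 (P_coef c a) a s k))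
  - 2 * (rc s * (T3 a (P_coef c a) s k + T2 a (P_coef c a) s k)).

Definition step_coef c tau a : int -> R[i] := fun k =>
  cis (tau * omega c k) * a k
  + - ('i * rc c / 2) * (rc (omega c k)^-1 * (cis (tau * omega c k)
      * cint `[0, tau] (fun s => lin_integrand c a s k)))
  + 4^-1 * (rc (- sq k) * (rc (omega c k)^-1 * (cis (tau * omega c k)
      * cint `[0, tau] (fun s => quad_integrand c a s k)))).

Lemma lp_ex p s a K : lp p a K -> lp p (ex s a) K.
Proof. by apply: lpM1 => k; rewrite nm_cis. Qed.

Lemma nm_ex s a k : nm (ex s a k) = nm (a k).
Proof. by rewrite nmM nm_cis mul1r. Qed.

Lemma csummable_ex s a : csummable a -> csummable (ex s a).
Proof. by move=> [K h]; exists K; exact: lp_ex. Qed.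

Lemma cj_ex s a : cj (ex s a) =1 ex (- s) (cj a).
Proof. by move=> k; rewrite /cj /ex conjcM conj_cis sq_opp mulNr. Qed.

Lemma cj_convol a b : csummable a -> csummable b ->
  cj (convol a b) =1 convol (cj a) (cj b).
Proof.
move=> sa sb k; rewrite /cj /convol -csum_conj; last exact: csummable_convol.
rewrite -csum_opp; apply: eq_csum => j; rewrite conjcM; congr (_ * conjc (b _)).
by rewrite opprB opprK addrC.
Qed.

Lemma S2_twice_re a : S2 a -> S2 (twice_re a).
Proof. by move=> h; apply: S2D => //; exact: S2_cj. Qed.

Lemma S2_P_coef c a : 0 < c -> S2 a -> S2 (P_coef c a).
Proof.
move=> c0 ha; apply: S2B.
  by apply: (S2M (C := 1 + c)) => // k; exact: nm_asym.
apply: S2Z.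
apply: (@S2_ext _ (fun k => rc (2 * (c * (omega c k)^-1)) * twice_re a k
   + rc (- (sq k * (omega c k)^-1)) * convol (twice_re a) (twice_re a) k)).
  move=> k; set w := (omega c k)^-1.
  have -> : rc (2 * (c * w)) = rc w * rc (2 * c) by rewrite -rmorphM; congr rc; ring.
  have -> : rc (- (sq k * w)) = rc w * rc (- sq k) by rewrite -rmorphM; congr rc; ring.
  by rewrite /nls; ring.
apply: S2D.
  apply: (S2M (C := 2 * (1 + c))); last exact: S2_twice_re.
  move=> k; rewrite nm_real ger0_norm; first by rewrite ler_pM2l // c_omegaV.
  by rewrite !mulr_ge0 ?invr_ge0 ?omega_ge0 // ltW.
apply: (S2M (C := 1)); last by apply: S2_convol; exact: S2_twice_re.
move=> k; rewrite nm_real normrN ger0_norm ?sq_omegaV //.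
by rewrite mulr_ge0 ?sq_ge0 ?invr_ge0 ?omega_ge0.
Qed.

End SchemeCoefficients.

(** * Time integrals of the scheme *)

Section SchemeFamilies.
Context {R : realType}.
Notation mu := (@lebesgue_measure R).
Notation Om := (@Omega R).
Local Notation rc := (real_complex R).
Local Notation sq := (@sq R).
Implicit Types (a b : int -> R[i]) (f g : R -> R[i]) (c : R) (k : int).
Variable tau : R.
Hypothesis tau0 : 0 < tau.
Local Notation D := (`[0, tau]%classic : set R).

Let mD : measurable D. Proof. exact: measurable_itv. Qed.
Let muD : (mu D < +oo)%E. Proof. exact: mu_itv_lty. Qed.

Lemma mu_tau : fine (mu D) = tau.
Proof. by rewrite mu_itv; [rewrite subr0|exact: ltW]. Qed.

Lemma tfam_ex (r : R -> R) (B : R -> int -> R[i]) (E : set R) :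
  measurable_fun E r -> tfam E B -> tfam E (fun s => ex (r s) (B s)).
Proof.
move=> mr; apply: (@tfamM _ E (fun s k => cis (- (r s * sq k))) 1) => //.
  move=> k; apply: cmeas_cis; apply: measurableT_comp => //.
  by apply: measurable_funM => //; exact: measurable_cst.
by move=> s k _; rewrite nm_cis.
Qed.

Lemma tfam_s (B : R -> int -> R[i]) : tfam D B -> tfam D (fun s k => rc s * B s k).
Proof.
apply: (@tfamM _ D (fun s _ => rc s) tau); last 2 first.
- exact: ltW.
- by move=> s k /=; rewrite in_itv /= nm_real => /andP[s0 st]; rewrite ger0_norm.
by move=> k; apply: cmeas_real.
Qed.

Lemma tfam_mult (s : int -> R[i]) C (B : R -> int -> R[i]) (E : set R) :
  (forall k, nm (s k) <= C) -> tfam E B -> tfam E (fun t k => s k * B t k).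
Proof.
move=> hs; apply: (@tfamM _ E (fun _ k => s k) C) => [k||//].
  exact: cmeas_cst.
exact: le_trans (nm_ge0 _) (hs 0).
Qed.

Let mid : measurable_fun D (fun s : R => s). Proof. exact: measurable_id. Qed.
Let mN : measurable_fun D (fun s : R => - s). Proof. exact: measurableT_comp. Qed.
Let m2 : measurable_fun D (fun s : R => 2 * s).
Proof. by apply: measurable_funM => //; exact: measurable_cst. Qed.

Lemma tfam_T1 a b : S2 a -> S2 b -> tfam D (T1 a b).
Proof.
move=> ha hb; apply: tfam_ex => //; apply: tfam_convol.
  by apply: (@tfam_ex (fun s => - s)) => //; exact: tfam_cst.
by apply: (@tfam_ex (fun s => - s)) => //; exact: tfam_cst.
Qed.

Lemma tfam_T2 a b : S2 a -> S2 b -> tfam D (T2 a b).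
Proof.
move=> ha hb; apply: tfam_ex => //; apply: tfam_convol.
  by apply: (@tfam_ex (fun s => - s)) => //; exact: tfam_cst.
by apply: tfam_ex => //; apply: tfam_cst; exact: S2_cj.
Qed.

Lemma tfam_T3 a b : S2 a -> S2 b -> tfam D (T3 a b).
Proof.
move=> ha hb; apply: (@tfam_ex (fun s => 2 * s)) => //; apply: tfam_cst.
by apply: S2_convol; exact: S2_cj.
Qed.

(** All the time integrals of the scheme are taken over [0, tau]; keeping their
    integrands lets the terms of the scheme be gathered under a single integral. *)
Definition rept f (B : R -> int -> R[i]) : Prop :=
  tfam D B /\ rep f (fun k => cint D (B ^~ k)).

Lemma reptD f g B B' : rept f B -> rept g B' ->
  rept (fun x => f x + g x) (fun s k => B s k + B' s k).
Proof.
move=> [tB rf] [tB' rg]; split; first exact: tfamD.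
apply: rep_ext (repD rf rg) => k; rewrite (cintD mD) //.
  exact: (tfam_cinteg mD muD tB).
exact: (tfam_cinteg mD muD tB').
Qed.

Lemma reptZ z f B : rept f B -> rept (fun x => z * f x) (fun s k => z * B s k).
Proof.
move=> [tB rf]; split; first exact: tfamZ.
apply: rep_ext (repZ z rf) => k; rewrite (cintZ mD) //.
exact: (tfam_cinteg mD muD tB).
Qed.

Lemma reptB f g B B' : rept f B -> rept g B' ->
  rept (fun x => f x - g x) (fun s k => B s k - B' s k).
Proof.
move=> [tB rf] [tB' rg]; split; first exact: tfamB.
apply: rep_ext (repB rf rg) => k; rewrite (cintB mD) //.
  exact: (tfam_cinteg mD muD tB).
exact: (tfam_cinteg mD muD tB').
Qed.

Lemma rept_conj f B : rept f B -> rept (conjf f) (fun s => cj (B s)).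
Proof.
move=> [tB rf]; split; first exact: tfam_cj.
apply: rep_ext (rep_conj rf) => k; rewrite /cj (cint_conj mD) //.
exact: (tfam_cinteg mD muD tB).
Qed.

Lemma rept_fmult (s : int -> R[i]) C f B : (forall k, nm (s k) <= C) ->
  rept f B -> rept (fmult s f) (fun t k => s k * B t k).
Proof.
move=> hs [tB rf]; split; first exact: tfam_mult hs tB.
have sB := tfam_cint mD muD tB.
have [|//] := rep_fmult rf (s := s).
  by apply: S2_csummable; exact: S2M hs sB.
move=> h1 h2; split => // k; rewrite h2 (cintZ mD) //.
exact: (tfam_cinteg mD muD tB).
Qed.

Lemma rept_time (B : R -> int -> R[i]) (G : R -> R -> R[i]) : tfam D B ->
  (forall s x, D s -> G s x = Fs (B s) x) -> rept (fun x => cint D (G ^~ x)) B.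
Proof. by move=> tB h; split => //; exact: rep_time. Qed.

Lemma rept_cst f a : rep f a -> S2 a -> rept (fun x => rc tau * f x) (fun=> a).
Proof.
move=> rf sa; split; first exact: tfam_cst.
apply: rep_ext (repZ (rc tau) rf) => k.
rewrite -(cint_1 tau0) mulrC -(cintZ mD); last first.
  by apply: (bounded_cinteg (K := 1) mD muD (cmeas_cst _ _)) => x _; rewrite nm1.
by apply: eq_cint => s _; rewrite mulr1.
Qed.

Lemma rep_exp_dxx s f a : rep f a -> csummable a -> rep (exp_dxx s f) (ex s a).
Proof. by move=> rf sa; apply: rep_fmult rf _; exact: csummable_ex. Qed.

Lemma exp_dxxE s f a : rep f a -> exp_dxx s f = Fs (ex s a).
Proof.
move=> [_ fa]; rewrite /exp_dxx fmultE; congr Fs; apply/funext => k.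
by rewrite fa.
Qed.

Section Quadratic.
Variables (f g : R -> R[i]) (a b : int -> R[i]).
Hypotheses (rf : rep f a) (rg : rep g b) (sa : S2 a) (sb : S2 b).
Let ca := S2_csummable sa.
Let cb := S2_csummable sb.

Lemma rep_T1 s : exp_dxx s (exp_dxx (- s) f \* exp_dxx (- s) g) = Fs (T1 a b s).
Proof.
apply: exp_dxxE; apply: repM; try exact: rep_exp_dxx; exact: csummable_ex.
Qed.

Lemma rep_T2 s : exp_dxx s (exp_dxx (- s) f \* exp_dxx s (conjf g)) = Fs (T2 a b s).
Proof.
have cbj : csummable (cj b) by exact: S2_csummable (S2_cj sb).
apply: exp_dxxE; apply: repM.
- exact: rep_exp_dxx.
- by apply: rep_exp_dxx => //; exact: rep_conj.
- exact: csummable_ex.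
- exact: csummable_ex.
Qed.

Lemma rept_J1 : rept (J1 tau f g) (fun s k => rc s * T1 a b s k).
Proof.
apply: rept_time; first by apply: tfam_s; exact: tfam_T1.
move=> s x Ds; rewrite rep_T1 /Fs -csumZ; first by apply: eq_csum => k; rewrite mulrA.
by apply: csummable_cis; exact: S2_csummable (tfam_S2 (tfam_T1 sa sb) Ds).
Qed.

Lemma rept_J2 : rept (J2 tau f g) (fun s k => rc s * T2 a b s k).
Proof.
apply: rept_time; first by apply: tfam_s; exact: tfam_T2.
move=> s x Ds; rewrite rep_T2 /Fs -csumZ; first by apply: eq_csum => k; rewrite mulrA.
by apply: csummable_cis; exact: S2_csummable (tfam_S2 (tfam_T2 sa sb) Ds).
Qed.

Let rab : rep (f \* g) (convol a b). Proof. exact: repM. Qed.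

Let rcab : rep (conjf (f \* g)) (convol (cj a) (cj b)).
Proof. by apply: rep_ext (rep_conj rab) => k; exact: cj_convol. Qed.

Lemma psi1_sym k : rc tau * psi1 (0 +i* (- (2 * tau * sq k))) =
  cint D (fun s => cis (- (2 * s * sq k))).
Proof.
have -> : - (2 * tau * sq k) = - 2 * sq k * tau by ring.
by rewrite psi1_int //; apply: eq_cint => s _; congr cis; ring.
Qed.

Lemma psi2_sym k : rc (tau ^+ 2) * psi2 (0 +i* (- (2 * tau * sq k))) =
  cint D (fun s => rc s * cis (- (2 * s * sq k))).
Proof.
have -> : - (2 * tau * sq k) = - 2 * sq k * tau by ring.
by rewrite psi2_int //; apply: eq_cint => s _; congr (_ * cis _); ring.
Qed.

Lemma cinteg_cisq k : cinteg D (fun s => cis (- (2 * s * sq k))).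
Proof.
have := @cinteg_cis R 0 tau (- 2 * sq k); congr (cinteg _ _); apply/funext => s.
by congr cis; ring.
Qed.

Lemma cinteg_scisq k : cinteg D (fun s => rc s * cis (- (2 * s * sq k))).
Proof.
apply: (bounded_cinteg (K := tau) mD muD).
  by apply: cmeasM; [exact: cmeas_real|exact: cinteg_meas (cinteg_cisq k)].
move=> s; rewrite /= in_itv /= nmM nm_cis mulr1 nm_real => /andP[s0 st].
by rewrite ger0_norm.
Qed.

(** tau psi_1 is an integral of unit complex numbers over [0, tau]. *)
Lemma psi1_bound k : nm (psi1 (0 +i* (- (2 * tau * sq k)))) <= 1.
Proof.
have h : nm (rc tau * psi1 (0 +i* (- (2 * tau * sq k)))) <= tau.
  rewrite psi1_sym; have := nm_cint_le mD muD ler01 (cinteg_cisq k).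
  by rewrite mu_tau mul1r; apply => t _; rewrite nm_cis.
by move: h; rewrite nmM nm_real gtr0_norm // ger_pMr.
Qed.

Lemma psi2_bound k : nm (psi2 (0 +i* (- (2 * tau * sq k)))) <= 1.
Proof.
have h : nm (rc (tau ^+ 2) * psi2 (0 +i* (- (2 * tau * sq k)))) <= tau ^+ 2.
  rewrite psi2_sym; have := nm_cint_le mD muD (ltW tau0) (cinteg_scisq k).
  rewrite mu_tau -expr2; apply => t.
  rewrite /= in_itv /= nmM nm_cis mulr1 nm_real => /andP[s0 st].
  by rewrite ger0_norm.
by move: h; rewrite nmM nm_real gtr0_norm ?exprn_gt0 // ger_pMr ?exprn_gt0.
Qed.

Lemma rept_psi1 : rept (fun x => rc tau * psi1_dxx tau f x) (fun s => ex (2 * s) a).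
Proof.
split; first by apply: (@tfam_ex (fun s => 2 * s)) => //; exact: tfam_cst.
have h : rep (psi1_dxx tau f) (fun k => psi1 (0 +i* (- (2 * tau * sq k))) * a k).
  by apply: rep_fmult rf _; apply: S2_csummable; exact: S2M psi1_bound sa.
apply: rep_ext (repZ (rc tau) h) => k.
rewrite mulrA psi1_sym mulrC -(cintZ mD); last exact: cinteg_cisq.
by apply: eq_cint => s _; rewrite mulrC.
Qed.

Lemma rept_psi2 : rept (fun x => rc (tau ^+ 2) * psi2_dxx tau f x)
  (fun s k => rc s * ex (2 * s) a k).
Proof.
split; first by apply: tfam_s; apply: (@tfam_ex (fun s => 2 * s)) => //; exact: tfam_cst.
have h : rep (psi2_dxx tau f) (fun k => psi2 (0 +i* (- (2 * tau * sq k))) * a k).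
  by apply: rep_fmult rf _; apply: S2_csummable; exact: S2M psi2_bound sa.
apply: rep_ext (repZ (rc (tau ^+ 2)) h) => k.
rewrite mulrA psi2_sym mulrC -(cintZ mD); last exact: cinteg_scisq.
by apply: eq_cint => s _; rewrite mulrC /ex mulrA.
Qed.

(** For k != 0 this is [J3_symbol]. The inverse of dxx loses the mean value, and the
    inner product in J_3 restores it: there s has integral tau^2 / 2. *)
Lemma rept_J3 : rept (J3 tau f g) (fun s k => rc s * T3 a b s k).
Proof.
split; first by apply: tfam_s; exact: tfam_T3.
pose y := convol (cj a) (cj b).
have sy : S2 y by apply: S2_convol; exact: S2_cj.
pose d k : R[i] := if k == 0 then 0 else rc (- (sq k)^-1).
have dle k : nm (d k) <= 1.
  rewrite /d; case: eqVneq => [_|k0]; first by rewrite nm0.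
  have q1 : 1 <= sq k.
    rewrite /sq -real_normK ?num_real // exprn_ege1 //.
    by rewrite -intr_norm -[1]/(1%:~R) ler_int; lia.
  by rewrite nm_real normrN ger0_norm ?invr_ge0 ?sq_ge0 // invf_le1 // (lt_le_trans ltr01).
have sdy : S2 (fun k => d k * y k) by exact: S2M dle sy.
have rq : rep (dxx_inv (conjf (f \* g))) (fun k => d k * y k).
  by apply: rep_fmult rcab _; exact: S2_csummable.
have rq1 := rep_exp_dxx (2 * tau) rq (S2_csummable sdy).
have rq2 : rep (psi1_dxx tau (dxx_inv (conjf (f \* g))))
    (fun k => psi1 (0 +i* (- (2 * tau * sq k))) * (d k * y k)).
  by apply: rep_fmult rq _; apply: S2_csummable; exact: S2M psi1_bound sdy.
have ri : inner (conjf f) g = y 0.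
  rewrite (rep_inner (rep_conj rf) rg) //.
  exact: S2_csummable (S2_cj sa).
have rJ := repD (repD (repZ (- ('i * rc tau / 2)) rq1) (repZ ('i * rc tau / 2) rq2))
  (rep_cst (rc tau ^+ 2 / 2 * inner (conjf f) g)).
apply: rep_ext rJ => k; rewrite ri.
have -> : cint D (fun s => rc s * T3 a b s k) =
   cint D (fun s => rc s * cis (- (2 * s * sq k))) * y k.
  rewrite [RHS]mulrC -(cintZ mD); last exact: cinteg_scisq.
  by apply: eq_cint => s _; rewrite /T3 /ex -/y; ring.
rewrite /ex /d; case: eqVneq => [->|k0].
  rewrite !mul0r !mulr0 !add0r.
  have -> : cint D (fun s => rc s * cis (- (2 * s * sq 0))) = cint D (fun s => rc s).
    by apply: eq_cint => s _; rewrite /sq expr0n mulr0 oppr0 cis0 mulr1.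
  rewrite (cint_s tau0) rmorphM fmorphV rmorphXn /=; congr (_ / _ * _).
  by rewrite rmorph_nat.
have q0 : sq k != 0 by rewrite sqrf_eq0 intr_eq0.
have -> : cint D (fun s => rc s * cis (- (2 * s * sq k))) =
    cint D (fun s => rc s * cis (- 2 * sq k * s)).
  by apply: eq_cint => s _; congr (_ * cis _); ring.
by rewrite -(J3_symbol tau0 q0) addr0; ring.
Qed.

End Quadratic.

End SchemeFamilies.

(** * One step of the scheme *)

Section SchemeRep.
Context {R : realType}.
Notation mu := (@lebesgue_measure R).
Notation Om := (@Omega R).
Local Notation rc := (real_complex R).
Local Notation sq := (@sq R).
Implicit Types (a b : int -> R[i]) (f g : R -> R[i]) (k : int).
Variables (c tau : R).
Hypotheses (c0 : 0 < c) (tau0 : 0 < tau).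
Local Notation D := (`[0, tau]%classic : set R).

Let mD : measurable D. Proof. exact: measurable_itv. Qed.
Let muD : (mu D < +oo)%E. Proof. exact: mu_itv_lty. Qed.

Lemma csummableM (s : int -> R[i]) C a : (forall k, nm (s k) <= C) -> csummable a ->
  csummable (fun k => s k * a k).
Proof.
move=> hs [K h]; exists (C * K); apply: lpM => //.
exact: le_trans (nm_ge0 _) (hs 0).
Qed.

Lemma nm_sq k : nm (rc (- sq k)) = sq k.
Proof. by rewrite nm_real normrN ger0_norm // sq_ge0. Qed.

Lemma nm_omV k : nm (rc (omega c k)^-1) <= 4 + 2 / c.
Proof. by rewrite nm_omegaV // omegaV_le. Qed.

Lemma nm_sq_omV k : nm (rc (- sq k) * rc (omega c k)^-1) <= 1.
Proof. by rewrite nmM nm_sq nm_omegaV // sq_omegaV. Qed.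

Section OneFunction.
Variables (f : R -> R[i]) (a : int -> R[i]).
Hypotheses (rf : rep f a) (sa : S2 a).

Lemma csummable_nls : csummable (nls c a).
Proof.
apply: csummableD; first by apply: S2_csummable; apply: S2Z; exact: S2_twice_re.
apply: (@S2_mul2 _ _ 1); last by apply: S2_convol; exact: S2_twice_re.
by move=> k; rewrite nm_sq mul1r sq_le_W.
Qed.

Lemma rep_nonlin : rep (nonlin c f) (nls c a).
Proof.
have rh : rep (f \+ conjf f) (twice_re a) by apply: repD => //; exact: rep_conj.
apply: repD; first exact: repZ.
apply: rep_fmult.
  by apply: repM => //; apply: S2_csummable; exact: S2_twice_re.
apply: (@S2_mul2 _ _ 1); last by apply: S2_convol; exact: S2_twice_re.
by move=> k; rewrite nm_sq mul1r sq_le_W.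
Qed.

Lemma rep_Aop : rep (Aop c f) (fun k => rc (asym c k) * a k).
Proof.
apply: rep_fmult rf _; apply: S2_csummable; apply: S2M sa => k; exact: nm_asym.
Qed.

Lemma S2_asym : S2 (fun k => rc (asym c k) * a k).
Proof. by apply: S2M sa => k; exact: nm_asym. Qed.

Lemma rep_Pop : rep (Pop c f) (P_coef c a).
Proof.
apply: repB; first exact: rep_Aop.
apply: repZ; apply: rep_fmult; first exact: rep_nonlin.
by apply: csummableM nm_omV _; exact: csummable_nls.
Qed.

Lemma rept_s : rept tau (fun x => rc (tau ^+ 2 / 2) * f x) (fun s k => rc s * a k).
Proof.
split; first by apply: tfam_s => //; exact: tfam_cst.
apply: rep_ext (repZ (rc (tau ^+ 2 / 2)) rf) => k.
rewrite -(cint_s tau0) mulrC -(cintZ mD); last first.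
  apply: (bounded_cinteg (K := tau) mD muD); first by apply: cmeas_real.
  by move=> s; rewrite /= in_itv /= nm_real => /andP[s0 st]; rewrite ger0_norm.
by apply: eq_cint => s _; rewrite mulrC.
Qed.

End OneFunction.

Lemma rept_rep f B : rept tau (fun x => rc tau * f x) B ->
  rep f (fun k => rc tau^-1 * cint D (B ^~ k)).
Proof.
move=> [_ /(repZ (rc tau^-1))]; congr rep; apply/funext => x.
by rewrite mulrA -rmorphM mulVf ?mul1r // gt_eqF.
Qed.

Variables (f : R -> R[i]) (a : int -> R[i]).
Hypotheses (rf : rep f a) (sa : S2 a).
Let rp := rep_Pop rf sa.
Let sp : S2 (P_coef c a) := S2_P_coef c0 sa.

Lemma rept_lin_integrand : rept tau (fun x => rc tau *
   ((f \- (('i * rc tau / 2) \*o (Aop c f \- Pop c f)) \+ psi1_dxx tau (conjf f))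
    \- (('i * rc tau) \*o psi2_dxx tau (Aop c (conjf f) \+ conjf (Pop c f)))) x)
  (lin_integrand c a).
Proof.
have rcf := rep_conj rf; have scf := S2_cj sa.
have r1 := rept_cst tau0 rf sa.
have r2 := rept_s (repB (rep_Aop rf sa) rp) (S2B (S2_asym sa) sp).
have r3 := rept_psi1 tau0 rcf scf.
have r4 := rept_psi2 tau0 (repD (rep_Aop rcf scf) (rep_conj rp))
  (S2D (S2_asym scf) (S2_cj sp)).
have := reptB (reptD (reptB r1 (reptZ 'i r2)) r3) (reptZ 'i r4).
set F := (X in rept _ X _ -> _); set B := (X in rept _ _ X -> _).
rewrite (_ : B = lin_integrand c a); last first.
  by apply/funext => s; apply/funext => k; rewrite /B /lin_integrand; ring.
congr rept; apply/funext => x; rewrite /F /=.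
rewrite rmorphM rmorphXn fmorphV /= rmorph_nat.
have two : (2 : R[i]) != 0 by rewrite pnatr_eq0.
set u := psi1_dxx _ _ x; set v := psi2_dxx _ _ x.
by rewrite expr2; field.
Qed.

Lemma rept_quad_integrand : let p := Pop c f in
  rept tau (
    ((- 'i) \*o (I1 tau f \+ conjf (I1 tau f) \+ (2 \*o I2 tau f)
                  \+ I3 tau f \- (rc tau \*o (conjf f \* conjf f))))
     \- Aop c (J1 tau f f \+ (2 \*o J2 tau f f) \+ J3 tau f f)
     \+ (2 \*o (J1 tau f p \+ J2 tau p f))
     \- (2 \*o (J3 tau f p \+ J2 tau f p))) (quad_integrand c a).
Proof.
move=> p.
have rcf := rep_conj rf; have scf := S2_cj sa.
have ccf := S2_csummable scf.
have i1 : rept tau (I1 tau f) (T1 a a).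
  apply: rept_time; first exact: tfam_T1.
  by move=> s x _; rewrite (rep_T1 rf rf sa sa).
have i2 : rept tau (I2 tau f) (T2 a a).
  apply: rept_time; first exact: tfam_T2.
  move=> s x _.
  have r1 := rep_exp_dxx (- s) rf (S2_csummable sa).
  have r2 : rep (conjf (exp_dxx (- s) f)) (ex s (cj a)).
    by apply: rep_ext (rep_conj r1) => k; rewrite cj_ex opprK.
  rewrite (exp_dxxE s (repM r1 r2 _ _)) //; apply: csummable_ex => //.
  exact: S2_csummable.
have rff := repM rcf rcf ccf ccf.
have sff := S2_convol scf scf.
have i3 : rept tau (I3 tau f) (T3 a a) := rept_psi1 tau0 rff sff.
have i4 := rept_cst tau0 rff sff.
have j1 := rept_J1 tau0 rf rf sa sa.
have j2 := rept_J2 tau0 rf rf sa sa.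
have j3 := rept_J3 tau0 rf rf sa sa.
have k1 := rept_J1 tau0 rf rp sa sp.
have k2 := rept_J2 tau0 rp rf sp sa.
have k3 := rept_J3 tau0 rf rp sa sp.
have k4 := rept_J2 tau0 rf rp sa sp.
have b1 := reptZ (- 'i) (reptB (reptD (reptD (reptD i1
   (rept_conj i1)) (reptZ 2 i2)) i3) i4).
have b2 := rept_fmult (fun k => nm_asym k c0)
  (reptD (reptD j1 (reptZ 2 j2)) j3).
have b3 := reptZ 2 (reptD k1 k2).
have b4 := reptZ 2 (reptD k3 k4).
have := reptB (reptD (reptB b1 b2) b3) b4.
set F := (X in rept _ X _ -> _); set B := (X in rept _ _ X -> _).
rewrite (_ : B = quad_integrand c a); last first.
  by apply/funext => s; apply/funext => k; rewrite /B /quad_integrand; ring.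
exact.
Qed.

(** All the multipliers of the scheme are bounded, except dxx, which is applied
    after the inverse of <dxx>_c; so the summability S2 is preserved and the scheme
    can be iterated. *)
Lemma rep_Psi : rep (Psi c tau f) (step_coef c tau a) /\ S2 (step_coef c tau a).
Proof.
have [tY rY] := rept_lin_integrand; have [tX rX] := rept_quad_integrand.
have sY := tfam_cint mD muD tY; have sX := tfam_cint mD muD tX.
have rZ := rept_rep rept_lin_integrand.
have c1 (s : R) k : nm (cis (s * omega c k)) <= 1 by rewrite nm_cis.
have sZ := S2Z (rc tau^-1) sY.
have rL := rep_fmult (rep_fmult rZ (S2_csummable (S2M (c1 tau) sZ)))
  (S2_csummable (S2M nm_omV (S2M (c1 tau) sZ))).
have rL' : rep (Lop c tau f) (fun k => - ('i * rc c / 2) *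
   (rc (omega c k)^-1 * (cis (tau * omega c k) * cint D (lin_integrand c a ^~ k)))).
  apply: rep_ext (repZ (- ('i * rc c * rc tau / 2)) rL) => k.
  have e : rc tau * rc tau^-1 = 1 by rewrite -rmorphM mulfV // gt_eqF.
  set y := cint _ _; set w := rc _^-1; set e1 := cis _.
  transitivity (- ('i * rc c / 2) * (w * (e1 * ((rc tau * rc tau^-1) * y)))).
    by ring.
  by rewrite e mul1r.
have rD := rep_fmult (s := fun k => cis (tau * omega c k)) rf
  (S2_csummable (S2M (c1 tau) sa)).
have rQ1 := rep_fmult rX (S2_csummable (S2M (c1 tau) sX)).
have rQ2 := rep_fmult rQ1 (S2_csummable (S2M nm_omV (S2M (c1 tau) sX))).
have sQ3 : S2 (fun k => rc (- sq k) * (rc (omega c k)^-1 *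
    (cis (tau * omega c k) * cint D (quad_integrand c a ^~ k)))).
  apply: (S2_ext _ (S2M nm_sq_omV (S2M (c1 tau) sX))) => k.
  by rewrite !mulrA.
have rQ3 := rep_fmult rQ2 (S2_csummable sQ3).
split; first exact: (repD (repD rD rL') (repZ 4^-1 rQ3)).
apply: S2D; last exact: S2Z.
apply: S2D; first exact: S2M (c1 tau) sa.
by apply: S2Z; apply: S2M nm_omV _; apply: S2M (c1 tau) _.
Qed.

End SchemeRep.

(** * Sobolev norms and exceptional times *)

Section SobolevNorms.
Context {R : realType}.
Local Notation rc := (real_complex R).
Local Notation sq := (@sq R).
Implicit Types (f : R -> R[i]) (a : int -> R[i]).

Lemma sqrte_le (x : \bar R) (N : R) : (0 <= x)%E -> 0 <= N ->
  (sqrte x <= N%:E)%E <-> (x <= (N ^+ 2)%:E)%E.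
Proof.
case: x => [x| |] //; rewrite /= !lee_fin => x0 N0.
rewrite -(ler_pXn2r (n := 2) (erefl _)) ?nnegrE ?sqrtr_ge0 // sqr_sqrtr //.
Qed.

Lemma esum_le_seq (p : int -> R) (K : R) : (forall k, 0 <= p k) ->
  (\esum_(k in [set: int]) (p k)%:E <= K%:E)%E <->
  (forall s : seq int, uniq s -> \sum_(k <- s) p k <= K).
Proof.
move=> p0; split=> [H s us|H].
  rewrite -lee_fin; apply: le_trans H.
  apply: esum_ge; exists [set` s].
    by split => //; exact: finite_seq.
  by rewrite -fsbig_seq // sumEFin.
apply: ub_ereal_sup => _ [A [fA _] <-].
rewrite fsbig_finite // sumEFin lee_fin; apply: H.
exact: finmap.fset_uniq.
Qed.

Lemma sobolev_le m f N : 0 <= N ->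
  (sobolev_norm m f <= N%:E)%E <->
  (forall s : seq int, uniq s -> \sum_(k <- s)
     ((1 + sq k) `^ m * nm (fourier f k) ^+ 2) <= N ^+ 2).
Proof.
move=> N0.
have p0 k : 0 <= (1 + sq k) `^ m * nm (fourier f k) ^+ 2.
  by rewrite mulr_ge0 ?powR_ge0 ?sqr_ge0.
rewrite /sobolev_norm sqrte_le //; last by apply: esum_ge0 => k _; rewrite lee_fin; exact: p0.
exact: (esum_le_seq _ p0).
Qed.

Lemma sob_lp (m : nat) f N : 0 <= N -> (sobolev_norm m%:R f <= N%:E)%E ->
  lp true (wt m (fourier f)) (2 ^+ m * N).
Proof.
move=> N0 /(sobolev_le _ _ N0) H; split; first by rewrite mulr_ge0 ?exprn_ge0.
move=> s us; rewrite exprMn.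
apply: (@le_trans _ _ ((2 ^+ m) ^+ 2 * \sum_(k <- s)
     ((1 + sq k) `^ m%:R * nm (fourier f k) ^+ 2))); last first.
  by apply: ler_wpM2l; [rewrite sqr_ge0|exact: H].
rewrite mulr_sumr; apply: ler_sum => k _; rewrite nm_wt exprMn mulrA.
apply: ler_wpM2r; first exact: sqr_ge0.
have s0 := @sq_ge0 R k.
rewrite powR_mulrn ?addr_ge0 //.
have -> : (W k ^+ m) ^+ 2 = (W k ^+ 2) ^+ m :> R by rewrite -!exprM mulnC.
have -> : (2 ^+ m) ^+ 2 = (2 ^+ 2) ^+ m :> R by rewrite -!exprM mulnC.
rewrite -exprMn; apply: lerXn2r; rewrite ?nnegrE ?sqr_ge0 ?mulr_ge0 ?addr_ge0 //.
apply: (le_trans (W_sqr_le k)); rewrite -/(sq k); lra.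
Qed.

Lemma lp_sob0 f K : lp true (fourier f) K -> (sobolev_norm 0 f <= K%:E)%E.
Proof.
move=> [K0 H]; apply/(sobolev_le _ _ K0) => s us.
by apply: le_trans (H s us); apply: ler_sum => k _; rewrite powRr0 mul1r.
Qed.

Lemma lp_sobN2 f a C K : 0 <= C ->
  (forall k, nm (fourier f k) <= C * (1 + sq k) * nm (a k)) ->
  lp true a K -> (sobolev_norm (- 2) f <= (C * K)%:E)%E.
Proof.
move=> C0 h [K0 H]; apply/(sobolev_le _ _ (mulr_ge0 C0 K0)) => s us.
rewrite exprMn; apply: (@le_trans _ _ (C ^+ 2 * \sum_(k <- s) nm (a k) ^+ 2)); last first.
  by apply: ler_wpM2l; [exact: sqr_ge0|exact: H].
rewrite mulr_sumr; apply: ler_sum => k _.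
have s0 : 0 < 1 + sq k by rewrite ltr_wpDr ?sq_ge0.
rewrite (@powR_invn _ _ 2) ?(ltW s0) // mulrC ler_pdivrMr ?exprn_gt0 //.
rewrite -!exprMn; apply: lerXn2r; rewrite ?nnegrE ?nm_ge0 ?mulr_ge0 ?nm_ge0 ?(ltW s0) //.
by apply: le_trans (h k) _; apply: eq_ler; ring.
Qed.

End SobolevNorms.

Section RepTimeAE.
Context {R : realType}.
Notation mu := (@lebesgue_measure R).
Notation Om := (@Omega R).

(** The integrand is bounded only for almost every time, as the hypotheses on the
    solution are essential suprema. *)
Lemma rep_time_ae (D : set R) (B : R -> int -> R[i]) (G : R -> R -> R[i]) K :
  measurable D -> (mu D < +oo)%E -> 0 <= K ->
  (forall k, cmeas D (B ^~ k)) -> (forall s, D s -> csummable (B s)) ->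
  {ae mu, forall s, D s -> lp false (B s) K} ->
  (forall s x, D s -> G s x = Fs (B s) x) ->
  (forall k, cinteg D (B ^~ k)) /\
  rep (fun x => cint D (G ^~ x)) (fun k => cint D (B ^~ k)).
Proof.
move=> mD muD K0 mB sB H HG.
have [_ iB _] := cint_csum mD muD K0 mB sB H.
split=> //.
have sb : csummable (fun k => cint D (B ^~ k)).
  by eexists; exact: (lp_cint mD muD K0 iB H).
rewrite (_ : (fun x => cint D (G ^~ x)) = Fs (fun k => cint D (B ^~ k))).
  exact: rep_Fs.
apply/funext => x.
rewrite (eq_cint (g := fun s => csum (fun k => B s k * cis (k%:~R * x)))); last first.
  by move=> s /set_mem Ds; rewrite HG.
have mm k : cmeas D (fun s => B s k * cis (k%:~R * x)).
  by apply: cmeasM => //; exact: cmeas_cst.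
have l : {ae mu, forall s, D s -> lp false (fun k => B s k * cis (k%:~R * x)) K}.
  apply: (ae_mono H) => s h /h; apply: le_lp1 => k; by rewrite nmM nm_cis mulr1.
have [_ _ ->] := cint_csum mD muD K0 mm (fun s Ds => csummable_cis _ (sB s Ds)) l.
apply: eq_csum => k; rewrite [RHS]mulrC -(cintZ mD); last exact: iB.
by apply: eq_cint => s _; rewrite mulrC.
Qed.

Lemma ae_ex (T : R) (P : R -> Prop) : 0 < T -> {ae mu, forall t, `]0, T[%classic t -> P t} ->
  exists2 t, 0 < t < T & P t.
Proof.
move=> T0 [N [mN N0 sub]].
apply: contrapT => H.
have : (mu `]0%R, T[ <= mu N)%E.
  apply: le_measure; rewrite ?inE //.
  move=> t tT; apply: sub => /= h; apply: H; exists t; last exact: h.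
  by move: tT; rewrite /= in_itv.
by rewrite N0 lebesgue_measure_itv /= lte_fin T0 /= sube0 lee_fin leNgt T0.
Qed.

End RepTimeAE.

(** * The exact solution *)

Section NonlinearityBound.
Context {R : realType}.
Local Notation rc := (real_complex R).
Local Notation sq := (@sq R).
Implicit Types (a : int -> R[i]) (c K : R).

Definition nlw c a : int -> R[i] := fun k => rc (omega c k)^-1 * nls c a k.

(** The inverse multiplier absorbs the two derivatives of the nonlinearity. *)
Lemma nlwE c a k : nlw c a k =
  rc (2 * (c * (omega c k)^-1)) * twice_re a k
  + rc (- sq k) * rc (omega c k)^-1 * convol (twice_re a) (twice_re a) k.
Proof.
rewrite /nlw /nls mulrDr !mulrA; congr (_ + _); last by rewrite [X in X * _]mulrC.
by congr (_ * _); rewrite -rmorphM; congr rc; ring.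
Qed.

Lemma nm_cw c k : 0 < c -> nm (rc (2 * (c * (omega c k)^-1))) <= 2 * (1 + c).
Proof.
move=> c0; rewrite nm_real ger0_norm; first by rewrite ler_pM2l // c_omegaV.
by rewrite !mulr_ge0 ?invr_ge0 ?omega_ge0 // ltW.
Qed.

Lemma lp_wt_twice_re p m a K : lp p (wt m a) K -> lp p (wt m (twice_re a)) (2 * K).
Proof.
move=> h; rewrite mulr_natl mulr2n.
by apply: le_lpD_wt h (lp_wt_cj h) => k; exact: nmD.
Qed.

Lemma lp_wt_nlw m c a K : 0 < c -> lp true (wt m.+1 a) K ->
  lp true (wt m.+1 (nlw c a))
    (2 * (1 + c) * (2 * K) + 2 ^+ m.+1 * (4 * (2 * K) * (2 * K))).
Proof.
move=> c0 h; have hH := lp_wt_twice_re h.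
have h1 : lp true (wt m.+1 (fun k => rc (2 * (c * (omega c k)^-1)) * twice_re a k))
    (2 * (1 + c) * (2 * K)).
  apply: le_lp_wt hH => [|k]; first by rewrite mulr_ge0 // addr_ge0 // ltW.
  by rewrite nmM ler_wpM2r ?nm_ge0 // nm_cw.
have h2 : lp true (wt m.+1 (fun k => rc (- sq k) * rc (omega c k)^-1 *
    convol (twice_re a) (twice_re a) k)) (1 * (2 ^+ m.+1 * (4 * (2 * K) * (2 * K)))).
  apply: le_lp_wt (convol_H hH hH) => [|k]; first exact: ler01.
  by rewrite nmM ler_wpM2r ?nm_ge0 // nm_sq_omV.
rewrite mul1r in h2.
by apply: le_lpD_wt h1 h2 => k; rewrite nlwE; exact: nmD.
Qed.

End NonlinearityBound.

Section ExactSolution.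
Context {R : realType}.
Notation mu := (@lebesgue_measure R).
Notation Om := (@Omega R).
Local Notation rc := (real_complex R).
Local Notation sq := (@sq R).
Variables (c T : R) (z zt : R -> R -> R).
Hypotheses (c0 : 0 < c) (T0 : 0 < T).
Hypothesis sol : boussinesq_solution c T z zt.
Hypothesis reg : forall t : R, 0 <= t <= T ->
  in_H 3 (toC (z t)) /\ in_H 1 (toC (zt t)).

Local Notation zc := (fun t => fourier (toC (z t))).
Local Notation ztc := (fun t => fourier (toC (zt t))).

Definition ucoef t : int -> R[i] := fourier (u_of c z zt t).

Let sob_fin (m : nat) (f : R -> R[i]) : in_H m%:R f ->
  rep f (fourier f) /\ exists N, lp true (wt m (fourier f)) N.
Proof.
move=> [_ i1 i2 fin]; split; first by split.
have s0 : (0 <= sobolev_norm m%:R f)%E by exact: sqrte_ge0.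
have fn : sobolev_norm m%:R f \is a fin_num by rewrite ge0_fin_numE.
exists (2 ^+ m * fine (sobolev_norm m%:R f)); apply: sob_lp.
  exact: fine_ge0.
by rewrite fineK.
Qed.

(** z_t has two derivatives fewer than z, and the inverse multiplier returns them. *)
Lemma lp_omegaV (a : int -> R[i]) (K : R) : lp true (wt 1 a) K ->
  lp true (wt 3 (fun k => rc (omega c k)^-1 * a k)) ((4 + 2 / c) * K).
Proof.
apply: le_lp => [|k]; first by rewrite addr_ge0 // divr_ge0 // ltW.
rewrite !nm_wt nmM nm_omegaV // (exprD _ 2 1).
have -> : W k ^+ 2 * W k ^+ 1 * ((omega c k)^-1 * nm (a k)) =
  (W k ^+ 2 * (omega c k)^-1) * (W k ^+ 1 * nm (a k)) by ring.
by rewrite ler_wpM2r ?W_omegaV // mulr_ge0 ?nm_ge0 ?W_exp_ge0.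
Qed.

Let toC_conj (w : R -> R) : conjf (toC w) = toC w.
Proof. by apply/funext => x; rewrite /conjf /toC conjc_real. Qed.

Let cj_toC (w : R -> R) : cinteg Om (toC w) ->
  cj (fourier (toC w)) =1 fourier (toC w).
Proof.
move=> iw k; have [_ <-] := rep_conj (conj iw (fun k => erefl) : rep (toC w) _).
by rewrite toC_conj.
Qed.

Lemma ucoef_rep t : 0 <= t <= T ->
  rep (u_of c z zt t) (fun k => zc t k - 'i * (rc (omega c k)^-1 * ztc t k)).
Proof.
move=> /reg [/sob_fin[r1 [N1 h1]] /(@sob_fin 1)[r2 [N2 h2]]].
apply: repB => //; apply: repZ; apply: rep_fmult r2 _.
have := l2_l1 (lp_omegaV h2) => /lp_wt0; exact: lp_csummable.
Qed.

Lemma ucoefE t k : 0 <= t <= T ->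
  ucoef t k = zc t k - 'i * (rc (omega c k)^-1 * ztc t k).
Proof. by move=> /ucoef_rep [_ h]; exact: h. Qed.

Lemma ucoef_rep' t : 0 <= t <= T -> rep (u_of c z zt t) (ucoef t).
Proof. by move=> /ucoef_rep [h _]; split. Qed.

Lemma ucoef_lp t N1 N2 : 0 <= t <= T -> lp true (wt 3 (zc t)) N1 ->
  lp true (wt 1 (ztc t)) N2 ->
  lp true (wt 3 (ucoef t)) (N1 + (4 + 2 / c) * N2).
Proof.
move=> ht h1 h2; apply: le_lpD_wt h1 (lp_omegaV h2) => k.
by rewrite ucoefE // (le_trans (nmB _ _)) // [nm ('i * _)]nmM nmi mul1r.
Qed.

Lemma ucoef_S2 t : 0 <= t <= T -> S2 (ucoef t).
Proof.
move=> ht; have [/sob_fin[_ [N1 h1]] /(@sob_fin 1)[_ [N2 h2]]] := reg ht.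
by eexists; exact: l2_l1 (ucoef_lp ht h1 h2).
Qed.

Let conj_form (x y : R[i]) (r : R) :
  conjc (x - 'i * (rc r * y)) = conjc x + 'i * (rc r * conjc y).
Proof.
rewrite conjcD conjcN !conjcM conjc_real.
by rewrite [conjc 'i](_ : _ = - 'i); [ring|rewrite /conjc; congr Complex; rewrite oppr0].
Qed.

Let cj_zc t k : 0 <= t <= T -> conjc (zc t (- k)) = zc t k /\
  conjc (ztc t (- k)) = ztc t k.
Proof.
move=> ht; have [[_ i1 i2 _] [_ j1 j2 _]] := reg ht.
split; first exact: (cj_toC (conj i1 i2) k).
exact: (cj_toC (conj j1 j2) k).
Qed.

Let cj_ucoef t k : 0 <= t <= T ->
  cj (ucoef t) k = zc t k + 'i * (rc (omega c k)^-1 * ztc t k).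
Proof.
move=> ht; have [e1 e2] := cj_zc k ht.
by rewrite /cj ucoefE // conj_form e1 e2 omega_opp.
Qed.

Lemma twice_re_ucoef t k : 0 <= t <= T -> twice_re (ucoef t) k = 2 * zc t k.
Proof.
by move=> ht; rewrite /twice_re cj_ucoef // ucoefE //; ring.
Qed.

(** As z and z_t are real, u - conj u is -2 i times the inverse multiplier of z_t. *)
Lemma ucoef_diff t k : 0 <= t <= T ->
  'i / 2 * (rc (omega c k) * (ucoef t k - cj (ucoef t) k)) = ztc t k.
Proof.
move=> ht; rewrite cj_ucoef // ucoefE //.
have ww : rc (omega c k) * rc (omega c k)^-1 = 1.
  by rewrite -rmorphM mulfV // gt_eqF // omega_gt0.
have two : (2 : R[i]) != 0 by rewrite pnatr_eq0.
set w := rc (omega c k) in ww *; set w' := rc _^-1 in ww *.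
set x := fourier (toC (z t)) k; set y := fourier (toC (zt t)) k.
rewrite -!complexiE; set I : R[i] := 'i%C.
have ii : I * I = -1 by rewrite -expr2 sqr_i.
transitivity (- (I * I) * (w * w') * y); first by clearbody w w' x y I; field.
by rewrite ii ww; ring.
Qed.

Lemma cmeas_ucoef k : cmeas `[0, T] (fun t => ucoef t k).
Proof.
have [[m1 m2] _ _] := sol.
apply: (@eq_cmeas _ _ (fun t => zc t k - 'i * (rc (omega c k)^-1 * ztc t k))).
  by move=> t /set_mem; rewrite /= in_itv /= => ht; rewrite ucoefE.
apply: cmeasB; first exact: m1.
apply: cmeasM; first exact: cmeas_cst.
by apply: cmeasM; [exact: cmeas_cst|exact: m2].
Qed.

Lemma cmeas_nlw k : cmeas `[0, T] (fun t => nlw c (ucoef t) k).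
Proof.
have [[m1 _] _ _] := sol.
have mh j : cmeas `[0, T] (fun t => twice_re (ucoef t) j).
  apply: (@eq_cmeas _ _ (fun t => 2 * zc t j)).
    by move=> t /set_mem; rewrite /= in_itv /= => ht; rewrite twice_re_ucoef.
  by apply: cmeasM; [exact: cmeas_cst|exact: m1].
apply: cmeasM; first exact: cmeas_cst.
apply: cmeasD; first by apply: cmeasM; [exact: cmeas_cst|exact: mh].
apply: cmeasM; first exact: cmeas_cst.
apply: (cmeas_csum (b := fun j t => twice_re (ucoef t) j * twice_re (ucoef t) (k - j))).
  by move=> j; exact: cmeasM.
move=> t; rewrite /= in_itv /= => ht; apply: csummable_convol;
  by apply: S2_csummable; apply: S2_twice_re; exact: ucoef_S2.
Qed.

Variable M : R.
Hypothesis hM : (Linf_norm T 3 (fun t => toC (z t))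
              + Linf_norm T 1 (fun t => toC (zt t)) <= M%:E)%E.

Let muT : (0 < mrestr mu (measurable_itv `]0%R, T[) setT)%E.
Proof.
rewrite /mrestr setTI lebesgue_measure_itv /= lte_fin T0 /= sube0.
by rewrite lte_fin.
Qed.

Lemma Linf_ge0 m (w : R -> R -> R[i]) : (0 <= Linf_norm T m w)%E.
Proof.
apply: ess_sup_gee => //; apply: aeW => t; exact: sqrte_ge0.
Qed.

Let M0 : 0 <= M.
Proof. by rewrite -lee_fin (le_trans _ hM) // adde_ge0 ?Linf_ge0. Qed.

Let Linf_ae m (w : R -> R -> R[i]) : (Linf_norm T m w <= M%:E)%E ->
  {ae mu, forall t, `]0, T[%classic t -> (sobolev_norm m (w t) <= M%:E)%E}.
Proof.
move=> h.
have := ess_sup_ge (mrestr mu (measurable_itv `]0%R, T[)) (fun t => sobolev_norm m (w t)).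
move=> [N [mN N0 sub]].
exists (N `&` `]0, T[); split => //.
  by apply: measurableI => //; exact: measurable_itv.
move=> t /= ht; have [h1 h2] : `]0%R, T[%classic t /\ ~ (sobolev_norm m (w t) <= M%:E)%E.
  by apply/not_implyP; exact: ht.
split=> //; apply: sub => /= h3; apply: h2; exact: le_trans h3 h.
Qed.

Definition ae_bound : R := 2 ^+ 3 * M + (4 + 2 / c) * (2 * M).

(** An essential supremum is a bound at almost every time only. *)
Lemma ucoef_ae : {ae mu, forall t, `]0, T[%classic t ->
  lp true (wt 3 (ucoef t)) ae_bound}.
Proof.
have h1 : (Linf_norm T 3 (fun t => toC (z t)) <= M%:E)%E.
  by apply: le_trans hM; rewrite leeDl ?Linf_ge0.
have h2 : (Linf_norm T 1 (fun t => toC (zt t)) <= M%:E)%E.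
  by apply: le_trans hM; rewrite leeDr ?Linf_ge0.
apply: (ae_mono (ae_and (Linf_ae h1) (Linf_ae h2))) => t [a1 a2] ht.
have ht' : 0 <= t <= T by move: ht; rewrite /= in_itv /= => /andP[p1 p2]; rewrite !ltW.
apply: ucoef_lp => //; first by apply: sob_lp => //; exact: a1.
by rewrite -[2]expr1; apply: (@sob_lp _ 1) => //; exact: a2.
Qed.

Lemma ae_ne (r : R) : {ae mu, forall t : R, t != r}.
Proof.
exists [set r]; split; [exact: measurable_set1|exact: lebesgue_measure_set1|].
by move=> t /= /negP; rewrite negbK => /eqP.
Qed.

Let ucoef_ae' : {ae mu, forall t, 0 <= t <= T -> lp true (wt 3 (ucoef t)) ae_bound}.
Proof.
apply: (ae_mono (ae_and ucoef_ae (ae_and (ae_ne 0) (ae_ne T)))).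
move=> t [h [n0 nT]] /andP[t0 tT]; apply: h.
by rewrite /= in_itv /= !lt_neqAle t0 tT eq_sym n0 nT.
Qed.

Definition nlw_bound : R :=
  2 * (1 + c) * (2 * ae_bound) + 2 ^+ 3 * (4 * (2 * ae_bound) * (2 * ae_bound)).

Let nlw_ae : {ae mu, forall t, 0 <= t <= T ->
  lp true (wt 3 (nlw c (ucoef t))) nlw_bound}.
Proof. by apply: (ae_mono ucoef_ae') => t h /h; exact: lp_wt_nlw. Qed.

Lemma ae_bound_ge0 : 0 <= ae_bound.
Proof.
by rewrite /ae_bound addr_ge0 // !mulr_ge0 // ?addr_ge0 ?divr_ge0 // ltW.
Qed.

Lemma nlw_bound_ge0 : 0 <= nlw_bound.
Proof.
have b0 := ae_bound_ge0.
by rewrite /nlw_bound addr_ge0 // !mulr_ge0 // ?addr_ge0 // ltW.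
Qed.

Definition duham t s k : R[i] :=
  cis ((t - s) * omega c k) * nlw c (ucoef s) k.

Let csummable_nlw t : 0 <= t <= T -> csummable (nlw c (ucoef t)).
Proof.
move=> ht; apply: csummableM (fun k => nm_omV c0 k) _.
by apply: csummable_nls => //; exact: ucoef_S2.
Qed.

Let duham_meas t k : t <= T -> cmeas `[0, t] (fun s => duham t s k).
Proof.
move=> tT; apply: cmeasM.
  apply: cmeas_cis; apply: measurable_funM; last exact: measurable_cst.
  by apply: measurable_funB => //; exact: measurable_cst.
apply: cmeasS (cmeas_nlw k); first exact: measurable_itv.
by apply: subset_itv; rewrite bnd_simp.
Qed.

Let nm_duham t s k : nm (duham t s k) = nm (nlw c (ucoef s) k).
Proof. by rewrite nmM nm_cis mul1r. Qed.

Let duhamel_rep t : 0 <= t <= T ->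
  (forall k, cinteg `[0, t] (fun s => duham t s k)) /\
  rep (fun x => cint `[0, t]
         (fun s => exp_bra c (t - s) (bra_inv c (nonlin c (u_of c z zt s))) x))
      (fun k => cint `[0, t] (fun s => duham t s k)).
Proof.
move=> /andP[t0 tT].
have sT s : `[0, t]%classic s -> 0 <= s <= T.
  by rewrite /= in_itv /= => /andP[-> st]; rewrite (le_trans st).
apply: (rep_time_ae (K := 2 * nlw_bound)).
- exact: measurable_itv.
- exact: mu_itv_lty.
- by rewrite mulr_ge0 // nlw_bound_ge0.
- by move=> k; exact: duham_meas.
- move=> s /sT hs; have [K h] := csummable_nlw hs.
  by exists K; apply: le_lp1 h => k; rewrite nm_duham.
- apply: (ae_mono nlw_ae) => s h /sT /h /l2_l1 /lp_wt0.
  by apply: le_lp1 => k; rewrite nm_duham.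
move=> s x /sT hs.
have rs := ucoef_rep' hs; have ss := ucoef_S2 hs.
have rN := rep_nonlin c rs ss.
have [_ rB] := rep_fmult rN (csummable_nlw hs).
rewrite /exp_bra fmultE; congr (Fs _ x); apply/funext => k.
by rewrite /bra_inv rB.
Qed.

(** Duhamel's formula holds for almost every x, and Fourier coefficients do not see
    null sets. *)
Lemma duhamel0 t k : 0 <= t <= T ->
  ucoef t k = cis (t * omega c k) * ucoef 0 k
    - 'i * 4^-1 * cint `[0, t] (fun s => duham t s k).
Proof.
move=> ht; have [_ rD] := duhamel_rep ht.
have h0 : 0 <= (0 : R) <= T by rewrite lexx ltW.
have r0 : rep (exp_bra c t (u_of c z zt 0)) (fun k => cis (t * omega c k) * ucoef 0 k).
  apply: rep_fmult (ucoef_rep' h0) _; apply: S2_csummable.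
  by apply: (S2M (C := 1)) (ucoef_S2 h0) => j; rewrite nm_cis.
have [_ _ /(_ t ht) H] := sol.
have rR := repB r0 (repZ ('i * 4^-1) rD).
have [_ h] := rep_ae_eq (cinteg_meas (proj1 (ucoef_rep' ht)))
  (ae_mono H (fun x hx _ => hx)) rR.
exact: h.
Qed.

Definition sup_bound : R := ae_bound + nlw_bound * T + nlw_bound * T.

Let duham_lp t : 0 <= t <= T ->
  lp true (wt 3 (fun k => cint `[0, t] (fun s => duham t s k))) (nlw_bound * T).
Proof.
move=> ht; have [iD _] := duhamel_rep ht; have /andP[t0 tT] := ht.
have mD : measurable (`[0, t]%classic : set R) by exact: measurable_itv.
have iw k : cinteg `[0, t] (fun s => wt 3 (duham t s) k) by exact: cintegZ.
apply: (@lpW _ _ _ (nlw_bound * fine (mu `[0, t]))).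
  by rewrite mu_itv // subr0 ler_wpM2l // nlw_bound_ge0.
apply: (eq_lp (a := fun k => cint `[0, t] (fun s => wt 3 (duham t s) k))).
  by move=> k; rewrite [RHS]/wt -(cintZ mD _ (iD k)).
apply: (lp_cint mD _ nlw_bound_ge0 iw); first exact: mu_itv_lty.
apply: (ae_mono nlw_ae) => s h; rewrite /= in_itv /= => /andP[s0 st].
have /h : 0 <= s <= T by rewrite s0 (le_trans st).
by apply: le_lp1 => k; rewrite !nm_wt nm_duham.
Qed.

(** The Duhamel formula propagates the bound from one good time back to 0 and
    from 0 to any t. *)
Lemma ucoef_sup t : 0 <= t <= T -> lp true (wt 3 (ucoef t)) sup_bound.
Proof.
move=> ht.
(* A time at which the essential suprema are genuine bounds. *)
have [s /andP[s0 sT] hs] := ae_ex T0 ucoef_ae.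
have hsT : 0 <= s <= T by rewrite !ltW.
have i4 : nm ('i * 4^-1 : R[i]) <= 1.
  rewrite -complexiE nmM nmi mul1r.
  have -> : (4^-1 : R[i]) = rc 4^-1 by rewrite fmorphV rmorph_nat.
  by rewrite nm_real ger0_norm ?invr_ge0 // invf_le1 // ler1n.
have h0 : lp true (wt 3 (ucoef 0)) (ae_bound + nlw_bound * T).
  apply: le_lpD_wt hs (duham_lp hsT) => k.
  apply: (@le_trans _ _ (nm (cis (s * omega c k) * ucoef 0 k))).
    by rewrite [leRHS]nmM nm_cis mul1r.
  rewrite (_ : cis (s * omega c k) * ucoef 0 k = ucoef s k +
      'i * 4^-1 * cint `[0, s] (fun r => duham s r k)); last first.
    by rewrite (duhamel0 k hsT); ring.
  apply: (le_trans (nmD _ _)); rewrite lerD2l nmM ler_piMl ?nm_ge0 //.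
apply: le_lpD_wt h0 (duham_lp ht) => k; rewrite (duhamel0 k ht).
apply: (le_trans (nmB _ _)); rewrite [X in X + _]nmM nm_cis mul1r lerD2l.
by rewrite nmM ler_piMl ?nm_ge0.
Qed.

Let duhamel_alg (a b v i1 i2 q : R[i]) :
  a * b * v - q * (a * i1 + i2) = a * (b * v - q * i1) - q * i2.
Proof. by ring. Qed.

(** The flow property: the formula from 0 to t + s is split at t. *)
Lemma duhamel t s k : 0 <= t -> 0 <= s -> t + s <= T ->
  ucoef (t + s) k = cis (s * omega c k) * ucoef t k
    - 'i * 4^-1 * cint `[0, s] (fun r => cis ((s - r) * omega c k) *
                                         nlw c (ucoef (t + r)) k).
Proof.
move=> t0 s0 tsT.
have ht : 0 <= t <= T by rewrite t0 (le_trans _ tsT) // lerDl.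
have hts : 0 <= t + s <= T by rewrite addr_ge0.
have [iD _] := duhamel_rep hts.
have [iD' _] := duhamel_rep ht.
rewrite (duhamel0 k hts) (duhamel0 k ht).
have -> : cint `[0, t + s] (fun r => duham (t + s) r k) =
    cint `[0, t] (fun r => duham (t + s) r k) +
    cint `[t, t + s] (fun r => duham (t + s) r k).
  by apply: cint_split => //; rewrite lerDl.
have -> : cint `[0, t] (fun r => duham (t + s) r k) =
    cis (s * omega c k) * cint `[0, t] (fun r => duham t r k).
  rewrite -cintZ; [|exact: measurable_itv|exact: iD'].
  apply: eq_cint => r _; rewrite /duham mulrA -cisD; congr (cis _ * _); ring.
have -> : cint `[t, t + s] (fun r => duham (t + s) r k) =
    cint `[0, s] (fun r => cis ((s - r) * omega c k) * nlw c (ucoef (t + r)) k).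
  have i2 : cinteg `[t + 0, t + s] (fun r => duham (t + s) r k).
    by apply: cintegS (iD k); rewrite ?addr0.
  rewrite -{1}[t]addr0 (cint_shift s0 i2); apply: eq_cint => r _.
  by rewrite /duham; congr (cis _ * _); ring.
have -> : cis ((t + s) * omega c k) = cis (s * omega c k) * cis (t * omega c k) :> R[i].
  by rewrite -cisD; congr cis; ring.
exact: duhamel_alg.
Qed.

End ExactSolution.

(** * Products in the frame of the free flow, uniform bounds *)

Section Bilinear.
Context {R : realType}.
Local Notation rc := (real_complex R).
Local Notation sq := (@sq R).
Implicit Types (x y a b : int -> R[i]) (s : R) (k j : int).

(** A product seen through three free Schroedinger flows; every quadratic term of
    the scheme and of the Duhamel formula has this form. *)
Definition bil (s1 s2 s3 : R) x y : int -> R[i] :=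
  ex s3 (convol (ex s1 x) (ex s2 y)).

Lemma bil_lp_l p s1 s2 s3 x y X Y : lp p x X -> lp false y Y ->
  lp p (bil s1 s2 s3 x y) (X * Y).
Proof. by move=> hx hy; apply: lp_ex; apply: convol_young_l; exact: lp_ex. Qed.

Lemma bil_lp_r p s1 s2 s3 x y X Y : lp false x X -> lp p y Y ->
  lp p (bil s1 s2 s3 x y) (X * Y).
Proof.
move=> hx hy; apply: lp_ex.
by have [_] := convol_young (lp_ex s1 hx) (lp_ex s2 hy).
Qed.

Lemma bil_summ s1 s2 x y k : csummable x -> csummable y ->
  csummable (fun j => ex s1 x j * ex s2 y (k - j)).
Proof. by move=> sx sy; apply: csummable_convol; exact: csummable_ex. Qed.

Lemma bilDl s1 s2 s3 x x' y k : csummable x -> csummable x' -> csummable y ->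
  bil s1 s2 s3 (fun j => x j + x' j) y k = bil s1 s2 s3 x y k + bil s1 s2 s3 x' y k.
Proof.
move=> sx sx' sy; rewrite /bil /ex -mulrDr; congr (_ * _).
rewrite /convol -csumD; [|exact: bil_summ|exact: bil_summ].
by apply: eq_csum => j; rewrite mulrDr mulrDl.
Qed.

Lemma bilDr s1 s2 s3 x y y' k : csummable x -> csummable y -> csummable y' ->
  bil s1 s2 s3 x (fun j => y j + y' j) k = bil s1 s2 s3 x y k + bil s1 s2 s3 x y' k.
Proof.
move=> sx sy sy'; rewrite /bil /ex -mulrDr; congr (_ * _).
rewrite /convol -csumD; [|exact: bil_summ|exact: bil_summ].
by apply: eq_csum => j; rewrite mulrDr mulrDr.
Qed.

Lemma bilZl s1 s2 s3 (z : R[i]) x y k : csummable x -> csummable y ->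
  bil s1 s2 s3 (fun j => z * x j) y k = z * bil s1 s2 s3 x y k.
Proof.
move=> sx sy; rewrite /bil ![ex s3 _ k]/ex [RHS]mulrCA; congr (_ * _).
rewrite /convol -csumZ; last exact: bil_summ.
by apply: eq_csum => j; rewrite /ex; ring.
Qed.

Lemma bilZr s1 s2 s3 (z : R[i]) x y k : csummable x -> csummable y ->
  bil s1 s2 s3 x (fun j => z * y j) k = z * bil s1 s2 s3 x y k.
Proof.
move=> sx sy; rewrite /bil ![ex s3 _ k]/ex [RHS]mulrCA; congr (_ * _).
rewrite /convol -csumZ; last exact: bil_summ.
by apply: eq_csum => j; rewrite /ex; ring.
Qed.

Lemma bilC s1 s3 x y k : csummable x -> csummable y ->
  bil s1 s1 s3 x y k = bil s1 s1 s3 y x k.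
Proof.
move=> sx sy; rewrite /bil /ex; congr (_ * _).
by apply: convol_comm; exact: csummable_ex.
Qed.

Lemma bilE s1 s2 s3 x y k : csummable x -> csummable y ->
  bil s1 s2 s3 x y k =
  csum (fun j => cis (- (s1 * sq j + s2 * sq (k - j) + s3 * sq k)) * (x j * y (k - j))).
Proof.
move=> sx sy; rewrite /bil [LHS]/ex /convol -csumZ; last exact: bil_summ.
apply: eq_csum => j; rewrite /ex.
have -> : - (s1 * sq j + s2 * sq (k - j) + s3 * sq k) =
   - (s3 * sq k) + (- (s1 * sq j) + - (s2 * sq (k - j))) by ring.
by rewrite !cisD; ring.
Qed.

Lemma bil_theta_summ (th : int -> R[i]) (C : R) x y k : csummable x -> csummable y ->
  (forall j, nm (th j) <= C) -> csummable (fun j => th j * (x j * y (k - j))).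
Proof. by move=> sx sy h; apply: csummableM h _; exact: csummable_convol. Qed.

Lemma bil0 x y : bil 0 0 0 x y =1 convol x y.
Proof.
have e0 z : ex 0 z = z by apply/funext => k; rewrite /ex mul0r oppr0 cis0 mul1r.
by move=> k; rewrite /bil !e0.
Qed.

Lemma csummableB x y : csummable x -> csummable y -> csummable (fun k => x k - y k).
Proof. by move=> [K h] [K' h']; exists (K + K'); exact: lpB. Qed.

(** The resonance function of the quadratic interaction. *)
Lemma sq_resonance k j : sq k - sq j - sq (k - j) = 2 * (j%:~R * (k - j)%:~R).
Proof. by rewrite /sq rmorphB /=; ring. Qed.

End Bilinear.

Section UniformBounds.
Context {R : realType} {Pi : Type}.
Local Notation rc := (real_complex R).
Implicit Types (F G : Pi -> int -> R[i]) (e g : Pi -> R).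

(** The parameter i carries the solution, the time and the step, so that the
    constant depends on none of them. *)
Definition uO p e F : Prop :=
  exists C, 0 <= C /\ forall i, lp p (F i) (C * e i).

Lemma uO_ext p e F G : (forall i, F i =1 G i) -> uO p e F -> uO p e G.
Proof. by move=> h [C [C0 H]]; exists C; split => // i; apply: eq_lp (H i). Qed.

Lemma uO_le p e e' F : (forall i, 0 <= e i <= e' i) -> uO p e F -> uO p e' F.
Proof.
move=> h [C [C0 H]]; exists C; split => // i; apply: lpW (H i).
by rewrite ler_wpM2l //; case/andP: (h i).
Qed.

Lemma uOD p e F G : uO p e F -> uO p e G -> uO p e (fun i k => F i k + G i k).
Proof.
move=> [C [C0 H]] [D [D0 H']]; exists (C + D); split; first exact: addr_ge0.
by move=> i; rewrite mulrDl; exact: lpD.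
Qed.

Lemma uON p e F : uO p e F -> uO p e (fun i k => - F i k).
Proof. by move=> [C [C0 H]]; exists C; split => // i; exact: lpN. Qed.

Lemma uOB p e F G : uO p e F -> uO p e G -> uO p e (fun i k => F i k - G i k).
Proof. by move=> h h'; apply: uOD => //; exact: uON. Qed.

Lemma uOM p e g (m : Pi -> int -> R[i]) F (D : R) : 0 <= D ->
  (forall i, 0 <= g i) -> (forall i k, nm (m i k) <= D * g i) -> uO p e F ->
  uO p (fun i => g i * e i) (fun i k => m i k * F i k).
Proof.
move=> D0 g0 h [C [C0 H]]; exists (D * C); split; first exact: mulr_ge0.
move=> i; have -> : D * C * (g i * e i) = D * g i * (C * e i) by ring.
by apply: lpM => //; rewrite mulr_ge0.
Qed.

Lemma uOM1 p e (m : Pi -> int -> R[i]) F (D : R) : 0 <= D ->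
  (forall i k, nm (m i k) <= D) -> uO p e F ->
  uO p e (fun i k => m i k * F i k).
Proof.
move=> D0 h [C [C0 H]]; exists (D * C); split; first exact: mulr_ge0.
by move=> i; rewrite -mulrA; apply: lpM.
Qed.

Lemma uOZ p e (z : R[i]) F : uO p e F -> uO p e (fun i k => z * F i k).
Proof. by apply: (uOM1 (D := nm z)) => //; exact: nm_ge0. Qed.

Lemma uO_cj p e F : uO p e F -> uO p e (fun i => cj (F i)).
Proof. by move=> [C [C0 H]]; exists C; split => // i; exact: lp_cj. Qed.

Lemma uO_ex p e (s : Pi -> R) F : uO p e F -> uO p e (fun i => ex (s i) (F i)).
Proof. by move=> [C [C0 H]]; exists C; split => // i; exact: lp_ex. Qed.

Lemma uO_bill p e e' (s1 s2 s3 : Pi -> R) F G : uO p e F -> uO false e' G ->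
  uO p (fun i => e i * e' i) (fun i => bil (s1 i) (s2 i) (s3 i) (F i) (G i)).
Proof.
move=> [C [C0 H]] [D [D0 H']]; exists (C * D); split; first exact: mulr_ge0.
move=> i; have -> : C * D * (e i * e' i) = C * e i * (D * e' i) by ring.
exact: bil_lp_l.
Qed.

Lemma uO_bilr p e e' (s1 s2 s3 : Pi -> R) F G : uO false e F -> uO p e' G ->
  uO p (fun i => e i * e' i) (fun i => bil (s1 i) (s2 i) (s3 i) (F i) (G i)).
Proof.
move=> [C [C0 H]] [D [D0 H']]; exists (C * D); split; first exact: mulr_ge0.
move=> i; have -> : C * D * (e i * e' i) = C * e i * (D * e' i) by ring.
exact: bil_lp_r.
Qed.

Lemma uO_csummable e F : uO false e F -> forall i, csummable (F i).
Proof. by move=> [C [_ H]] i; exact: lp_csummable (H i). Qed.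

(** One of the three weights is spent on summability. *)
Lemma uO_wt p (m : nat) e F : (m <= 2)%N ->
  uO true e (fun i => wt 3 (F i)) -> uO p e (fun i => wt m (F i)).
Proof.
move=> m2 [C [C0 H]]; exists (2 * C); split; first by rewrite mulr_ge0.
move=> i; have l1 : lp false (wt m (F i)) (2 * (C * e i)).
  exact: lp_wt_le m2 (l2_l1 (H i)).
by rewrite -mulrA; case: p => //; exact: lp_l1_l2.
Qed.

Lemma uO_wt0 p e F : uO true e (fun i => wt 3 (F i)) -> uO p e F.
Proof.
by move=> /(uO_wt p (leq0n 2)); apply: uO_ext => i; exact: wt0.
Qed.

End UniformBounds.

(** * Lipschitz dependence *)

Section Near.
Context {R : realType} {Pi : Type}.
Variables (p : bool) (e : Pi -> R).
Local Notation rc := (real_complex R).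
Local Notation sq := (@sq R).
Implicit Types (F G : Pi -> int -> R[i]).

(** A Lipschitz relation between two families, stable under all the operations from
    which the scheme is built; it serves both for the stability of the scheme and
    for the continuity in time of the nonlinearity. *)
Definition near_by F G : Prop :=
  [/\ uO false (fun=> 1) F, uO false (fun=> 1) G &
      uO p e (fun i k => G i k - F i k)].

Lemma near_ext F G F' G' : (forall i, F i =1 F' i) -> (forall i, G i =1 G' i) ->
  near_by F G -> near_by F' G'.
Proof.
move=> h h' [b1 b2 b3]; split; [exact: uO_ext b1|exact: uO_ext b2|].
by apply: uO_ext b3 => i k; rewrite h h'.
Qed.

Lemma nearD F G F' G' : near_by F G -> near_by F' G' ->
  near_by (fun i k => F i k + F' i k) (fun i k => G i k + G' i k).
Proof.
move=> [a1 a2 a3] [b1 b2 b3]; split; [exact: uOD|exact: uOD|].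
by apply: uO_ext (uOD a3 b3) => i k; ring.
Qed.

Lemma nearM (m : Pi -> int -> R[i]) D F G : 0 <= D ->
  (forall i k, nm (m i k) <= D) -> near_by F G ->
  near_by (fun i k => m i k * F i k) (fun i k => m i k * G i k).
Proof.
move=> D0 h [a1 a2 a3]; split; [exact: uOM1 h a1|exact: uOM1 h a2|].
by apply: uO_ext (uOM1 D0 h a3) => i k; rewrite mulrBr.
Qed.

Lemma nearZ z F G : near_by F G ->
  near_by (fun i k => z * F i k) (fun i k => z * G i k).
Proof. by apply: (@nearM (fun _ _ => z) (nm z)) => //; exact: nm_ge0. Qed.

Lemma nearN F G : near_by F G -> near_by (fun i k => - F i k) (fun i k => - G i k).
Proof.
by move=> h; apply: near_ext (nearZ (-1) h) => i k; rewrite mulN1r.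
Qed.

Lemma nearB F G F' G' : near_by F G -> near_by F' G' ->
  near_by (fun i k => F i k - F' i k) (fun i k => G i k - G' i k).
Proof. by move=> h h'; apply: nearD => //; exact: nearN. Qed.

Lemma near_cj F G : near_by F G -> near_by (fun i => cj (F i)) (fun i => cj (G i)).
Proof.
move=> [a1 a2 a3]; split; [exact: uO_cj|exact: uO_cj|].
by apply: uO_ext (uO_cj a3) => i k; rewrite /cj conjcD conjcN.
Qed.

Lemma near_ex (s : Pi -> R) F G : near_by F G ->
  near_by (fun i => ex (s i) (F i)) (fun i => ex (s i) (G i)).
Proof. by apply: (nearM (D := 1)) => // i k; rewrite nm_cis. Qed.

(** A bilinear difference: one factor changes at a time, the other being bounded
    in l1. *)
Lemma near_bil (s1 s2 s3 : Pi -> R) F G F' G' : near_by F G -> near_by F' G' ->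
  near_by (fun i => bil (s1 i) (s2 i) (s3 i) (F i) (F' i))
          (fun i => bil (s1 i) (s2 i) (s3 i) (G i) (G' i)).
Proof.
move=> [a1 a2 a3] [b1 b2 b3].
have one (f g : Pi -> int -> R[i]) : uO false (fun=> 1) f -> uO false (fun=> 1) g ->
    uO false (fun=> 1) (fun i => bil (s1 i) (s2 i) (s3 i) (f i) (g i)).
  move=> h h'; have := uO_bill s1 s2 s3 h h'.
  by move=> [C [C0 H]]; exists C; split => // i; have := H i; rewrite mul1r.
split; [exact: one|exact: one|].
have [C [C0 H]] := uO_bill s1 s2 s3 a3 b2.
have [D [D0 H']] := uO_bilr s1 s2 s3 a1 b3.
exists (C + D); split=> [|i]; first exact: addr_ge0.
rewrite mulrDl; have := lpD (H i) (H' i); rewrite mul1r mulr1; apply: eq_lp => k.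
have sF := uO_csummable a1 i; have sG := uO_csummable a2 i.
have sF' := uO_csummable b1 i; have sG' := uO_csummable b2 i.
have sd := csummableB sG sF; have sd' := csummableB sG' sF'.
have eG : (fun j => F i j + (G i j - F i j)) = G i by apply/funext => j; ring.
have eG' : (fun j => F' i j + (G' i j - F' i j)) = G' i by apply/funext => j; ring.
have := bilDl (s1 i) (s2 i) (s3 i) k sF sd sG'; rewrite eG => ->.
have := bilDr (s1 i) (s2 i) (s3 i) k sF sF' sd'; rewrite eG' => ->.
by ring.
Qed.

Lemma near_convol F G F' G' : near_by F G -> near_by F' G' ->
  near_by (fun i => convol (F i) (F' i)) (fun i => convol (G i) (G' i)).
Proof.
move=> h h'; apply: near_ext (near_bil (fun=> 0) (fun=> 0) (fun=> 0) h h') => i k;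
  by rewrite bil0.
Qed.

Variable c : R.
Hypothesis c0 : 0 < c.

Lemma near_nlw F G : near_by F G ->
  near_by (fun i => nlw c (F i)) (fun i => nlw c (G i)).
Proof.
move=> h; have hH : near_by (fun i => twice_re (F i)) (fun i => twice_re (G i)).
  by apply: nearD => //; exact: near_cj.
have c1 : 0 <= 2 * (1 + c) by rewrite mulr_ge0 // addr_ge0 // ltW.
have h1 := nearM (m := fun i k => rc (2 * (c * (omega c k)^-1))) c1
  (fun _ k => nm_cw k c0) hH.
have h2 := nearM (m := fun i k => rc (- sq k) * rc (omega c k)^-1) ler01
  (fun _ k => nm_sq_omV c0 k) (near_convol hH hH).
by apply: near_ext (nearD h1 h2) => i k; rewrite nlwE.
Qed.

Lemma near_asym F G : near_by F G ->
  near_by (fun i k => rc (asym c k) * F i k) (fun i k => rc (asym c k) * G i k).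
Proof.
by apply: (nearM (D := 1 + c)) => [|i k]; [rewrite addr_ge0 // ltW|exact: nm_asym].
Qed.

Lemma near_P_coef F G : near_by F G ->
  near_by (fun i => P_coef c (F i)) (fun i => P_coef c (G i)).
Proof.
move=> h; apply: nearB; first exact: near_asym.
by apply: nearZ; exact: near_nlw.
Qed.

Variable s : Pi -> R.
Hypothesis s01 : forall i, 0 <= s i <= 1.

Lemma near_s F G : near_by F G ->
  near_by (fun i k => rc (s i) * F i k) (fun i k => rc (s i) * G i k).
Proof.
apply: (nearM (D := 1)) => // i k; rewrite nm_real.
by have /andP[a b] := s01 i; rewrite ger0_norm.
Qed.

Lemma near_lin_integrand F G : near_by F G ->
  near_by (fun i => lin_integrand c (F i) (s i)) (fun i => lin_integrand c (G i) (s i)).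
Proof.
move=> h; have hP := near_P_coef h; have hA := near_asym h.
have hc := near_cj h; have is_ F' G' : near_by F' G' -> near_by
  (fun i k => 'i * rc (s i) * F' i k) (fun i k => 'i * rc (s i) * G' i k).
  by move=> H; apply: near_ext (nearZ 'i (near_s H)) => i k; rewrite mulrA.
apply: nearD.
  by apply: nearB => //; apply: is_; exact: nearB.
apply: nearB; first by apply: near_ex.
apply: is_; apply: (near_ex (fun i => 2 * s i)); apply: nearD; last exact: (near_cj hP).
exact: near_asym.
Qed.

Lemma near_quad_integrand F G : near_by F G ->
  near_by (fun i => quad_integrand c (F i) (s i)) (fun i => quad_integrand c (G i) (s i)).
Proof.
move=> h; have hP := near_P_coef h.
have nT1 F1 G1 F2 G2 : near_by F1 G1 -> near_by F2 G2 ->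
  near_by (fun i => T1 (F1 i) (F2 i) (s i)) (fun i => T1 (G1 i) (G2 i) (s i)).
  by move=> h1 h2; apply: (near_bil (fun i => - s i) (fun i => - s i) s h1 h2).
have nT2 F1 G1 F2 G2 : near_by F1 G1 -> near_by F2 G2 ->
  near_by (fun i => T2 (F1 i) (F2 i) (s i)) (fun i => T2 (G1 i) (G2 i) (s i)).
  by move=> h1 h2; apply: (near_bil (fun i => - s i) s s h1 (near_cj h2)).
have nT3 F1 G1 F2 G2 : near_by F1 G1 -> near_by F2 G2 ->
  near_by (fun i => T3 (F1 i) (F2 i) (s i)) (fun i => T3 (G1 i) (G2 i) (s i)).
  move=> h1 h2; apply: (near_ex (fun i => 2 * s i)).
  by apply: near_convol; exact: near_cj.
apply: nearB; last by apply: nearZ; apply: near_s; apply: nearD; [exact: nT3|exact: nT2].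
apply: nearD; last by apply: nearZ; apply: near_s; apply: nearD; [exact: nT1|exact: nT2].
apply: nearB.
  apply: nearZ; apply: nearB; last exact: (near_convol (near_cj h) (near_cj h)).
  apply: nearD; last exact: nT3.
  apply: nearD; last by apply: nearZ; exact: nT2.
  by apply: nearD; [exact: nT1|exact: (near_cj (nT1 _ _ _ _ h h))].
apply: near_asym; apply: near_s; apply: nearD; last exact: nT3.
by apply: nearD; [exact: nT1|apply: nearZ; exact: nT2].
Qed.

End Near.

(** * Stability *)

Section Multipliers.
Context {R : realType}.
Local Notation mu := (@lebesgue_measure R).
Local Notation rc := (real_complex R).
Local Notation sq := (@sq R).
Implicit Types (a b : int -> R[i]).
Variables (c tau : R).
Hypotheses (c0 : 0 < c) (tau0 : 0 < tau).

(** The multipliers in front of the linear and of the quadratic time integral, for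
    the scheme as well as for the Duhamel formula. *)
Definition lmult k : R[i] :=
  - ('i * rc c / 2) * (rc (omega c k)^-1 * cis (tau * omega c k)).
Definition qmult k : R[i] :=
  4^-1 * (rc (- sq k) * (rc (omega c k)^-1 * cis (tau * omega c k))).

Lemma nm_lmult k : nm (lmult k) <= 1 + c.
Proof.
rewrite /lmult -complexiE !nmM nmN !nmM nmi nm_cis mulr1 mul1r nm_omegaV //.
rewrite nm_real ger0_norm; last exact: ltW.
have -> : nm (2^-1 : R[i]) = 2^-1.
  rewrite (_ : 2^-1 = rc 2^-1); last by rewrite fmorphV rmorph_nat.
  by rewrite nm_real ger0_norm.
rewrite mulrAC; apply: (@le_trans _ _ (c * (omega c k)^-1)); last exact: c_omegaV.
by rewrite ler_piMr ?invf_le1 ?ler1n // mulr_ge0 ?invr_ge0 ?omega_ge0 // ltW.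
Qed.

Lemma nm_qmult k : nm (qmult k) <= 1.
Proof.
rewrite /qmult [rc _ * (_ * _)]mulrA nmM [X in _ * X]nmM nm_cis mulr1.
have -> : nm (4^-1 : R[i]) = 4^-1.
  rewrite (_ : 4^-1 = rc 4^-1); last by rewrite fmorphV rmorph_nat.
  by rewrite nm_real ger0_norm.
apply: (@le_trans _ _ (1 * 1)); last by rewrite mulr1.
by apply: ler_pM => //; [exact: nm_ge0|rewrite invf_le1 ?ler1n|exact: nm_sq_omV].
Qed.

Lemma step_coefE a k : step_coef c tau a k = cis (tau * omega c k) * a k
  + lmult k * cint `[0, tau] (fun s => lin_integrand c a s k)
  + qmult k * cint `[0, tau] (fun s => quad_integrand c a s k).
Proof.
rewrite /step_coef /lmult /qmult; set I := cint _ _; set J := cint _ _.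
by rewrite !mulrA.
Qed.

Lemma tfam_lin_integrand a : S2 a -> tfam `[0, tau] (lin_integrand c a).
Proof.
by move=> sa; have [] := rept_lin_integrand c0 tau0 (rep_Fs (S2_csummable sa)) sa.
Qed.

Lemma tfam_quad_integrand a : S2 a -> tfam `[0, tau] (quad_integrand c a).
Proof.
by move=> sa; have [] := rept_quad_integrand c0 tau0 (rep_Fs (S2_csummable sa)) sa.
Qed.

(** The multipliers in front of the two integrals are bounded, so only the
    integrands have to be compared. *)
Lemma lp_step_diff p (x y q : int -> R[i]) (Y Y' X X' : R -> int -> R[i]) KX KY :
  (forall k, cinteg `[0, tau] (Y ^~ k)) -> (forall k, cinteg `[0, tau] (Y' ^~ k)) ->
  (forall k, cinteg `[0, tau] (X ^~ k)) -> (forall k, cinteg `[0, tau] (X' ^~ k)) ->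
  0 <= KY -> 0 <= KX ->
  (forall s, 0 <= s <= tau -> lp p (fun k => Y' s k - Y s k) KY) ->
  (forall s, 0 <= s <= tau -> lp p (fun k => X' s k - X s k) KX) ->
  (forall k, x k = q k + lmult k * cint `[0, tau] (Y ^~ k)
                       + qmult k * cint `[0, tau] (X ^~ k)) ->
  (forall k, y k = q k + lmult k * cint `[0, tau] (Y' ^~ k)
                       + qmult k * cint `[0, tau] (X' ^~ k)) ->
  lp p (fun k => y k - x k) (tau * ((1 + c) * KY + KX)).
Proof.
move=> iY iY' iX iX' KY0 KX0 hY hX ex ey.
have mD : measurable (`[0, tau]%classic : set R) by exact: measurable_itv.
have muD := mu_itv_lty 0 tau.
have D_ s : `[0, tau]%classic s -> 0 <= s <= tau by rewrite /= in_itv.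
have h1 : lp p (fun k => cint `[0, tau] (fun s => Y' s k - Y s k)) (KY * tau).
  rewrite -{2}(mu_tau tau0); apply: lp_cint => //.
    by move=> k; exact: (cintegB mD (iY' k) (iY k)).
  by apply: ae_all => s /D_; exact: hY.
have h2 : lp p (fun k => cint `[0, tau] (fun s => X' s k - X s k)) (KX * tau).
  rewrite -{2}(mu_tau tau0); apply: lp_cint => //.
    by move=> k; exact: (cintegB mD (iX' k) (iX k)).
  by apply: ae_all => s /D_; exact: hX.
have c1 : 0 <= 1 + c by rewrite addr_ge0 // ltW.
have := lpD (lpM c1 nm_lmult h1) (lpM1 nm_qmult h2).
rewrite (_ : (1 + c) * (KY * tau) + KX * tau = tau * ((1 + c) * KY + KX)); last by ring.
apply: eq_lp => k; rewrite ex ey.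
rewrite (cintB mD (iY' k) (iY k)) (cintB mD (iX' k) (iX k)).
move: (cint _ (Y ^~ k)) (cint _ (Y' ^~ k)) (cint _ (X ^~ k)) (cint _ (X' ^~ k)).
by move=> u u' v v'; ring.
Qed.

End Multipliers.

Section Stability.
Context {R : realType}.
Local Notation rc := (real_complex R).
Variables (p : bool) (c L : R).
Hypotheses (c0 : 0 < c) (L0 : 0 <= L).

(** The parameters with respect to which the constants must be uniform. *)
Record stab_data := StabData {
  st_a : int -> R[i]; st_b : int -> R[i]; st_d : R; st_s : R;
  st_aL : lp false st_a L; st_bL : lp false st_b L;
  st_ab : lp p (fun k => st_b k - st_a k) st_d; st_s01 : 0 <= st_s <= 1 }.

Let near0 : near_by p st_d st_a st_b.
Proof.
split; [exists L|exists L|exists 1]; split => // -[a b d s ha hb hd hs] /=.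
- by rewrite mulr1.
- by rewrite mulr1.
- by rewrite mul1r.
Qed.

(** The difference is carried isometrically by the linear flow, and the integrands
    are Lipschitz by [near_by]. *)
Lemma step_coef_stable : exists C, 0 <= C /\ forall tau a b d, 0 < tau -> tau <= 1 ->
  S2 a -> S2 b -> lp false a L -> lp false b L -> lp p (fun k => b k - a k) d ->
  lp p (fun k => step_coef c tau b k - step_coef c tau a k) ((1 + C * tau) * d).
Proof.
have [_ _ [CY [CY0 hY]]] := near_lin_integrand c0 st_s01 near0.
have [_ _ [CX [CX0 hX]]] := near_quad_integrand c0 st_s01 near0.
have c1 : 0 <= 1 + c by rewrite addr_ge0 // ltW.
exists ((1 + c) * CY + CX); split; first by rewrite addr_ge0 // mulr_ge0.
move=> tau a b d tau0 tau1 Sa Sb ha hb hd; have d0 := lp_ge0 hd.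
have mD : measurable (`[0, tau]%classic : set R) by exact: measurable_itv.
have muD := mu_itv_lty 0 tau.
have i_ B : tfam `[0, tau] B -> forall k, cinteg `[0, tau] (B ^~ k).
  by move=> tB; exact: (tfam_cinteg mD muD tB).
have st s : 0 <= s <= tau -> 0 <= s <= 1.
  by move=> /andP[-> h]; rewrite (le_trans h).
pose x k : R[i] := lmult c tau k * cint `[0, tau] (fun s => lin_integrand c a s k)
  + qmult c tau k * cint `[0, tau] (fun s => quad_integrand c a s k).
pose y k : R[i] := lmult c tau k * cint `[0, tau] (fun s => lin_integrand c b s k)
  + qmult c tau k * cint `[0, tau] (fun s => quad_integrand c b s k).
have h1 : lp p (fun k => cis (tau * omega c k) * (b k - a k)) d.
  by apply: lpM1 hd => k; rewrite nm_cis.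
have h2 : lp p (fun k => y k - x k) (tau * ((1 + c) * (CY * d) + CX * d)).
  apply: (lp_step_diff c0 tau0 (q := fun=> 0) (i_ _ (tfam_lin_integrand c0 tau0 Sa))
    (i_ _ (tfam_lin_integrand c0 tau0 Sb)) (i_ _ (tfam_quad_integrand c0 tau0 Sa)) (i_ _ (tfam_quad_integrand c0 tau0 Sb))).
  - exact: mulr_ge0.
  - exact: mulr_ge0.
  - by move=> s /st hs; exact: (hY (StabData ha hb hd hs)).
  - by move=> s /st hs; exact: (hX (StabData ha hb hd hs)).
  - by move=> k; rewrite add0r.
  - by move=> k; rewrite add0r.
have := lpD h1 h2.
rewrite (_ : d + _ = (1 + ((1 + c) * CY + CX) * tau) * d); last by ring.
have ea k : step_coef c tau a k = cis (tau * omega c k) * a k + x k.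
  by rewrite step_coefE -addrA.
have eb k : step_coef c tau b k = cis (tau * omega c k) * b k + y k.
  by rewrite step_coefE -addrA.
apply: eq_lp => k; rewrite ea eb; move: (x k) (y k) => xk yk.
by rewrite mulrBr addrACA -opprD.
Qed.

End Stability.

(** * The solution over one step *)

Section MildSolution.
Context {R : realType}.
Local Notation mu := (@lebesgue_measure R).
Local Notation rc := (real_complex R).
Local Notation sq := (@sq R).
Variables (c T K : R).
Hypothesis c0 : 0 < c.

(** What the local error analysis uses of the exact solution. *)
Record mild (U : R -> int -> R[i]) : Prop := Mild {
  mild_bd : forall t, 0 <= t <= T -> lp true (wt 3 (U t)) K;
  mild_meas : forall k, cmeas `[0, T] (U ^~ k);
  mild_duh : forall t s k, 0 <= t -> 0 <= s -> t + s <= T ->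
    U (t + s) k = cis (s * omega c k) * U t k
      - 'i * 4^-1 * cint `[0, s] (fun r => cis ((s - r) * omega c k) *
                                           nlw c (U (t + r)) k) }.

(** A time t on a solution and a time increment s: the parameters with respect to
    which the expansions in s are uniform. *)
Record spot := Spot {
  pU : R -> int -> R[i]; pt : R; ps : R;
  p_mild : mild pU; pt0 : 0 <= pt; ps01 : 0 <= ps <= 1; psT : pt + ps <= T }.

Implicit Types (i : spot).

Lemma ps0 i : 0 <= ps i. Proof. by case: i => ? ? ? ? ? /= /andP[]. Qed.
Lemma ps1 i : ps i <= 1. Proof. by case: i => ? ? ? ? ? /= /andP[]. Qed.

Lemma pt_s_in i r : 0 <= r <= ps i -> 0 <= pt i + r <= T.
Proof.
move=> /andP[r0 rs]; rewrite addr_ge0 ?pt0 //=.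
by apply: le_trans (psT i); rewrite lerD2l.
Qed.

Lemma pt_in i : 0 <= pt i <= T.
Proof. by have := @pt_s_in i 0; rewrite addr0 lexx ps0; exact. Qed.

Lemma spot_at_proof i r : 0 <= r <= ps i -> 0 <= r <= 1 /\ pt i + r <= T.
Proof.
move=> h; have /andP[_ ->] := pt_s_in h; move: h => /andP[-> h].
by rewrite (le_trans h) ?ps1.
Qed.

(** The Duhamel integral evaluates the solution at intermediate times, where the
    estimates for a shorter increment apply. *)
Definition spot_at i r (h : 0 <= r <= ps i) : spot :=
  Spot (p_mild i) (pt0 i) (proj1 (spot_at_proof h)) (proj2 (spot_at_proof h)).

Definition ubase i : int -> R[i] := pU i (pt i).
Definition unext i : int -> R[i] := pU i (pt i + ps i).
(** The solution seen in the frame of the free Schroedinger flow. *)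
Definition vnext i : int -> R[i] := ex (ps i) (unext i).
Definition vincr i : int -> R[i] := fun k => vnext i k - ubase i k.
Definition Pbase i : int -> R[i] := P_coef c (ubase i).
Definition vrem i : int -> R[i] := fun k => vincr i k - 'i * rc (ps i) * Pbase i k.

Definition nlwK : R := 2 * (1 + c) * (2 * K) + 2 ^+ 3 * (4 * (2 * K) * (2 * K)).

Lemma K_ge0 i : 0 <= K.
Proof. by have := mild_bd (p_mild i) (pt_in i); exact: lp_ge0. Qed.

Lemma ubase_bd : uO true (fun=> 1) (fun i => wt 3 (ubase i)).
Proof.
exists `|K|; split => // i; rewrite mulr1.
by apply: lpW (ler_norm K) _; apply: mild_bd (p_mild i) _ _; exact: pt_in.
Qed.

Lemma unext_bd : uO true (fun=> 1) (fun i => wt 3 (unext i)).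
Proof.
exists `|K|; split => // i; rewrite mulr1.
apply: lpW (ler_norm K) _; apply: mild_bd (p_mild i) _ _; apply: pt_s_in.
by rewrite ps0 lexx.
Qed.

Lemma uO_nlw (F : spot -> int -> R[i]) : uO true (fun=> 1) (fun i => wt 3 (F i)) ->
  uO true (fun=> 1) (fun i => wt 3 (nlw c (F i))).
Proof.
move=> [C [C0 H]].
exists (2 * (1 + c) * (2 * C) + 2 ^+ 3 * (4 * (2 * C) * (2 * C))); split.
  by rewrite addr_ge0 // !mulr_ge0 // addr_ge0 // ltW.
by move=> i; rewrite mulr1; apply: lp_wt_nlw => //; have := H i; rewrite mulr1.
Qed.

Lemma tfam_mild U : mild U -> tfam `[0, T] U.
Proof.
move=> hU; split; first exact: mild_meas hU.
exists (2 * K) => t; rewrite /= in_itv /= => /(mild_bd hU) /l2_l1 h; exact: h.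
Qed.

Lemma cmeas_mild_nlw U k : mild U -> cmeas `[0, T] (fun t => nlw c (U t) k).
Proof.
move=> /tfam_mild tU; have tH : tfam `[0, T] (fun t => twice_re (U t)).
  by apply: tfamD => //; exact: tfam_cj.
have [mH _] := tH; have [mC _] := tfam_convol tH tH.
apply: cmeasM; first exact: cmeas_cst.
by apply: cmeasD; apply: cmeasM; [exact: cmeas_cst|exact: mH|exact: cmeas_cst|exact: mC].
Qed.

Lemma cmeas_shift0 (f : R -> R[i]) (t s : R) : 0 <= t -> t + s <= T ->
  cmeas `[0, T] f -> cmeas `[0, s] (fun r => f (t + r)).
Proof.
move=> t0 ts [m1 m2].
have sub : `[0, s]%classic `<=` (fun r => t + r) @^-1` `[0, T]%classic.
  move=> r; rewrite /= !in_itv /= => /andP[r0 rs].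
  by rewrite addr_ge0 //= (le_trans _ ts) // lerD2l.
have m_ : measurable_fun (`[0, s]%classic : set R) (fun r : R => t + r).
  by apply: measurable_funD => //; exact: measurable_cst.
have sub' : (fun r => t + r) @` `[0, s]%classic `<=` `[0, T]%classic.
  by move=> _ [r /sub h <-].
by split; [apply: (measurable_comp _ sub' m1)|apply: (measurable_comp _ sub' m2)].
Qed.

Section OnePoint.
Variable i : spot.
Local Notation s := (ps i).
Local Notation D := (`[0, s]%classic : set R).
Local Notation N r := (nlw c (pU i (pt i + r))).

Let mD : measurable D. Proof. exact: measurable_itv. Qed.
Let muD : (mu D < +oo)%E. Proof. exact: mu_itv_lty. Qed.

Lemma N_bd r : D r -> lp true (wt 3 (N r)) nlwK.
Proof.
rewrite /= in_itv /= => h; apply: lp_wt_nlw => //.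
exact: mild_bd (p_mild i) _ (pt_s_in h).
Qed.

Let mN k : cmeas D (fun r => N r k).
Proof.
apply: (@cmeas_shift0 (fun t => nlw c (pU i t) k)); [exact: pt0|exact: psT|].
exact: cmeas_mild_nlw (p_mild i).
Qed.

Lemma intN (f : R -> R) k : measurable_fun D f ->
  cinteg D (fun r => cis (f r) * N r k).
Proof.
move=> mf; apply: (bounded_cinteg (K := nlwK) mD muD).
  by apply: cmeasM => //; exact: cmeas_cis.
by move=> r /N_bd h; rewrite nmM nm_cis mul1r; exact: (lp_sup k (lp_wt0 h)).
Qed.

Definition phase k r : R := (s - r) * asym c k - r * sq k.

Lemma m_phase k : measurable_fun D (phase k).
Proof.
apply: measurable_funB; apply: measurable_funM => //; try exact: measurable_cst.
by apply: measurable_funB => //; exact: measurable_cst.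
Qed.

(** In this frame the linear flow has the bounded phase s A, and the integrand the
    phase (s - r) A - r k^2. *)
Lemma vnextE k : vnext i k = cis (s * asym c k) * ubase i k
  - 'i * 4^-1 * cint D (fun r => cis (phase k r) * N r k).
Proof.
rewrite /vnext /ex /unext (mild_duh (p_mild i)) ?pt0 ?ps0 ?psT //.
rewrite mulrBr mulrA -cisD; congr (cis _ * _ - _).
  by rewrite /asym; ring.
rewrite mulrCA; congr (_ * _).
rewrite -cintZ //; last first.
  apply: intN; apply: measurable_funM => //.
  by apply: measurable_funB => //; exact: measurable_cst.
apply: eq_cint => r _; rewrite mulrA -cisD; congr (cis _ * _).
by rewrite /phase /asym; ring.
Qed.

End OnePoint.

Lemma cint_cst (s : R) (z : R[i]) : 0 <= s -> cint `[0, s] (fun=> z) = rc s * z.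
Proof.
move=> s_ge0; have mD : measurable (`[0, s]%classic : set R) by exact: measurable_itv.
have E (x : R) : \int[mu]_(_ in `[0, s]) x = x * s.
  by rewrite Rintegral_cst //= mu_itv // subr0.
apply/complex_eq; rewrite /cint /= !E.
  by rewrite cReM /= mul0r subr0 mulrC.
by rewrite cImM /= mul0r addr0 mulrC.
Qed.

Lemma nm_i4 : nm ('i * 4^-1 : R[i]) <= 1.
Proof.
rewrite -complexiE nmM nmi mul1r.
have -> : (4^-1 : R[i]) = rc 4^-1 by rewrite fmorphV rmorph_nat.
by rewrite nm_real ger0_norm ?invr_ge0 // invf_le1 // ler1n.
Qed.

Lemma nm_asym_phase i k : nm (cis (ps i * asym c k) - 1) <= (1 + c) * ps i.
Proof.
apply: (le_trans (nm_cisB1_le _)); rewrite normrM ger0_norm ?ps0 // mulrC.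
by rewrite ger0_norm ?asym_ge0 // ler_wpM2r ?ps0 ?asym_le.
Qed.

(** No derivative is lost, as the symbol of A is bounded and the nonlinearity maps
    H^3 to itself. *)
Lemma vincr_bd : uO true ps (fun i => wt 3 (vincr i)).
Proof.
have c1 : 0 <= 1 + c by rewrite addr_ge0 // ltW.
exists ((1 + c) * `|K| + `|nlwK|); split=> [|i]; first by rewrite addr_ge0 // mulr_ge0.
have ha : lp true (wt 3 (ubase i)) `|K|.
  by apply: lpW (ler_norm K) _; apply: mild_bd (p_mild i) _ (pt_in i).
have k0 : 0 <= nlwK.
  by have k0 := K_ge0 i; rewrite /nlwK addr_ge0 // !mulr_ge0 //.
pose I k := cint `[0, ps i] (fun r => cis (phase i k r) * nlw c (pU i (pt i + r)) k).
have mD : measurable (`[0, ps i]%classic : set R) by exact: measurable_itv.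
have hI : lp true (wt 3 I) (`|nlwK| * ps i).
  rewrite (ger0_norm k0).
  apply: (eq_lp (a := fun k => cint `[0, ps i] (fun r => rc (W k ^+ 3) *
     (cis (phase i k r) * nlw c (pU i (pt i + r)) k)))).
    by move=> k; rewrite (cintZ mD _ (intN k (m_phase k))).
  rewrite -{2}[ps i](_ : fine (mu `[0, ps i]) = _); last by rewrite mu_itv ?ps0 // subr0.
  apply: (lp_cint mD (mu_itv_lty 0 (ps i)) k0).
    by move=> k; apply: (cintegZ mD); exact: (intN k (m_phase k)).
  apply: ae_all => r /N_bd; apply: le_lp1 => k.
  by rewrite mulrCA nmM nm_cis mul1r.
rewrite mulrDl [_ * _ * ps i]mulrAC.
have c2 : 0 <= (1 + c) * ps i by rewrite mulr_ge0 // ps0.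
have h1 : lp true (wt 3 (fun k => (cis (ps i * asym c k) - 1) * ubase i k))
    ((1 + c) * ps i * `|K|).
  apply: (le_lp_wt c2) ha => k; rewrite nmM ler_wpM2r ?nm_ge0 //.
  exact: nm_asym_phase.
apply: le_lpD_wt h1 hI => k; rewrite /vincr vnextE -/(I k).
rewrite (_ : _ - _ = (cis (ps i * asym c k) - 1) * ubase i k - 'i * 4^-1 * I k).
  apply: (le_trans (nmB _ _)); rewrite lerD2l nmM ler_piMl ?nm_ge0 //.
  exact: nm_i4.
by move: (ubase i k) (I k) ('i * 4^-1 : R[i]) => x y z; ring.
Qed.

Lemma vnext_bd : uO true (fun=> 1) (fun i => wt 3 (vnext i)).
Proof.
have [C [C0 H]] := unext_bd; exists C; split => // i.
by apply: le_lp1 (H i) => k; rewrite !nm_wt nm_ex.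
Qed.

(** Out of the moving frame, an increment O(s) costs two derivatives. *)
Lemma near_unext p : near_by p ps ubase unext.
Proof.
split; [exact: uO_wt0 ubase_bd|exact: uO_wt0 unext_bd|].
have [C [C0 H]] := uO_wt p (leqnn 2) ubase_bd.
have [D [D0 H']] := uO_wt0 p vincr_bd.
exists (D + C); split=> [|i]; first exact: addr_ge0.
have := lp_ex (- ps i) (H' i) => h1.
have h2 : lp p (fun k => (cis (ps i * sq k) - 1) * ubase i k) (ps i * (C * 1)).
  apply: (le_lp (ps0 i) _ (H i)) => k; rewrite nm_wt nmM.
  rewrite mulrA ler_wpM2r ?nm_ge0 //; apply: (le_trans (nm_cisB1_le _)).
  rewrite normrM !ger0_norm ?ps0 ?sq_ge0 //.
  by rewrite ler_wpM2l ?ps0 // sq_le_W.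
have := lpD h1 h2; rewrite (_ : D * _ + _ = (D + C) * ps i); last by ring.
apply: eq_lp => k; rewrite /vincr /vnext /ex mulrBr mulrA -cisD.
rewrite (_ : _ + - (ps i * sq k) = 0); last by ring.
rewrite cis0 mul1r (_ : - (- ps i * sq k) = ps i * sq k); last by ring.
by ring.
Qed.

(** Second-order expansion: in the Duhamel integral the phase is 1 + O(s k^2), and
    the nonlinearity varies by O(s) because it is Lipschitz. *)
Lemma vrem_bd p : uO p (fun i => ps i ^+ 2) vrem.
Proof.
have [C1 [C10 H1]] := uO_wt p (leqnn 2) (uO_nlw unext_bd).
have [_ _ [C2 [C20 H2]]] := near_nlw c0 (near_unext p).
have [C3 [C30 H3]] := uO_wt0 p ubase_bd.
have c1 : 0 <= 1 + c by rewrite addr_ge0 // ltW.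
have c2 : 0 <= 2 + c by rewrite addr_ge0 // ltW.
exists (2 * (1 + c) ^+ 2 * C3 + ((2 + c) * C1 + C2)); split=> [|i].
  by rewrite !addr_ge0 ?mulr_ge0 ?sqr_ge0.
have mD : measurable (`[0, ps i]%classic : set R) by exact: measurable_itv.
have muD := mu_itv_lty 0 (ps i).
pose x k r := cis (phase i k r) * nlw c (pU i (pt i + r)) k - nlw c (ubase i) k.
have icst k : cinteg `[0, ps i] (fun=> nlw c (ubase i) k).
  by apply: (bounded_cinteg (K := nm (nlw c (ubase i) k)) mD muD) => //; exact: cmeas_cst.
have hI : lp p (fun k => cint `[0, ps i] (x k)) (((2 + c) * C1 + C2) * ps i * ps i).
  rewrite -{3}[ps i](_ : fine (mu `[0, ps i]) = _); last by rewrite mu_itv ?ps0 // subr0.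
  apply: (lp_cint mD muD).
  - by rewrite mulr_ge0 ?ps0 // addr_ge0 // mulr_ge0.
  - by move=> k; apply: (cintegB mD) => //; exact: (intN k (m_phase k)).
  apply: ae_all => r; rewrite /= in_itv /= => hr; have /andP[r0 rs] := hr.
  have h1 := H1 (spot_at hr); have h2 := H2 (spot_at hr).
  rewrite mulrDl; apply: (le_lpD (a := fun k => rc ((2 + c) * ps i) *
    wt 2 (nlw c (pU i (pt i + r))) k) (b := fun k => nlw c (pU i (pt i + r)) k -
    nlw c (ubase i) k)) => [k||].
  - rewrite /x; set n := nlw _ _ k; set n0 := nlw _ _ k.
    rewrite (_ : _ - _ = (cis (phase i k r) - 1) * n + (n - n0)); last by ring.
    apply: (le_trans (nmD _ _)); rewrite lerD2r nmM [leRHS]nmM nm_wt mulrA.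
    apply: ler_wpM2r; first exact: nm_ge0.
    rewrite nm_real ger0_norm ?mulr_ge0 ?ps0 //.
    apply: (le_trans (nm_cisB1_le _)); rewrite /phase.
    apply: (le_trans (ler_normB _ _)); rewrite [ `|(ps i - r) * _| ]normrM [ `|r * _| ]normrM.
    rewrite [ `|asym c k| ]ger0_norm ?asym_ge0 // [ `|sq k| ]ger0_norm ?sq_ge0 //.
    rewrite [ `|r| ]ger0_norm // [ `|ps i - r| ]ger0_norm ?subr_ge0 //.
    have w1 : 1 <= (W k : R) ^+ 2 by rewrite exprn_ege1 // W_ge1.
    apply: (@le_trans _ _ (ps i * ((1 + c) * W k ^+ 2) + ps i * W k ^+ 2)).
      apply: lerD.
        apply: ler_pM; rewrite ?subr_ge0 ?asym_ge0 // ?lerBlDr ?lerDl //.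
        by apply: (le_trans (asym_le k c0)); rewrite ler_peMr.
      by apply: ler_pM; rewrite ?sq_ge0 ?sq_le_W.
    by rewrite le_eqVlt; apply/orP; left; apply/eqP; ring.
  - have := lpZ (rc ((2 + c) * ps i)) h1.
    rewrite nm_real ger0_norm ?mulr_ge0 ?ps0 //.
    by rewrite (_ : _ * (C1 * 1) = (2 + c) * C1 * ps i); [exact|ring].
  - by apply: lpW h2; rewrite ler_wpM2l.
have h1 : lp p (fun k => (cis (ps i * asym c k) - 1 - 'i * rc (ps i * asym c k)) * ubase i k)
    (2 * (1 + c) ^+ 2 * ps i ^+ 2 * (C3 * 1)).
  apply: lpM (H3 i); first by apply: mulr_ge0 (mulr_ge0 _ (sqr_ge0 _)) (sqr_ge0 _).
  move=> k; apply: (le_trans (nm_cis_taylor2 _)); rewrite -mulrA ler_pM2l //.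
  rewrite -exprMn ler_pXn2r ?nnegrE ?mulr_ge0 ?ps0 ?asym_ge0 //.
  by rewrite mulrC ler_wpM2r ?ps0 ?asym_le.
rewrite (_ : _ * ps i ^+ 2 = 2 * (1 + c) ^+ 2 * ps i ^+ 2 * (C3 * 1) +
  ((2 + c) * C1 + C2) * ps i * ps i); last by ring.
apply: le_lpD h1 hI => k; rewrite /vrem /vincr vnextE.
have E : cint `[0, ps i] (x k) = cint `[0, ps i] (fun r => cis (phase i k r) *
    nlw c (pU i (pt i + r)) k) - rc (ps i) * nlw c (ubase i) k.
  rewrite /x cintB //; last exact: (intN k (m_phase k)).
  by rewrite cint_cst ?ps0.
set J := cint _ (fun r => cis _ * _) in E *.
have -> : J = cint `[0, ps i] (x k) + rc (ps i) * nlw c (ubase i) k by rewrite E subrK.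
move: (cint _ (x k)) => X.
rewrite /Pbase /P_coef -/(nlw c (ubase i) k).
set y := nlw c (ubase i) k; set z := ubase i k.
have -> : rc (ps i * asym c k) = rc (ps i) * rc (asym c k) by rewrite -rmorphM.
move: (rc (asym c k)) (rc (ps i)) (cis _) y z => A s E' y z.
rewrite (_ : _ - _ = (E' - 1 - 'i * (s * A)) * z - 'i * 4^-1 * X); last by ring.
apply: (le_trans (nmB _ _)); rewrite lerD2l nmM ler_piMl ?nm_ge0 //.
exact: nm_i4.
Qed.

End MildSolution.

(** * Resonant phases *)

Section ResonanceKernels.
Context {R : realType}.
Local Notation rc := (real_complex R).
Local Notation sq := (@sq R).
Implicit Types (x y : int -> R[i]) (s : R).

Let nm_res s j k : 0 <= s ->
  nm (cis (2 * s * (j%:~R * (k - j)%:~R)) - 1) <= 2 * s * (W j * W (k - j)).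
Proof.
move=> s0; apply: (le_trans (nm_cisB1_le _)).
rewrite normrM ger0_norm ?mulr_ge0 // ler_wpM2l ?mulr_ge0 //.
by rewrite normrM ler_pM // W_le_abs.
Qed.

Let bil_phase s j k : s * sq j + s * sq (k - j) + s * sq k =
  - (2 * s * (j%:~R * (k - j)%:~R)) + 2 * s * sq k.
Proof.
have h := @sq_resonance R k j.
have -> : 2 * s * (j%:~R * (k - j)%:~R) = s * (2 * (j%:~R * (k - j)%:~R)) by ring.
by rewrite -h; ring.
Qed.

Let nm_cis1 (t : R) : nm (cis t) <= 1.
Proof. by rewrite nm_cis. Qed.

(** Freezing the resonant phase costs one power of s and one derivative per factor. *)
Lemma lp_freeze p s x y X Y : 0 <= s -> csummable x ->
  lp p (wt 1 x) X -> lp false (wt 1 y) Y ->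
  lp p (fun k => bil s s s x y k - bil 0 0 (2 * s) x y k) (2 * s * X * Y).
Proof.
move=> s0 sx hx hy.
have sy := lp_csummable (lp_wt0 hy).
pose th k j : R[i] :=
  cis (- (2 * s * sq k)) * (cis (2 * s * (j%:~R * (k - j)%:~R)) - 1).
have [|_] := @young R p (fun k j => th k j * (x j * y (k - j)))
   (fun k => rc (2 * s) * wt 1 x k) (wt 1 y) (fun=> 0) (fun=> 0) _ _ 0 0
   _ (lpZ _ hx) hy (lp0 _) (lp0 _).
  move=> k j; rewrite nm0 mul0r addr0 !nmM nm_cis mul1r nm_real ger0_norm ?mulr_ge0 //.
  rewrite -!/(wt 1 _ _) !nm_real !ger0_norm ?W_exp_ge0 // !expr1.
  apply: (@le_trans _ _ (2 * s * (W j * W (k - j)) * (nm (x j) * nm (y (k - j))))).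
    by rewrite ler_wpM2r ?mulr_ge0 ?nm_ge0 // nm_res.
  by rewrite le_eqVlt; apply/orP; left; apply/eqP; ring.
rewrite mulr0 addr0 nm_real ger0_norm ?mulr_ge0 //; apply: eq_lp => k.
rewrite !bilE // -csumB; last 2 first.
- by apply: bil_theta_summ => // j; exact: nm_cis1.
- by apply: bil_theta_summ => // j; exact: nm_cis1.
apply: eq_csum => j; rewrite -mulrBl /th bil_phase opprD opprK !mul0r !add0r.
by rewrite [in RHS]addrC cisD; congr (_ * _); ring.
Qed.

(** The discrepancy between the product of the two conjugate factors and its
    explicitly integrable replacement has kernel (e^(i a) - 1) (e^(i b) - 1) with
    a = -2 s k^2 and b = 2 s j (k - j). *)
Definition gap s x y k : R[i] := bil s s s x y k - bil s s (- s) x y k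
  - bil 0 0 (2 * s) x y k + bil 0 0 0 x y k.

Let gth s k j : R[i] := (cis (- (2 * s * sq k)) - 1) *
  (cis (2 * s * (j%:~R * (k - j)%:~R)) - 1).

Let gapE s x y k : csummable x -> csummable y ->
  gap s x y k = csum (fun j => gth s k j * (x j * y (k - j))).
Proof.
move=> sx sy; rewrite /gap !bilE //.
have S th : (forall j : int, nm (th j) <= 1) ->
    csummable (fun j => th j * (x j * y (k - j))).
  by move=> h; exact: bil_theta_summ h.
rewrite -csumB; [|by apply: S => j; exact: nm_cis1..].
rewrite -csumB; last 2 first.
- by apply: csummableB; apply: S => j; exact: nm_cis1.
- by apply: S => j; exact: nm_cis1.
rewrite -csumD; last 2 first.
- by apply: csummableB; [apply: csummableB|]; apply: S => j; exact: nm_cis1.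
- by apply: S => j; exact: nm_cis1.
apply: eq_csum => j; rewrite !mul0r !add0r oppr0 cis0 mulNr.
have -> : s * sq j + s * sq (k - j) - s * sq k = - (2 * s * (j%:~R * (k - j)%:~R)).
  have h := bil_phase s j k.
  by apply: (addIr (2 * s * sq k)); rewrite -h; ring.
rewrite bil_phase opprD !opprK cisD /gth.
by ring.
Qed.

(** Both factors of the kernel are used at first order; k^2 is split between j and
    k - j, so that three weights fall on one factor and one on the other. *)
Lemma lp_gap2 s x y X Y : 0 <= s -> lp true (wt 3 x) X -> lp true (wt 3 y) Y ->
  lp true (gap s x y) (32 * s ^+ 2 * (2 * X * Y)).
Proof.
move=> s0 hx hy.
have hx1 := lp_wt_le (leqnSn 1) (l2_l1 hx).
have hy1 := lp_wt_le (leqnSn 1) (l2_l1 hy).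
have sx := lp_csummable (lp_wt0 hx1); have sy := lp_csummable (lp_wt0 hy1).
have [|_] := @young R true (fun k j => gth s k j * (x j * y (k - j)))
   (fun k => rc (16 * s ^+ 2) * wt 3 x k) (wt 1 y)
   (wt 1 x) (fun k => rc (16 * s ^+ 2) * wt 3 y k) _ _ _ _
   _ (lpZ _ hx) hy1 hx1 (lpZ _ hy).
  move=> k j; rewrite !nmM -!/(wt _ _ _).
  have S0 : 0 <= 16 * s ^+ 2 by rewrite mulr_ge0 // sqr_ge0.
  rewrite !nm_real !ger0_norm ?W_exp_ge0 //.
  set a := nm (x j); set b := nm (y (k - j)).
  have ab0 : 0 <= a * b by rewrite mulr_ge0 ?nm_ge0.
  have h1 : nm (cis (- (2 * s * sq k)) - 1) <= 2 * s * (4 * (W j ^+ 2 + W (k - j) ^+ 2)).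
    apply: (le_trans (nm_cisB1_le _)); rewrite normrN ger0_norm; last first.
      by apply: mulr_ge0 (mulr_ge0 _ s0) (sq_ge0 _).
    rewrite ler_wpM2l ?mulr_ge0 //; apply: (le_trans (sq_le_W k)).
    by have := @W_expD R 2 k j; have -> : (2 : R) ^+ 2 = 4 by ring.
  apply: (@le_trans _ _ (2 * s * (4 * (W j ^+ 2 + W (k - j) ^+ 2)) *
     (2 * s * (W j * W (k - j))) * (a * b))).
    rewrite ler_wpM2r //; apply: ler_pM; rewrite ?nm_ge0 //.
    exact: nm_res.
  by rewrite !expr1 le_eqVlt; apply/orP; left; apply/eqP; ring.
rewrite nm_real ger0_norm ?mulr_ge0 ?sqr_ge0 //.
rewrite (_ : _ + _ = 32 * s ^+ 2 * (2 * X * Y)); last by ring.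
by apply: eq_lp => k; rewrite gapE.
Qed.

(** Three weights in l1 exceed the regularity of the solution, so the factor with
    the phase a is only bounded by 2. *)
Lemma lp_gap1 s x y X Y : 0 <= s -> lp false (wt 1 x) X -> lp false (wt 1 y) Y ->
  lp false (gap s x y) (4 * s * X * Y).
Proof.
move=> s0 hx hy.
have sx := lp_csummable (lp_wt0 hx); have sy := lp_csummable (lp_wt0 hy).
have [|_] := @young R false (fun k j => gth s k j * (x j * y (k - j)))
   (fun k => rc (4 * s) * wt 1 x k) (wt 1 y) (fun=> 0) (fun=> 0) _ _ 0 0
   _ (lpZ _ hx) hy (lp0 _) (lp0 _).
  move=> k j; rewrite nm0 mul0r addr0 !nmM -!/(wt _ _ _).
  rewrite !nm_real !ger0_norm ?W_exp_ge0 ?mulr_ge0 // !expr1.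
  set a := nm (x j); set b := nm (y (k - j)).
  have h1 : nm (cis (- (2 * s * sq k)) - 1) <= 2.
    by apply: (le_trans (nmB _ _)); rewrite nm_cis nm1.
  apply: (@le_trans _ _ (2 * (2 * s * (W j * W (k - j))) * (a * b))).
    rewrite ler_wpM2r ?mulr_ge0 ?nm_ge0 //; apply: ler_pM; rewrite ?nm_ge0 //.
    exact: nm_res.
  by rewrite le_eqVlt; apply/orP; left; apply/eqP; ring.
rewrite mulr0 addr0 nm_real ger0_norm ?mulr_ge0 //.
by apply: eq_lp => k; rewrite gapE.
Qed.

End ResonanceKernels.

(** * Errors of the integrands *)

Section LocalAlgebra.
Context {R : realType}.
Implicit Types (i s A E v a d P r : R[i]).

(** The comparison of the linear parts, with E the phase e^(-i s A), a the base point,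
    d the increment and e2 the phase of the conjugate. *)
Lemma lin_alg i s A E e2 a d P ca cd cP :
  E * (a + d) + E * (e2 * (ca + cd)) -
    (a - i * s * (A * a - P) + (e2 * ca - i * s * (e2 * (A * ca + cP)))) =
  (E - 1 + i * (s * A)) * (a + d) + (d - i * s * P) - i * (s * A) * d +
  e2 * ((E - 1 + i * (s * A)) * (ca + cd) + (cd + i * s * cP) - i * (s * A) * cd).
Proof. ring. Qed.

(** The comparison of the quadratic parts. In the names, bN stands for the N-th
    bilinear form and tN for its counterpart in the scheme, followed by the
    arguments: v the moving solution, a the base point, d = v - a the increment,
    r = d - i s P its second-order remainder. *)
Lemma quad_alg i s A E S Q b1vv b1ad b1dd b1ar b2vv b2da b2ad b2dd b2ra b2ar
  b3vv b3aa b3ad b3dd b3aP b3ar t1aa ct1 t2aa t3aa c0 t1aP t2Pa t3aP t2aP :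
  i * i = -1 ->
  b1vv = t1aa + 2 * b1ad + b1dd -> b1ad = i * s * t1aP + b1ar ->
  b2vv = t2aa + b2da + b2ad + b2dd ->
  b2da = i * s * t2Pa + b2ra -> b2ad = - (i * s) * t2aP + b2ar ->
  b3vv = b3aa + 2 * b3ad + b3dd -> b3ad = - (i * s) * b3aP + b3ar ->
  S = b1vv + 2 * b2vv + b3vv -> Q = E * S ->
  - i * Q - (- i * (t1aa + ct1 + 2 * t2aa + t3aa - c0)
    - A * (s * (t1aa + 2 * t2aa + t3aa)) + 2 * (s * (t1aP + t2Pa))
    - 2 * (s * (t3aP + t2aP))) =
  - i * ((E - 1 + i * (s * A)) * S
    + ((2 * b1ar + b1dd) + 2 * (b2ra + b2ar + b2dd) + (2 * b3ar + b3dd))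
    + (b3aa - ct1 - t3aa + c0)
    - 2 * (i * s) * (b3aP - t3aP)
    - i * (s * A) * ((2 * b1ad + b1dd) + 2 * (b2da + b2ad + b2dd)
                     + (2 * b3ad + b3dd) + (b3aa - t3aa))).
Proof.
move=> ii -> -> -> -> -> -> -> -> ->.
have k x : x = - (i * i) * x by rewrite ii opprK mul1r.
rewrite [A * (s * _)]k [2 * (s * (t1aP + t2Pa))]k [2 * (s * (t3aP + t2aP))]k.
by ring.
Qed.

End LocalAlgebra.

Section LocalError.
Context {R : realType}.
Local Notation mu := (@lebesgue_measure R).
Local Notation rc := (real_complex R).
Local Notation sq := (@sq R).
Variables (p : bool) (c T K : R).
Hypothesis c0 : 0 < c.

Local Notation spot := (spot c T K).
Implicit Types (i : spot) (F : spot -> int -> R[i]).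
Local Notation s1 := (fun i : spot => ps i).
Local Notation s2 := (fun i : spot => ps i ^+ 2).
Local Notation one := (fun _ : spot => 1 : R).

Let uOeq (e e' : spot -> R) (F : spot -> int -> R[i]) : (forall i, e i = e' i) -> uO p e F -> uO p e' F.
Proof. by move=> h [C [C0 H]]; exists C; split => // i; rewrite -h. Qed.

Let i_sq : 'i * 'i = -1 :> R[i].
Proof. by rewrite -complexiE -expr2 sqr_i. Qed.

Let nm_isA i k : nm ('i * (rc (ps i) * rc (asym c k))) <= (1 + c) * ps i.
Proof.
rewrite -complexiE nmM nmi mul1r -rmorphM nm_real ger0_norm; last first.
  by rewrite mulr_ge0 ?ps0 ?asym_ge0.
by rewrite mulrC ler_wpM2r ?ps0 ?asym_le.
Qed.

Let c1 : 0 <= 1 + c. Proof. by rewrite addr_ge0 // ltW. Qed.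

Let uO_isA F : uO p s1 F ->
  uO p s2 (fun i k => 'i * (rc (ps i) * rc (asym c k)) * F i k).
Proof.
move=> h; apply: uOeq (uOM (g := s1) c1 (fun i => ps0 i) nm_isA h) => i.
by rewrite expr2.
Qed.

(** The error in approximating e^(-i s A) by 1 - i s A; it is O(s^2) because A is
    bounded. *)
Definition taylor_rest i k : R[i] :=
  cis (- (ps i * asym c k)) - 1 + 'i * (rc (ps i) * rc (asym c k)).

Let nm_taylor_rest i k : nm (taylor_rest i k) <= 2 * (1 + c) ^+ 2 * ps i ^+ 2.
Proof.
have := nm_cis_taylor2 (- (ps i * asym c k)).
rewrite (_ : _ - _ = taylor_rest i k); last first.
  by rewrite /taylor_rest rmorphN rmorphM mulrN opprK.
move=> h; apply: (le_trans h); rewrite sqrrN -mulrA ler_pM2l // -exprMn.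
rewrite ler_pXn2r ?nnegrE ?mulr_ge0 ?ps0 ?asym_ge0 //.
by rewrite mulrC ler_wpM2r ?ps0 ?asym_le.
Qed.

Let uO_taylor_rest F : uO p one F -> uO p s2 (fun i k => taylor_rest i k * F i k).
Proof.
have D0 : 0 <= 2 * (1 + c) ^+ 2 by apply: mulr_ge0 (sqr_ge0 _).
move=> h; apply: uOeq (uOM (g := s2) D0 (fun i => sqr_ge0 _) nm_taylor_rest h) => i.
by rewrite mulr1.
Qed.

Let unext_ex i : unext i = ex (- ps i) (vnext i).
Proof.
apply/funext => k; rewrite /vnext /ex mulrA -cisD.
rewrite (_ : _ + _ = 0); last by ring.
by rewrite cis0 mul1r.
Qed.

Let cj_unext i : cj (unext i) = ex (ps i) (cj (vnext i)).
Proof. by apply/funext => k; rewrite unext_ex cj_ex opprK. Qed.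

Let cj_vrem i k : cj (vrem i) k = cj (vincr i) k + 'i * rc (ps i) * cj (Pbase i) k.
Proof.
rewrite /cj /vrem conjcD conjcN !conjcM conjc_real.
by rewrite [conjc 'i](_ : _ = - 'i); [ring|rewrite /conjc; congr Complex; rewrite oppr0].
Qed.

Let vnext_ad i : vnext i = (fun k => ubase i k + vincr i k).
Proof. by apply/funext => k; rewrite /vincr; ring. Qed.

Let cj_vnext i : cj (vnext i) = (fun k => cj (ubase i) k + cj (vincr i) k).
Proof. by apply/funext => k; rewrite {1}vnext_ad /cj conjcD. Qed.

(** Only bounded multipliers act on the expansion of v, so no order is lost. *)
Lemma lin_error : uO p s2 (fun i k =>
  cis (- (ps i * omega c k)) * twice_re (unext i) k - lin_integrand c (ubase i) (ps i) k).
Proof.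
have hv := uO_wt0 p (vnext_bd c T K).
have hd := uO_wt0 p (vincr_bd T K c0).
have hr := vrem_bd T K c0 p.
have h1 := uOB (uOD (uO_taylor_rest hv) hr) (uO_isA hd).
have h2 := uOB (uOD (uO_taylor_rest (uO_cj hv)) (uO_cj hr)) (uO_isA (uO_cj hd)).
apply: uO_ext (uOD h1 (uO_ex (fun i => 2 * ps i) h2)) => i k.
have /esym := @lin_alg R 'i%R (rc (ps i)) (rc (asym c k)) (cis (- (ps i * asym c k)))
  (cis (- (2 * ps i * sq k))) (ubase i k) (vincr i k) (Pbase i k) (cj (ubase i) k)
  (cj (vincr i) k) (cj (Pbase i) k).
have e1 : cis (- (ps i * omega c k)) * unext i k = cis (- (ps i * asym c k)) * (ubase i k + vincr i k).
  rewrite unext_ex vnext_ad /ex mulrA -cisD; congr (cis _ * _).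
  by rewrite /asym; ring.
have e2 : cis (- (ps i * omega c k)) * cj (unext i) k =
    cis (- (ps i * asym c k)) * (cis (- (2 * ps i * sq k)) * (cj (ubase i) k + cj (vincr i) k)).
  rewrite cj_unext cj_vnext /ex ![cis _ * (cis _ * _)]mulrA -!cisD; congr (cis _ * _).
  by rewrite /asym; ring.
move=> H; rewrite /twice_re [X in _ = X - _]mulrDr e1 e2 /lin_integrand.
rewrite [ex _ (cj (ubase i)) k]/ex [ex _ (fun _ => _ + _) k]/ex.
apply: etrans _ H; cbv beta; rewrite cj_vrem /taylor_rest.
have -> : vnext i k = ubase i k + vincr i k by rewrite {1}vnext_ad.
have -> : cj (vnext i) k = cj (ubase i) k + cj (vincr i) k by rewrite cj_vnext.
by [].
Qed.

Let bl (x y z : spot -> R) e F G : uO p e F -> uO false one G ->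
  uO p e (fun i => bil (x i) (y i) (z i) (F i) (G i)).
Proof. by move=> h h'; apply: uOeq (uO_bill x y z h h') => i; rewrite mulr1. Qed.

Let br (x y z : spot -> R) e F G : uO false one F -> uO p e G ->
  uO p e (fun i => bil (x i) (y i) (z i) (F i) (G i)).
Proof. by move=> h h'; apply: uOeq (uO_bilr x y z h h') => i; rewrite mul1r. Qed.

Let bs (x y z : spot -> R) F G : uO p s1 F -> uO false s1 G ->
  uO p s2 (fun i => bil (x i) (y i) (z i) (F i) (G i)).
Proof. by move=> h h'; apply: uOeq (uO_bill x y z h h') => i; rewrite expr2. Qed.

(** The size of the resonance gap. *)
Definition eps i : R := if p then ps i ^+ 2 else ps i.

Let ps2_le i : ps i ^+ 2 <= ps i.
Proof. by rewrite expr2 ler_piMr ?ps0 ?ps1. Qed.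

Let s2_eps F : uO p s2 F -> uO p eps F.
Proof.
apply: uO_le => i; apply/andP; split; first exact: sqr_ge0.
by rewrite /eps; case: ifP => _; [exact: lexx|exact: ps2_le].

Qed.

Lemma gap_error : uO p eps (fun i => gap (ps i) (cj (ubase i)) (cj (ubase i))).
Proof.
have [C [C0 H]] := uO_wt false (leqnSn 1) (ubase_bd c T K).
have [D [D0 H']] := ubase_bd c T K.
exists (4 * C ^+ 2 + 64 * D ^+ 2); split=> [|i].
  by apply: addr_ge0; apply: mulr_ge0 => //; exact: sqr_ge0.
have h1 := lp_wt_cj (H i); have h2 := lp_wt_cj (H' i).
rewrite /eps; case: ifP => _.
  apply: lpW (lp_gap2 (ps0 i) h2 h2).
  rewrite [leRHS]mulrDl [leLHS](_ : _ = 64 * D ^+ 2 * ps i ^+ 2); last by ring.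
  by rewrite lerDr; apply: mulr_ge0 (mulr_ge0 _ _) _ => //; exact: sqr_ge0.
apply: lpW (lp_gap1 (ps0 i) h1 h1).
rewrite [leRHS]mulrDl [leLHS](_ : _ = 4 * C ^+ 2 * ps i); last by ring.
by rewrite lerDl; apply: mulr_ge0 (mulr_ge0 _ (sqr_ge0 _)) (ps0 i).
Qed.

Lemma Pbase_bd : uO true one (fun i => wt 3 (Pbase i)).
Proof.
have hN := uO_nlw c0 (ubase_bd c T K); have hA := ubase_bd c T K.
have h1 := uOM1 (m := fun i k => rc (asym c k)) c1 (fun _ k => nm_asym k c0) hA.
apply: uO_ext (uOB h1 (uOZ 4^-1 hN)) => i k.
by rewrite /wt /Pbase /P_coef /nlw; ring.
Qed.

Lemma freeze_error F G : uO true one (fun i => wt 3 (F i)) ->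
  uO true one (fun i => wt 3 (G i)) -> uO p s1 (fun i k =>
    bil (ps i) (ps i) (ps i) (F i) (G i) k - bil 0 0 (2 * ps i) (F i) (G i) k).
Proof.
move=> hF hG; have sF := uO_csummable (uO_wt0 false hF).
have [C [C0 H]] := uO_wt p (leqnSn 1) hF.
have [D [D0 H']] := uO_wt false (leqnSn 1) hG.
exists (2 * C * D); split=> [|i]; first by rewrite !mulr_ge0.
rewrite [X in lp _ _ X](_ : _ = 2 * ps i * (C * 1) * (D * 1)); last by ring.
exact: (lp_freeze (ps0 i) (sF i) (H i) (H' i)).
Qed.

Let wt_cj F : uO true one (fun i => wt 3 (F i)) -> uO true one (fun i => wt 3 (cj (F i))).
Proof. by move=> [C [C0 H]]; exists C; split => // i; exact: lp_wt_cj. Qed.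

Local Notation B1 x y i := (bil (- ps i) (- ps i) (ps i) x y).
Local Notation B2 x y i := (bil (- ps i) (ps i) (ps i) x y).
Local Notation B3 x y i := (bil (ps i) (ps i) (ps i) x y).

(** The square of u + conj u, with the flows of the moving frame. *)
Definition quadS i k : R[i] := B1 (vnext i) (vnext i) i k + 2 * B2 (vnext i) (cj (vnext i)) i k
  + B3 (cj (vnext i)) (cj (vnext i)) i k.

Lemma quadS_eq i k :
  cis (- (ps i * omega c k)) * convol (twice_re (unext i)) (twice_re (unext i)) k =
  cis (- (ps i * asym c k)) * quadS i k.
Proof.
have sv_s := uO_csummable (uO_wt0 false (vnext_bd c T K)) i.
have cv_s : csummable (cj (vnext i)) by have [C /lp_cj h] := sv_s; exists C.
have x_s := csummable_ex (- ps i) sv_s; have y_s := csummable_ex (ps i) cv_s.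
have -> : twice_re (unext i) = (fun j => ex (- ps i) (vnext i) j + ex (ps i) (cj (vnext i)) j).
  by apply/funext => j; rewrite /twice_re cj_unext unext_ex.
rewrite -bil0 bilDl //; last exact: csummableD.
rewrite !bilDr // [bil 0 0 0 (ex (ps i) _) (ex (- ps i) _) _]bilC // !bil0.
(* omega = k^2 + A: the free flow is absorbed by the bilinear forms. *)
rewrite (_ : - (ps i * omega c k) = - (ps i * asym c k) + - (ps i * sq k)); last first.
  by rewrite /asym; ring.
rewrite cisD -mulrA; congr (_ * _).
rewrite /quadS /bil ![ex (ps i) (convol _ _) k]/ex.
move: (convol _ _ k) (convol _ _ k) (convol _ _ k) => u v w.
by ring.
Qed.

Let bil_sqr (x y z : R) (a b : int -> R[i]) k : csummable a -> csummable b ->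
  bil x x z (fun j => a j + b j) (fun j => a j + b j) k =
  bil x x z a a k + 2 * bil x x z a b k + bil x x z b b k.
Proof.
move=> ha hb; have hab := csummableD ha hb.
by rewrite bilDl // !bilDr // [bil x x z b a k]bilC //; ring.
Qed.

Let bilDZr (x y z : R) (t : R[i]) (a b d : int -> R[i]) k :
  csummable a -> csummable b -> csummable d ->
  bil x y z a (fun j => t * b j + d j) k = t * bil x y z a b k + bil x y z a d k.
Proof.
move=> ha hb hd; have htb : csummable (fun j => t * b j).
  by apply: (csummableM (C := nm t)).
by rewrite bilDr // bilZr.
Qed.

Let bilDZl (x y z : R) (t : R[i]) (a b d : int -> R[i]) k :
  csummable a -> csummable b -> csummable d ->
  bil x y z (fun j => t * b j + d j) a k = t * bil x y z b a k + bil x y z d a k.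
Proof.
move=> ha hb hd; have htb : csummable (fun j => t * b j).
  by apply: (csummableM (C := nm t)).
by rewrite bilDl // bilZl.
Qed.

(** Every term is of second order except the resonance gap, which loses one order
    in l1. *)
Lemma quad_error : uO p eps (fun i k =>
  - 'i * (cis (- (ps i * omega c k)) * convol (twice_re (unext i)) (twice_re (unext i)) k)
  - quad_integrand c (ubase i) (ps i) k).
Proof.
pose ms := fun i : spot => - ps i; pose z0 := fun _ : spot => 0 : R.
have av q := uO_wt0 q (vnext_bd c T K); have aa q := uO_wt0 q (ubase_bd c T K).
have ad q := uO_wt0 q (vincr_bd T K c0); have ar q := vrem_bd T K c0 q.
have aP := uO_wt0 false Pbase_bd.
have hS : uO p one quadS.
  apply: uOD; last exact: bl (uO_cj (av p)) (uO_cj (av false)).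
  by apply: uOD; [exact: bl|apply: uOZ; exact: bl (uO_cj _)].
have hR : uO p s2 (fun i k =>
    (2 * B1 (ubase i) (vrem i) i k + B1 (vincr i) (vincr i) i k)
    + 2 * (B2 (vrem i) (cj (ubase i)) i k + B2 (ubase i) (cj (vrem i)) i k
           + B2 (vincr i) (cj (vincr i)) i k)
    + (2 * B3 (cj (ubase i)) (cj (vrem i)) i k + B3 (cj (vincr i)) (cj (vincr i)) i k)).
  apply: uOD; last first.
    apply: uOD; last exact: (bs s1 s1 s1 (uO_cj (ad p)) (uO_cj (ad false))).
    by apply: uOZ; exact: (br s1 s1 s1 (uO_cj (aa false)) (uO_cj (ar p))).
  apply: uOD.
    apply: uOD; last exact: (bs ms ms s1 (ad p) (ad false)).
    by apply: uOZ; exact: (br ms ms s1 (aa false) (ar p)).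
  apply: uOZ; apply: uOD; last exact: (bs ms s1 s1 (ad p) (uO_cj (ad false))).
  apply: uOD; first exact: (bl ms s1 s1 (ar p) (uO_cj (aa false))).
  exact: (br ms s1 s1 (aa false) (uO_cj (ar p))).
have hD : uO p s1 (fun i k =>
    (2 * B1 (ubase i) (vincr i) i k + B1 (vincr i) (vincr i) i k)
    + 2 * (B2 (vincr i) (cj (ubase i)) i k + B2 (ubase i) (cj (vincr i)) i k
           + B2 (vincr i) (cj (vincr i)) i k)
    + (2 * B3 (cj (ubase i)) (cj (vincr i)) i k + B3 (cj (vincr i)) (cj (vincr i)) i k)
    + (B3 (cj (ubase i)) (cj (ubase i)) i k
       - bil 0 0 (2 * ps i) (cj (ubase i)) (cj (ubase i)) k)).
  have w G : uO p s2 G -> uO p s1 G by apply: uO_le => i; rewrite sqr_ge0 ps2_le.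
  apply: uOD; last by apply: freeze_error; apply: wt_cj; exact: ubase_bd.
  apply: uOD; last first.
    apply: uOD; last exact: w (bs s1 s1 s1 (uO_cj (ad p)) (uO_cj (ad false))).
    by apply: uOZ; exact: (br s1 s1 s1 (uO_cj (aa false)) (uO_cj (ad p))).
  apply: uOD.
    apply: uOD; last exact: w (bs ms ms s1 (ad p) (ad false)).
    by apply: uOZ; exact: (br ms ms s1 (aa false) (ad p)).
  apply: uOZ; apply: uOD; last exact: w (bs ms s1 s1 (ad p) (uO_cj (ad false))).
  apply: uOD; first exact: (bl ms s1 s1 (ad p) (uO_cj (aa false))).
  exact: (br ms s1 s1 (aa false) (uO_cj (ad p))).
have hF : uO p s2 (fun i k => 2 * ('i * rc (ps i)) *
    (B3 (cj (ubase i)) (cj (Pbase i)) i k - bil 0 0 (2 * ps i) (cj (ubase i)) (cj (Pbase i)) k)).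
  have h := freeze_error (wt_cj (ubase_bd c T K)) (wt_cj Pbase_bd).
  apply: uOeq (uOM (g := s1) (D := 2) (m := fun i _ => 2 * ('i * rc (ps i))) _ _ _ h) => //.
  - by move=> i; exact: ps0.
  - move=> i _; rewrite -complexiE !nmM nmi mul1r nm_real (ger0_norm (ps0 i)).
    by rewrite (_ : 2 = rc 2) ?nm_real ?ger0_norm // rmorph_nat.
have hT := uOB (uOB (uOD (uOD (s2_eps (uO_taylor_rest hS)) (s2_eps hR)) gap_error)
  (s2_eps hF)) (s2_eps (uO_isA hD)).
apply: uO_ext (uOZ (- 'i) hT) => i k.
have cs F e : uO false e F -> csummable (F i) by move=> h; exact: (uO_csummable h i).
have ca := cs _ _ (aa false); have cd := cs _ _ (ad false).
have cr := cs _ _ (ar false); have cP := cs _ _ aP.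
have ca' := cs _ _ (uO_cj (aa false)); have cd' := cs _ _ (uO_cj (ad false)).
have cr' := cs _ _ (uO_cj (ar false)); have cP' := cs _ _ (uO_cj aP).
have dE : vincr i = (fun j => 'i * rc (ps i) * Pbase i j + vrem i j).
  by apply/funext => j; rewrite /vrem; ring.
have dE' : cj (vincr i) = (fun j => - ('i * rc (ps i)) * cj (Pbase i) j + cj (vrem i) j).
  by apply/funext => j; rewrite cj_vrem; ring.
have e3 b : T3 (ubase i) b (ps i) k = bil 0 0 (2 * ps i) (cj (ubase i)) (cj b) k.
  have e0 y : ex 0 y = y by apply/funext => j; rewrite /ex mul0r oppr0 cis0 mul1r.
  by rewrite /T3 /bil !e0.
have e1 : cj (T1 (ubase i) (ubase i) (ps i)) k =
    bil (ps i) (ps i) (- ps i) (cj (ubase i)) (cj (ubase i)) k.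
  have eC : cj (ex (- ps i) (ubase i)) = ex (ps i) (cj (ubase i)).
    by apply/funext => j; rewrite cj_ex opprK.
  rewrite /T1 cj_ex [LHS]/ex [RHS]/ex cj_convol; try exact: csummable_ex.
  by rewrite eC.
apply: esym; cbv beta; rewrite /quad_integrand !e3 e1 -[convol (cj _) _ _]bil0 /taylor_rest /gap.
apply: (@quad_alg R _ _ _ _ (quadS i k) _ (B1 (vnext i) (vnext i) i k) _ _ _
  (B2 (vnext i) (cj (vnext i)) i k) _ _ _ _ _ (B3 (cj (vnext i)) (cj (vnext i)) i k)).
- exact: i_sq.
- by rewrite {1 2}vnext_ad; exact: bil_sqr.
- by rewrite {1}dE; exact: bilDZr.
- rewrite {1}vnext_ad cj_vnext bilDl //; last exact: csummableD.
  rewrite !bilDr // [T2 _ _ _ k](_ : _ = B2 (ubase i) (cj (ubase i)) i k) //.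
  by ring.
- by rewrite {1}dE; exact: bilDZl.
- by rewrite dE'; exact: bilDZr.
- by rewrite cj_vnext; exact: bil_sqr.
- by rewrite dE'; exact: bilDZr.
- by [].
- exact: quadS_eq.
Qed.

End LocalError.

(** * Local error *)

Section OneStep.
Context {R : realType}.
Local Notation mu := (@lebesgue_measure R).
Local Notation rc := (real_complex R).
Local Notation sq := (@sq R).

Let step_alg (i e1 e2 w cc h q v : R[i]) :
  - (i * 4^-1) * (e1 * e2 * (w * (2 * cc * h + q * v))) =
  - (i * cc / 2) * (w * e1) * (e2 * h) + 4^-1 * (q * (w * e1)) * (- i * (e2 * v)).
Proof. by field. Qed.

Variables (p : bool) (c T K : R).
Hypothesis c0 : 0 < c.

Lemma mild_S2 U t : mild c T K U -> 0 <= t <= T -> S2 (U t).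
Proof. by move=> hU ht; exists (2 * K); exact: l2_l1 (mild_bd hU ht). Qed.

Lemma tfam_shift U t tau : mild c T K U -> 0 <= t -> t + tau <= T ->
  tfam `[0, tau] (fun r => U (t + r)).
Proof.
move=> hU t0 tT; have [m [C h]] := tfam_mild hU; split.
  by move=> k; apply: (cmeas_shift0 (f := U ^~ k) t0 tT); exact: m.
exists C => r; rewrite /= in_itv /= => /andP[r0 rt]; apply: h.
by rewrite /= in_itv /= addr_ge0 //= (le_trans _ tT) // lerD2l.
Qed.

(** The scheme and the Duhamel formula are integrals over the step with the same
    multipliers, and their integrands are compared by [lin_error] and [quad_error]. *)
Lemma local_error : exists C, 0 <= C /\ forall U t tau, mild c T K U ->
  0 <= t -> 0 < tau -> tau <= 1 -> t + tau <= T ->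
  lp p (fun k => U (t + tau) k - step_coef c tau (U t) k)
       (C * (tau * (if p then tau ^+ 2 else tau))).
Proof.
have [CY [CY0 hY]] := @lin_error R p c T K c0.
have [CX [CX0 hX]] := @quad_error R p c T K c0.
have c1 : 0 <= 1 + c by rewrite addr_ge0 // ltW.
exists ((1 + c) * CY + CX); split; first by rewrite addr_ge0 // mulr_ge0.
move=> U t tau hU t0 tau0 tau1 tT.
have mD : measurable (`[0, tau]%classic : set R) by exact: measurable_itv.
have muD := mu_itv_lty 0 tau.
have i_ B : tfam `[0, tau] B -> forall k, cinteg `[0, tau] (B ^~ k).
  by move=> tB; exact: (tfam_cinteg mD muD tB).
have tU := tfam_shift hU t0 tT.
have tH : tfam `[0, tau] (fun r => twice_re (U (t + r))).
  exact: (tfamD tU (tfam_cj tU)).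
have t_cis B : tfam `[0, tau] B ->
    tfam `[0, tau] (fun r k => cis (- (r * omega c k)) * B r k).
  apply: (@tfamM _ _ (fun r k => cis (- (r * omega c k))) 1) => //.
    move=> k; apply: cmeas_cis; apply: measurableT_comp => //.
    by apply: measurable_funM => //; exact: measurable_cst.
  by move=> r k _; rewrite nm_cis.
have tY' := t_cis _ tH.
have tX' := tfamZ (- 'i) (t_cis _ (tfam_convol tH tH)).
have St : S2 (U t).
  apply: mild_S2 hU _; rewrite t0; apply: le_trans tT.
  by rewrite lerDl; exact: (ltW tau0).
have st s : 0 <= s <= tau -> 0 <= s <= 1.
  by move=> /andP[-> h]; rewrite (le_trans h).
have sT s : 0 <= s <= tau -> t + s <= T.
  by move=> /andP[_ h]; apply: le_trans tT; rewrite lerD2l.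
set e := if p then _ else _.
have e_le s : 0 <= s <= tau -> 0 <= s ^+ 2 <= e /\ (if p then s ^+ 2 else s) <= e.
  move=> /andP[s0 sl]; have h2 : s ^+ 2 <= tau ^+ 2 by rewrite ler_pXn2r ?nnegrE ?(ltW tau0).
  rewrite sqr_ge0 /e; case: (p) => //; split => //.
  by apply: (le_trans h2); rewrite expr2 ler_piMr // ltW.
have e0 : 0 <= e.
  by have [/andP[a b] _] := e_le 0 (introT andP (conj (lexx 0) (ltW tau0))); exact: le_trans b.
have -> : ((1 + c) * CY + CX) * (tau * e) = tau * ((1 + c) * (CY * e) + CX * e) by ring.
apply: (lp_step_diff c0 tau0 (q := fun k => cis (tau * omega c k) * U t k)
   (i_ _ (tfam_lin_integrand c0 tau0 St)) (i_ _ tY') (i_ _ (tfam_quad_integrand c0 tau0 St)) (i_ _ tX')).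
- exact: mulr_ge0.
- exact: mulr_ge0.
- move=> s hs; have [/andP[_ h] _] := e_le s hs.
  apply: lpW (hY (Spot hU t0 (st s hs) (sT s hs))); exact: ler_wpM2l.
- move=> s hs; have [_ h] := e_le s hs.
  apply: lpW (hX (Spot hU t0 (st s hs) (sT s hs))); rewrite ler_wpM2l //.
- by move=> k; rewrite step_coefE.
move=> k; rewrite (mild_duh hU) ?(ltW tau0) // -addrA; congr (_ + _).
rewrite -mulNr -(cintZ mD (lmult c tau k)); last exact: i_ tY' k.
rewrite -(cintZ mD (qmult c tau k)); last exact: i_ tX' k.
rewrite -(cintD mD); [|by apply: (cintegZ mD); exact: i_ tY' k
  |by apply: (cintegZ mD); exact: i_ tX' k].
rewrite -(cintZ mD (- ('i * 4^-1))); last first.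
  have h1 : 0 <= tau <= 1 by rewrite tau1 ltW.
  apply: (@intN _ c T K c0 (Spot hU t0 h1 tT) (fun r => (tau - r) * omega c k)).
  apply: measurable_funM; last exact: measurable_cst.
  by apply: measurable_funB => //; exact: measurable_cst.
apply: eq_cint => r _.
rewrite mulrBl cisD /nlw /nls /lmult /qmult [rc (2 * c)]rmorphM rmorph_nat.
exact: step_alg.
Qed.

End OneStep.

(** * Convergence *)

Section Convergence.
Context {R : realType}.
Local Notation rc := (real_complex R).
Variables (c T K : R).
Hypotheses (c0 : 0 < c) (T0 : 0 < T).

Lemma S2_step_coef tau a : 0 < tau -> S2 a -> S2 (step_coef c tau a).
Proof.
by move=> tau0 sa; have [] := rep_Psi c0 tau0 (rep_Fs (S2_csummable sa)) sa.
Qed.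

(** A majorant of the error after n steps when each step adds an error C tau e and
    expands the previous one by 1 + D tau. *)
Definition gronwall (C D tau e : R) (n : nat) : R :=
  C * (n%:R * tau) * expR (D * (n%:R * tau)) * e.

Lemma gronwall_ge0 C D tau e n : 0 <= C -> 0 <= tau -> 0 <= e -> 0 <= gronwall C D tau e n.
Proof. by move=> *; rewrite /gronwall !mulr_ge0 // ?expR_ge0. Qed.

(** 1 + D tau <= e^(D tau), and the new local error is increased by the exponential. *)
Lemma gronwallS C D tau e n : 0 <= C -> 0 <= D -> 0 <= tau -> 0 <= e ->
  C * (tau * e) + (1 + D * tau) * gronwall C D tau e n <= gronwall C D tau e n.+1.
Proof.
move=> C0 D0 t0 e0; rewrite /gronwall.
have -> : n.+1%:R * tau = n%:R * tau + tau by rewrite -natr1 mulrDl mul1r.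
set x := n%:R * tau; have x0 : 0 <= x by rewrite mulr_ge0.
have -> : D * (x + tau) = D * x + D * tau by ring.
rewrite expRD; set E := expR (D * x); set F := expR (D * tau).
have E1 : 1 <= E by rewrite -expR0 ler_expR mulr_ge0.
have F1 : 1 + D * tau <= F by exact: expR_ge1Dx.
have F0 : 1 <= F by apply: le_trans F1; rewrite lerDl mulr_ge0.
have EF : 1 <= E * F by rewrite -[1]mulr1 ler_pM.
have -> : C * (x + tau) * (E * F) * e =
  C * (tau * e) * (E * F) + F * (C * x * E * e) by ring.
apply: lerD; first by rewrite ler_peMr // !mulr_ge0.
by rewrite ler_wpM2r // !mulr_ge0 // expR_ge0.
Qed.

Lemma gronwall_le C D tau e n : 0 <= C -> 0 <= D -> 0 <= tau -> 0 <= e -> n%:R * tau <= T ->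
  gronwall C D tau e n <= C * T * expR (D * T) * e.
Proof.
move=> C0 D0 t0 e0 h; rewrite /gronwall ler_wpM2r //.
have x0 : 0 <= n%:R * tau by rewrite mulr_ge0.
apply: ler_pM; rewrite ?mulr_ge0 ?expR_ge0 //; first by rewrite ler_wpM2l.
by rewrite ler_expR ler_wpM2l.
Qed.

(** The l1 estimate keeps the iterates bounded, which is what the stability of the
    l2 estimate needs. *)
Lemma converges : exists tau0 C, [/\ 0 < tau0, 0 <= C &
  forall U tau n, mild c T K U -> 0 < tau <= tau0 -> n%:R * tau <= T ->
  S2 (iter n (step_coef c tau) (U 0)) /\
  lp true (fun k => U (n%:R * tau) k - iter n (step_coef c tau) (U 0) k) (C * tau ^+ 2)].
Proof.
(* A bound in l1 for the solution, with a margin of 1 for the numerical error. *)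
pose L := 2 * `|K| + 1.
have L0 : 0 <= L by rewrite addr_ge0 // mulr_ge0.
have [C1 [C10 h1]] := local_error false T K c0.
have [C2 [C20 h2]] := local_error true T K c0.
have [D1 [D10 s1]] := step_coef_stable false c0 L0.
have [D2 [D20 s2]] := step_coef_stable true c0 L0.
pose B := C1 * T * expR (D1 * T).
have B0 : 0 <= B by rewrite !mulr_ge0 ?expR_ge0 // ltW.
(* With this tau0 the l1 error B tau stays below 1, within the margin of L. *)
exists (1 + B)^-1, (C2 * T * expR (D2 * T)); split.
- by rewrite invr_gt0 ltr_wpDr.
- by rewrite !mulr_ge0 ?expR_ge0 // ltW.
move=> U tau n hU /andP[t0 tle] nT; have t0' := ltW t0.
have t1 : tau <= 1 by apply: (le_trans tle); rewrite invf_le1 ?lerDl // ltr_wpDr.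
have Bt : B * tau <= 1.
  apply: (@le_trans _ _ ((1 + B) * (1 + B)^-1)); last by rewrite divff // gt_eqF // ltr_wpDr.
  by apply: ler_pM => //; rewrite lerDr.
have in_T m : m%:R * tau <= T -> 0 <= m%:R * tau <= T by move=> ->; rewrite mulr_ge0.
have UL t : 0 <= t <= T -> lp false (U t) (2 * `|K|).
  move=> ht; apply: lpW (lp_wt0 (l2_l1 (mild_bd hU ht))).
  by rewrite ler_pM2l // ler_norm.
have tele (x y w : R[i]) : x - y + (y - w) = x - w by ring.
have {nT} : [/\ S2 (iter n (step_coef c tau) (U 0)),
    lp false (fun k => U (n%:R * tau) k - iter n (step_coef c tau) (U 0) k)
      (gronwall C1 D1 tau tau n) &
    lp true (fun k => U (n%:R * tau) k - iter n (step_coef c tau) (U 0) k)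
      (gronwall C2 D2 tau (tau ^+ 2) n)] /\ n%:R * tau <= T.
  split=> //; elim: n nT => [_|n IH nT].
    rewrite /= mul0r; split; first by apply: mild_S2 hU _; rewrite lexx ltW.
      apply: lpW (gronwall_ge0 _ _ C10 t0' t0') (eq_lp _ (lp0 _)) => k.
      by rewrite subrr.
    apply: lpW (gronwall_ge0 _ _ C20 t0' (sqr_ge0 _)) (eq_lp _ (lp0 _)) => k.
    by rewrite subrr.
  have eT : n.+1%:R * tau = n%:R * tau + tau by rewrite -natr1 mulrDl mul1r.
  rewrite eT in nT *; have nT' : n%:R * tau <= T.
    by apply: le_trans nT; rewrite lerDl.
  have [Sn e1 e2] := IH nT'; set un := iter n _ _ in Sn e1 e2 *.
  have nT0 : 0 <= n%:R * tau by rewrite mulr_ge0.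
  have US : S2 (U (n%:R * tau)) by apply: mild_S2 hU (in_T _ nT').
  have lU : lp false (U (n%:R * tau)) L.
    by apply: lpW (UL _ (in_T _ nT')); rewrite lerDl.
  have lu : lp false un L.
    apply: (lpW (K := 2 * `|K| + gronwall C1 D1 tau tau n)).
      rewrite lerD2l; apply: le_trans Bt.
      exact: gronwall_le.
    by apply: eq_lp (lpB (UL _ (in_T _ nT')) e1) => k; rewrite opprB addrC subrK.
  split; first exact: S2_step_coef.
    apply: lpW (gronwallS n C10 D10 t0' t0') _.
    apply: eq_lp (lpD (h1 U _ tau hU nT0 t0 t1 nT) (s1 tau _ _ _ t0 t1 Sn US lu lU e1)).
    by move=> k; exact: tele.
  apply: lpW (gronwallS n C20 D20 t0' (sqr_ge0 tau)) _.
  apply: eq_lp (lpD (h2 U _ tau hU nT0 t0 t1 nT) (s2 tau _ _ _ t0 t1 Sn US lu lU e2)).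
  by move=> k; exact: tele.
move=> [[Sn _ e2] nT]; split => //.
by apply: lpW e2; apply: gronwall_le => //; exact: sqr_ge0.
Qed.

End Convergence.

Section Final.
Context {R : realType}.
Local Notation rc := (real_complex R).
Local Notation sq := (@sq R).
Variables (c T : R) (z zt : R -> R -> R).
Hypotheses (c0 : 0 < c) (T0 : 0 < T).
Hypothesis sol : boussinesq_solution c T z zt.
Hypothesis reg : forall t : R, 0 <= t <= T ->
  in_H 3 (toC (z t)) /\ in_H 1 (toC (zt t)).

Lemma mild_ucoef M : (Linf_norm T 3 (fun t => toC (z t))
    + Linf_norm T 1 (fun t => toC (zt t)) <= M%:E)%E ->
  mild c T (sup_bound c T M) (ucoef c z zt).
Proof.
move=> hM; split.
- by move=> t; exact: (ucoef_sup c0 T0 sol reg hM).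
- exact: (cmeas_ucoef c0 sol reg).
- by move=> t s k; exact: (duhamel c0 T0 sol reg hM).
Qed.

Lemma rep_u_num tau n : 0 < tau ->
  rep (u_num c tau (u_of c z zt 0) n) (iter n (step_coef c tau) (ucoef c z zt 0)) /\
  S2 (iter n (step_coef c tau) (ucoef c z zt 0)).
Proof.
move=> tau0; have h0 : 0 <= (0 : R) <= T by rewrite lexx ltW.
elim: n => [|n [r s]].
  by split; [exact: (ucoef_rep' c0 reg)|exact: (ucoef_S2 c0 reg)].
by rewrite /u_num !iterS; exact: (rep_Psi c0 tau0 r s).
Qed.

(** The errors in z and z_t are the symmetric and antisymmetric parts of the error in
    u; the second carries the factor omega, compensated by the norm in H^(-2). *)
Lemma error_bound tau t n E : 0 < tau -> 0 <= t <= T ->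
  lp true (fun k => ucoef c z zt t k - iter n (step_coef c tau) (ucoef c z zt 0) k) E ->
  (sobolev_norm 0 (toC (z t) \- z_num c tau (u_of c z zt 0) n)%R
   + sobolev_norm (- 2)%R (toC (zt t) \- zt_num c tau (u_of c z zt 0) n)%R
   <= ((2 + c) * E)%:E)%E.
Proof.
move=> tau0 ht he; have [ru Su] := rep_u_num n tau0.
set f := u_num _ _ _ _ in ru; set u := iter _ _ _ in ru Su he.
have [[_ i1 i2 _] [_ j1 j2 _]] := reg ht.
pose e k := ucoef c z zt t k - u k.
have half x : lp true x (E + E) -> lp true (fun k => 2^-1 * x k) E.
  move=> h; apply: lpW (lpZ 2^-1 h).
  rewrite (_ : 2^-1 = rc 2^-1); last by rewrite fmorphV rmorph_nat.
  by rewrite nm_real ger0_norm // le_eqVlt; apply/orP; left; apply/eqP; field.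
have hp : lp true (fun k => 2^-1 * (e k + cj e k)) E.
  by apply: half; apply: lpD => //; exact: lp_cj.
have hm : lp true (fun k => 2^-1 * (e k - cj e k)) E.
  by apply: half; apply: lpB => //; exact: lp_cj.
have cje k : cj e k = cj (ucoef c z zt t) k - cj u k.
  by rewrite /cj /e conjcD conjcN.
have rz : rep (toC (z t)) (fourier (toC (z t))) by split.
have rzt : rep (toC (zt t)) (fourier (toC (zt t))) by split.
have [_ F1] := repB rz (repZ 2^-1 (repD ru (rep_conj ru))).
have Sd : S2 (fun k => u k - cj u k) by apply: S2B => //; exact: S2_cj.
have cs : csummable (fun k => rc (omega c k) * (u k - cj u k)).
  apply: (S2_mul2 (C := 1 + c)) Sd => k.
  by rewrite nm_real ger0_norm ?omega_ge0 ?omega_le_W.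
have [_ F2] := repB rzt (repZ ('i / 2) (rep_fmult (repB ru (rep_conj ru)) cs)).
have c1 : 0 <= 1 + c by rewrite addr_ge0 // ltW.
rewrite (_ : (2 + c) * E = E + (1 + c) * E); last by ring.
rewrite EFinD; apply: leeD.
  apply: lp_sob0; apply: eq_lp hp => k; apply: etrans (esym (F1 k)).
  have := twice_re_ucoef c0 reg k ht; rewrite /twice_re => H.
  have -> : fourier (toC (z t)) k = 2^-1 * (ucoef c z zt t k + cj (ucoef c z zt t) k).
    by rewrite H mulrA mulVf ?mul1r // pnatr_eq0.
  rewrite cje /e.
  move: (ucoef c z zt t k) (cj _ k) (u k) (cj _ k) => x1 x2 x3 x4; ring.
apply: (lp_sobN2 c1 _ hm) => k; rewrite [fourier _ k]F2.
have H := ucoef_diff c0 reg k ht; rewrite -[fourier _ k]H.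
have -> : 'i / 2 * (rc (omega c k) * (ucoef c z zt t k - cj (ucoef c z zt t) k))
    - 'i / 2 * (rc (omega c k) * (u k - cj u k)) =
  'i * (rc (omega c k) * (2^-1 * (e k - cj e k))).
  rewrite cje /e.
  move: (ucoef c z zt t k) (cj _ k) (u k) (cj _ k) => x1 x2 x3 x4; ring.
rewrite -complexiE nmM nmi mul1r nmM nm_real ger0_norm ?omega_ge0 //.
rewrite ler_wpM2r ?nm_ge0 //; apply: (le_trans (omega_le k c0)).
by have := mulr_ge0 (ltW c0) (sq_ge0 (R := R) k); rewrite -/(sq k); lra.
Qed.

End Final.

Unset Implicit Arguments.

Theorem corollary4p5 (R : realType) :
  exists C : R -> R -> R -> R,
  forall (c T : R) (z zt : R -> R -> R),
    0 < c -> 0 < T ->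
    boussinesq_solution c T z zt ->
    (forall t : R, 0 <= t <= T ->
       in_H 3 (toC (z t)) /\ in_H 1 (toC (zt t))) ->
    let M := (Linf_norm T 3 (fun t => toC (z t))
              + Linf_norm T 1 (fun t => toC (zt t)))%E in
    (M < +oo)%E ->
    exists tau0 : R, 0 < tau0 /\
      forall (tau : R) (n : nat),
        0 < tau <= tau0 -> n%:R * tau <= T ->
        let u0 := u_of c z zt 0 in
        let t_n := n%:R * tau in
        let err := toC (z t_n) \- z_num c tau u0 n in
        let err_t := toC (zt t_n) \- zt_num c tau u0 n in
        (sobolev_norm 0 err + sobolev_norm (- 2)%R err_t
         <= (C T c (fine M) * tau ^+ 2)%:E)%E.
Proof.
(* The constant is chosen from (T, c, M) before the solution is given. *)
pose good (T c M C : R) := 0 < c -> 0 < T -> exists tau0 : R, 0 < tau0 /\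
  forall U tau n, mild c T (sup_bound c T M) U -> 0 < tau <= tau0 ->
  n%:R * tau <= T ->
  lp true (fun k => U (n%:R * tau) k - iter n (step_coef c tau) (U 0) k) (C * tau ^+ 2).
have ex_good (x : R * R * R) : exists C, good x.1.1 x.1.2 x.2 C.
  case: x => -[T c] M /=; have [c0|/negP c0] := boolP (0 < c); last by exists 0.
  have [T0|/negP T0] := boolP (0 < T); last by exists 0.
  have [tau0 [C [t0 _ h]]] := converges (sup_bound c T M) c0 T0.
  exists C => _ _; exists tau0; split => // U tau n hU ht nT.
  by have [] := h U tau n hU ht nT.
have [F hF] := choice ex_good.
exists (fun T c M => (2 + c) * F (T, c, M)) => c T z zt c0 T0 sol reg M Mfin.
have M0 : (0 <= M)%E by rewrite adde_ge0 // Linf_ge0.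
have hM : (M <= (fine M)%:E)%E by rewrite fineK // ge0_fin_numE.
have [tau0 [t0 h]] := hF (T, c, fine M) c0 T0.
exists tau0; split => // tau n /andP[tau_gt0 tle] nT; cbv zeta.
rewrite -mulrA; apply: (error_bound c0 T0 reg) => //.
  by rewrite mulr_ge0 // ltW.
by apply: h => //; [exact: mild_ucoef|rewrite tau_gt0].
Qed.
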